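(* Let $s > 1/2$, and for real $\lambda$ with $|\lambda|>1$ let $R_0^{\pm}(\lambda)$ be the extended resolvents of the free Dirac operator $H_0$. Then $R_0^{\pm}(\lambda)$ converge strongly to $0$ as $|\lambda|\to\infty$, i.e., for any $f\in\mathcal L_{2,s}$, $$R_0^{\pm}(\lambda) f \longrightarrow 0 \quad\text{in } \mathcal L_{2,-s}\qquad\text{as } |\lambda|\to\infty.$$
   Context: Notation: $\langle x\rangle = \sqrt{1+|x|^2}$. For $s\in\mathbf R$, $L_{2,s}(\mathbf R^3)=\{f : \langle x\rangle^s f\in L_2(\mathbf R^3)\}$ with norm $\|f\|_s = \big(\int_{\mathbf R^3}\langle x\rangle^{2s}|f(x)|^2dx\big)^{1/2}$, and $\mathcal L_{2,s}=[L_{2,s}(\mathbf R^3)]^4$ is the Hilbert space direct sum, with norm again denoted $\|\cdot\|_s$; $\mathcal L_2=\mathcal L_{2,0}$. Dirac matrices: $\alpha_1,\alpha_2,\alpha_3$ and $\alpha_4=\beta$ are $4\times4$ Hermitian matrices with $\alpha_j\alpha_k+\alpha_k\alpha_j=2\delta_{jk}I$ for $j,k=1,2,3,4$. Free Dirac operator: $H_0=-i\sum_{j=1}^3\alpha_j\frac{\partial}{\partial x_j}+\beta$, the selfadjoint operator in $\mathcal L_2$ with domain $[H^1(\mathbf R^3)]^4$ (the selfadjoint extension of the essentially selfadjoint restriction to $[C_0^\infty(\mathbf R^3)]^4$). $R_0(z)=(H_0-z)^{-1}$. Extended resolvents (limiting absorption principle, known): for $s>1/2$ and real $\lambda\in(-\infty,-1)\cup(1,\infty)$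 there exist bounded operators $R_0^{\pm}(\lambda):\mathcal L_{2,s}\to\mathcal L_{2,-s}$ such that for every $f\in\mathcal L_{2,s}$, $R_0(\lambda\pm i\mu)f\to R_0^{\pm}(\lambda)f$ in $\mathcal L_{2,-s}$ as $\mu\downarrow0$. *)

(* Defs.v *)
From HB Require Import structures.
From mathcomp Require Import all_boot all_order all_algebra.
From mathcomp Require Import complex.
From mathcomp Require Import all_classical all_reals all_analysis.

Set Implicit Arguments.
Unset Strict Implicit.
Unset Printing Implicit Defensive.
Import Order.TTheory GRing.Theory Num.Theory.
Import numFieldNormedType.Exports.

Local Open Scope classical_set_scope.
Local Open Scope ring_scope.
Local Open Scope complex_scope.

(* Points of R^3 have type R * R * R, which has a normed module structure. On   *)
(* each factor the library's Lebesgue measure is attached to measurableTypeR R *)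
(* (R with its Borel sigma-algebra).                                           *)
Definition leb3 {R : realType} :
    set (measurableTypeR R * measurableTypeR R * measurableTypeR R) -> \bar R :=
  ((@lebesgue_measure R \x @lebesgue_measure R) \x @lebesgue_measure R)%E.

HB.instance Definition _ (R : realType) := Measure.on (@leb3 R).

Definition unit_vec {R : realType} (j : 'I_3) : R * R * R :=
  ((val j == 0%N)%:R, (val j == 1%N)%:R, (val j == 2%N)%:R).

(* <x> with |x| the Euclidean norm; the library norm on the product R * R * R  *)
(* is the sup norm, hence the explicit sum of squares.                         *)
Definition japanese {R : realType} (x : R * R * R) : R :=
  Num.sqrt (1 + (x.1.1 ^+ 2 + x.1.2 ^+ 2 + x.2 ^+ 2)).

(* Elements of the L_2-type spaces are represented by functions; identities    *)
(* between them are required almost everywhere only.                           *)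
Definition scalar_field (R : realType) : Type := R * R * R -> R[i].
Definition spinor (R : realType) : Type := R * R * R -> 'cV[R[i]]_4.

Definition component {R : realType} (f : spinor R) (k : 'I_4) : scalar_field R :=
  fun x => f x k 0.

Definition wnorm_sq {R : realType} (s : R) (f : scalar_field R) : \bar R :=
  (\int[leb3]_x
     (japanese x `^ (2 * s) *
      (complex.Re (f x) ^+ 2 + complex.Im (f x) ^+ 2))%:E)%E.

Definition in_L2 {R : realType} (s : R) (f : scalar_field R) : Prop :=
  [/\ measurable_fun setT (fun x => complex.Re (f x)),
      measurable_fun setT (fun x => complex.Im (f x)) &
      (wnorm_sq s f < +oo)%E].

Definition spinor_norm {R : realType} (s : R) (f : spinor R) : \bar R :=
  ((\sum_(k < 4) wnorm_sq s (component f k)) `^ 2^-1)%E.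

Definition in_spinor_L2 {R : realType} (s : R) (f : spinor R) : Prop :=
  forall k, in_L2 s (component f k).

Definition spinor_ae_eq {R : realType} (f g : spinor R) : Prop :=
  {ae leb3, forall x, f x = g x}.

Fixpoint Cn {R : realType} (n : nat) (phi : R * R * R -> R) : Prop :=
  continuous phi /\
  if n is m.+1 then
    forall j, (forall x, derivable phi x (unit_vec j)) /\
              Cn m (fun x => 'D_(unit_vec j) phi x)
  else True.

Definition test_function {R : realType} (phi : R * R * R -> R) : Prop :=
  (forall n, Cn n phi) /\ compact (closure [set x | phi x != 0]).

Definition weak_partial_real {R : realType} (j : 'I_3)
    (u g : R * R * R -> R) : Prop :=
  forall phi, test_function phi ->
    \int[leb3]_x (u x * 'D_(unit_vec j) phi x) = - \int[leb3]_x (g x * phi x).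

(* Testing against real-valued functions is enough, so that the real and       *)
(* imaginary parts can be treated separately.                                  *)
Definition weak_partial {R : realType} (j : 'I_3) (u g : scalar_field R) : Prop :=
  weak_partial_real j (fun x => complex.Re (u x)) (fun x => complex.Re (g x)) /\
  weak_partial_real j (fun x => complex.Im (u x)) (fun x => complex.Im (g x)).

Definition in_H1 {R : realType} (u : scalar_field R) : Prop :=
  in_L2 0 u /\ forall j, exists g, in_L2 0 g /\ weak_partial j u g.

(* A representative of the weak derivative of u; meaningful for u in H^1.      *)
Definition wpartial {R : realType} (j : 'I_3) (u : scalar_field R) :
    scalar_field R :=
  xget (fun=> 0) [set g : R * R * R -> R[i] | in_L2 0 g /\ weak_partial j u g].

Definition in_spinor_H1 {R : realType} (u : spinor R) : Prop :=
  forall k, in_H1 (component u k).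

Definition spinor_wpartial {R : realType} (j : 'I_3) (u : spinor R) : spinor R :=
  fun x => \col_k wpartial j (component u k) x.

(* alpha 0, alpha 1, alpha 2 are the matrices alpha_1, alpha_2, alpha_3 and    *)
(* alpha 3 (= alpha ord_max) is alpha_4 = beta.                                *)
Definition dirac_matrices {R : realType} (alpha : 'I_4 -> 'M[R[i]]_4) : Prop :=
  (forall j, map_mx conjc (alpha j)^T = alpha j) /\
  (forall j k, alpha j *m alpha k + alpha k *m alpha j =
               ((j == k)%:R *+ 2)%:M).

(* The free Dirac operator, with domain in_spinor_H1. *)
Definition dirac_op {R : realType} (alpha : 'I_4 -> 'M[R[i]]_4) (u : spinor R) :
    spinor R :=
  fun x => (0 -i* 1) *: (\sum_(j < 3)
             alpha (widen_ord (leqnSn 3) j) *m spinor_wpartial j u x)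
           + alpha ord_max *m u x.

(* T = (H_0 - z)^{-1}: a two-sided inverse of the bijection H_0 - z from the   *)
(* domain of H_0 onto L_2.                                                     *)
Definition dirac_resolvent {R : realType} (alpha : 'I_4 -> 'M[R[i]]_4)
    (z : R[i]) (T : spinor R -> spinor R) : Prop :=
  (forall f, in_spinor_L2 0 f ->
     in_spinor_H1 (T f) /\
     spinor_ae_eq (fun x => dirac_op alpha (T f) x - z *: T f x) f) /\
  (forall u, in_spinor_H1 u ->
     spinor_ae_eq (T (fun x => dirac_op alpha u x - z *: u x)) u).

Definition bounded_operator {R : realType} (s t : R)
    (T : spinor R -> spinor R) : Prop :=
  [/\ forall f, in_spinor_L2 s f -> in_spinor_L2 t (T f),
      forall (a : R[i]) f g, in_spinor_L2 s f -> in_spinor_L2 s g ->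
        spinor_ae_eq (T (fun x => a *: f x + g x))
                     (fun x => a *: T f x + T g x) &
      exists C : R, forall f, in_spinor_L2 s f ->
        (spinor_norm t (T f) <= C%:E * spinor_norm s f)%E].

(* T is R_0^+(lam) for sigma = 1 and R_0^-(lam) for sigma = -1, as an operator *)
(* from L_{2,s} to L_{2,-s}; R0 is the family of resolvents of H_0.            *)
Definition extended_resolvent {R : realType}
    (R0 : R[i] -> spinor R -> spinor R) (s sigma lam : R)
    (T : spinor R -> spinor R) : Prop :=
  bounded_operator s (- s) T /\
  forall f, in_spinor_L2 s f ->
    spinor_norm (- s) (fun x => R0 (lam +i* (sigma * mu)) f x - T f x)
      @[mu --> 0^'+] --> 0%E.

(* Main.v *)
(* (H - z)(H + z) = - Delta + 1 - z^2, so
   the solution of (H - z) u = f is u = (H + z) w with w solving a Helmholtz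
   equation componentwise. The multiplier identity for the vector field
   x (<x>^-1 - <x>^(-2s) / 2), combined with the energy identities, bounds
   <x>^-s grad w and z <x>^-s w by <x>^s f; hence, for 1/2 < s < 1, the
   resolvents are bounded from L_{2,s} to L_{2,-s} uniformly for |Re z| large
   and 0 < |Im z| <= 1. It remains to find enough f with R(z) f -> 0. Truncate f
   and put u_n = n (n + i H)^-1 f; then R(z) u_n = z^-1 (R(z) H u_n - u_n) is
   O(1 / |z|). The u_n are bounded in L_{2,1}, since weights commute with the
   resolvent up to bounded terms, and Cauchy in L_2, since |u_n| increases with
   n; by interpolation they are Cauchy in L_{2,s}. Finally R(z) (f - u_m)
   tends to 0 in L_2 as m -> oo for each fixed z, so the L_2-limit of u_n need
   not be identified.
   A weak derivative is used in integrated form: u (. + t v) - u is t times the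
   average of g over the segments [x, x + t v] (Steklov averages). *)

(* The boundary values are reached from non-real z, so no lower bound on |Im z| may enter. In the
   multiplier identity Re z^2 drops out, because 2 a.grad + div a is skew; but nu = Im z^2 leaves a
   cross term nu (i w, a.grad w), unweighted and with no small factor. It is absorbed by pairing the
   equation with i w: this gives |nu| |w|^2 = |(F, i w)| for the source F, and F brings the weight
   back. In the vector field, x <x>^-1 alone has a Jacobian whose radial eigenvalue is only <x>^-3;
   the subtracted term x <x>^(-2s) / 2 raises the lower bound for twice the Jacobian to (2s - 1)
   <x>^(-2s), which is where s > 1/2 is used. The bound s < 1 costs nothing, since the weighted
   spaces are nested. The solution w is only known to be in H^1, while the identities need second
   derivatives. They are applied to averages of w over short segments, and the length is then sent
   to 0, so that no elliptic regularity has to be proved. Multiplication by i becomes a real matrix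
   J with J^2 = -1, and all pairings are real. *)
From HB Require Import structures.
Require Import Defs.
From mathcomp Require Import all_boot all_order all_algebra.
From mathcomp Require Import complex.
From mathcomp Require Import all_classical all_reals all_analysis.
From mathcomp Require Import measurable_realfun ring lra.
Set Implicit Arguments.
Unset Strict Implicit.
Unset Printing Implicit Defensive.
Import Order.TTheory GRing.Theory Num.Theory.
Import numFieldNormedType.Exports.
Local Open Scope classical_set_scope.
Local Open Scope ring_scope.

(** * Square-integrable functions *)

(* Locking the operations keeps unification from unfolding integrals. *)
Fact lkey : unit. Proof. exact: tt. Qed.

Section L2.
Context d (T : measurableType d) (R : realType) (mu : {measure set T -> \bar R}).
Implicit Types (f g : T -> R).

Definition sqint : {pred T -> R} := mem [set f : T -> R |
  measurable_fun setT f /\ (\int[mu]_x ((f x) ^+ 2)%:E < +oo)%E].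

Lemma sqintP f : f \in sqint <->
  measurable_fun setT f /\ (\int[mu]_x ((f x) ^+ 2)%:E < +oo)%E.
Proof. by rewrite inE. Qed.

Lemma measurable_sqrE f : measurable_fun setT f ->
  measurable_fun setT (EFin \o (fun x => f x ^+ 2)).
Proof. by move=> mf; apply/measurable_EFinP; exact: measurable_funX. Qed.

Lemma sqint_le f g : measurable_fun setT f -> g \in sqint ->
  (forall x, f x ^+ 2 <= g x ^+ 2) -> f \in sqint.
Proof.
move=> mf /sqintP[mg ig] fg; apply/sqintP; split => //.
apply: le_lt_trans ig; apply: ge0_le_integral => //.
- by move=> x _; rewrite lee_fin sqr_ge0.
- exact: measurable_sqrE.
- exact: measurable_sqrE.
- by move=> x _; rewrite lee_fin.
Qed.

Lemma sqint_integrable f : f \in sqint ->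
  mu.-integrable setT (EFin \o (fun x => f x ^+ 2)).
Proof.
move=> /sqintP[mf fi]; apply/integrableP; split; first exact: measurable_sqrE.
rewrite (eq_integral (fun x => (f x ^+ 2)%:E)) // => x _ /=.
by rewrite ger0_norm ?sqr_ge0.
Qed.

Lemma sqint_mul_integrable f g : f \in sqint -> g \in sqint ->
  mu.-integrable setT (EFin \o (fun x => f x * g x)).
Proof.
move=> fi gi; have /sqintP[mf _] := fi; have /sqintP[mg _] := gi.
have := integrableD measurableT (sqint_integrable fi) (sqint_integrable gi).
apply: le_integrable => //.
  by apply/measurable_EFinP; exact: measurable_funM.
move=> x _ /=; rewrite lee_fin [leRHS]ger0_norm ?addr_ge0 ?sqr_ge0 // normrM.
have := sqr_ge0 (`|f x| - `|g x|).
rewrite -(real_normK (num_real (f x))) -(real_normK (num_real (g x))).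
have := normr_ge0 (f x); have := normr_ge0 (g x); nra.
Qed.

Lemma sqint_submod : submod_closed sqint.
Proof.
split=> [|a f g fi gi].
  apply/sqintP; split; first exact: measurable_cst.
  by under eq_integral do rewrite expr0n/=; rewrite integral0.
have /sqintP[mf _] := fi; have /sqintP[mg _] := gi.
have mS : measurable_fun setT (a *: f + g).
  by apply: measurable_funD => //; exact: measurable_funM.
apply/sqintP; split => //.
have : mu.-integrable setT (EFin \o (fun x => (2 * a ^+ 2) * f x ^+ 2 + 2 * g x ^+ 2)).
  rewrite (_ : _ \o _ = (fun x => (2 * a ^+ 2)%:E * (f x ^+ 2)%:E + 2%:E * (g x ^+ 2)%:E)%E) //.
  by apply: integrableD => //; apply: integrableZl => //; exact: sqint_integrable.
move=> /integrable_lty => /(_ measurableT) H; apply: le_lt_trans H.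
apply: ge0_le_integral => //.
- by move=> x _; rewrite lee_fin sqr_ge0.
- exact: measurable_sqrE.
- apply/measurable_EFinP; apply: measurable_funD; apply: measurable_funM => //; exact: measurable_funX.
- move=> x _; rewrite lee_fin /=.
  have -> : (a *: f + g) x = a * f x + g x by [].
  rewrite -subr_ge0 (_ : _ - _ = (a * f x - g x) ^+ 2) ?sqr_ge0 //; ring.
Qed.

HB.instance Definition _ := GRing.isSubmodClosed.Build _ _ sqint sqint_submod.

(** Elements are functions, not classes modulo null sets, so [nrm2] is only a seminorm and equality
    is pointwise. Identities up to null sets are expressed by pairing with every element ([weq]
    below). *)
Record L2 := MkL2 { l2fun :> T -> R ; l2funP : l2fun \in sqint }.
HB.instance Definition _ := [isSub for l2fun].
HB.instance Definition _ := [Choice of L2 by <:].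
HB.instance Definition _ := [SubChoice_isSubLmodule of L2 by <:].

Definition toL2 f : L2 := insubd 0 f.

Lemma toL2E f : f \in sqint -> toL2 f = f :> (T -> R).
Proof. by move=> fi; rewrite /toL2 /insubd insubT. Qed.

Lemma L2_measurable (u : L2) : measurable_fun setT u.
Proof. by have /sqintP[] := l2funP u. Qed.

Lemma L2_int (u v : L2) : mu.-integrable setT (EFin \o (fun x => u x * v x)).
Proof. by apply: sqint_mul_integrable; exact: l2funP. Qed.

Lemma L2DE (u v : L2) x : (u + v) x = u x + v x. Proof. by []. Qed.
Lemma L2NE (u : L2) x : (- u) x = - u x. Proof. by []. Qed.
Lemma L2BE (u v : L2) x : (u - v) x = u x - v x. Proof. by []. Qed.
Lemma L2ZE a (u : L2) x : (a *: u) x = a * u x. Proof. by []. Qed.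
Lemma L2sumE I r (P : pred I) (F : I -> L2) x :
  (\sum_(i <- r | P i) F i) x = \sum_(i <- r | P i) F i x.
Proof. by elim/big_ind2 : _ => // a ? b ? <- <-. Qed.

Definition ip := locked_with lkey (fun u v : L2 => \int[mu]_x (u x * v x)).

Lemma ipE u v : ip u v = \int[mu]_x (u x * v x).
Proof. by rewrite /ip unlock. Qed.

Lemma ipC u v : ip u v = ip v u.
Proof. by rewrite !ipE; apply: eq_Rintegral => x _; rewrite mulrC. Qed.

Lemma ipDl u v w : ip (u + v) w = ip u w + ip v w.
Proof.
rewrite !ipE -RintegralD//; [|exact: L2_int|exact: L2_int].
by apply: eq_Rintegral => x _; rewrite L2DE mulrDl.
Qed.

Lemma ipZl a u w : ip (a *: u) w = a * ip u w.
Proof.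
rewrite !ipE -RintegralZl//; last exact: L2_int.
by apply: eq_Rintegral => x _; rewrite L2ZE mulrA.
Qed.

Lemma ipNl u w : ip (- u) w = - ip u w.
Proof. by rewrite -scaleN1r ipZl mulN1r. Qed.
Lemma ipBl u v w : ip (u - v) w = ip u w - ip v w.
Proof. by rewrite ipDl ipNl. Qed.
Lemma ipDr u v w : ip w (u + v) = ip w u + ip w v.
Proof. by rewrite ipC ipDl !(ipC _ w). Qed.
Lemma ipZr a u w : ip w (a *: u) = a * ip w u.
Proof. by rewrite ipC ipZl (ipC _ w). Qed.
Lemma ipNr u w : ip w (- u) = - ip w u.
Proof. by rewrite ipC ipNl (ipC _ w). Qed.
Lemma ipBr u v w : ip w (u - v) = ip w u - ip w v.
Proof. by rewrite ipDr ipNr. Qed.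
Lemma ip0l u : ip 0 u = 0.
Proof. by rewrite -(scale0r 0) ipZl mul0r. Qed.
Lemma ip0r u : ip u 0 = 0. Proof. by rewrite ipC ip0l. Qed.
Lemma ip_suml I r (P : pred I) (F : I -> L2) w :
  ip (\sum_(i <- r | P i) F i) w = \sum_(i <- r | P i) ip (F i) w.
Proof. by apply: (big_morph (fun u => ip u w)) => [u v|]; rewrite ?ipDl ?ip0l. Qed.
Lemma ip_sumr I r (P : pred I) (F : I -> L2) w :
  ip w (\sum_(i <- r | P i) F i) = \sum_(i <- r | P i) ip w (F i).
Proof. by rewrite ipC ip_suml; apply: eq_bigr => i _; rewrite ipC. Qed.

Definition nrm2 u := ip u u.
Lemma nrm2_ge0 u : 0 <= nrm2 u.
Proof. by rewrite /nrm2 ipE; apply: Rintegral_ge0 => x _; rewrite -expr2 sqr_ge0. Qed.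

(** Multiply by [t] the nonnegative squares of [u - t^-1 v] and [u + t^-1 v]. The free [t] is what
    later splits a cross term into a large and a small part. *)
Lemma ip_AMGM u v (t : R) : 0 < t -> 2 * `|ip u v| <= t * nrm2 u + t^-1 * nrm2 v.
Proof.
move=> t0; have ti : t * t^-1 = 1 by rewrite divff ?gt_eqF.
have ti0 : 0 < t^-1 by rewrite invr_gt0.
have H w z : 0 <= nrm2 w - z *+ 2 * ip w v + z ^+ 2 * nrm2 v.
  have := nrm2_ge0 (w - z *: v).
  rewrite /nrm2 !(ipBl, ipBr, ipZl, ipZr) (ipC v); lra.
have := H u t^-1; have := H u (- t^-1).
have := nrm2_ge0 v; move: (nrm2 u) (nrm2 v) (ip u v) => a b c b0 h1 h2.
have k : t * t^-1 ^+ 2 = t^-1 by rewrite expr2 mulrA ti mul1r.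
have := mulr_ge0 (ltW t0) h1; have := mulr_ge0 (ltW t0) h2.
have -> : t * (a - t^-1 *+ 2 * c + t^-1 ^+ 2 * b) = t * a - 2 * c * (t * t^-1) + t * t^-1 ^+ 2 * b by ring.
have -> : t * (a - - t^-1 *+ 2 * c + (- t^-1) ^+ 2 * b) = t * a + 2 * c * (t * t^-1) + t * t^-1 ^+ 2 * b by ring.
by rewrite k ti !mulr1; case: (ger0P c) => c0; lra.
Qed.

Lemma ip_CS u v : ip u v ^+ 2 <= nrm2 u * nrm2 v.
Proof.
have H z y : 0 <= y ^+ 2 * nrm2 u - 2 * z * y * ip u v + z ^+ 2 * nrm2 v.
  have := nrm2_ge0 (y *: u - z *: v).
  rewrite /nrm2 !(ipBl, ipBr, ipZl, ipZr) (ipC v); lra.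
have [b0|b0] := eqVneq (nrm2 v) 0; last first.
  have bp : 0 < nrm2 v by rewrite lt_def b0 nrm2_ge0.
  have := H (ip u v) (nrm2 v); move=> h; rewrite -subr_ge0 -(pmulr_rge0 _ bp); move: h.
  rewrite (_ : nrm2 v ^+ 2 * nrm2 u - 2 * ip u v * nrm2 v * ip u v + ip u v ^+ 2 * nrm2 v = nrm2 v * (nrm2 u * nrm2 v - ip u v ^+ 2)) //; ring.
rewrite b0 mulr0; have [c0|c0] := eqVneq (ip u v) 0; first by rewrite c0 expr0n.
(* If [nrm2 v] vanished but [ip u v] did not, subtracting this multiple of [v] from [u] would give a
   square equal to -1. *)
have := H ((nrm2 u + 1) / (2 * ip u v)) 1; rewrite b0 mulr0 addr0 expr1n mul1r mulr1.
have -> : 2 * ((nrm2 u + 1) / (2 * ip u v)) * ip u v = nrm2 u + 1 by field.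
lra.
Qed.

Lemma nrm2D u v : nrm2 (u + v) <= 2 * nrm2 u + 2 * nrm2 v.
Proof.
have := nrm2_ge0 (u - v); rewrite /nrm2 !(ipDl, ipDr, ipNl, ipNr) (ipC v u); lra.
Qed.

Lemma nrm2Z a u : nrm2 (a *: u) = a ^+ 2 * nrm2 u.
Proof. by rewrite /nrm2 ipZl ipZr mulrA. Qed.

Lemma nrm2E u : (nrm2 u)%:E = (\int[mu]_x (u x ^+ 2)%:E)%E.
Proof.
rewrite /nrm2 ipE /Rintegral fineK; last exact: integrable_fin_num (L2_int u u).
by apply: eq_integral => x _; rewrite expr2.
Qed.

Definition aeq (u v : T -> R) := {ae mu, forall x, u x = v x}.

Lemma ip_aeq (u v w : L2) : aeq u v -> ip u w = ip v w.
Proof.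
move=> uv; rewrite !ipE; congr fine; apply: ae_eq_integral => //.
- by apply/measurable_EFinP; apply: measurable_funM; exact: L2_measurable.
- by apply/measurable_EFinP; apply: measurable_funM; exact: L2_measurable.
- by move: uv; apply: filterS => x -> _.
Qed.

Definition bm (a : T -> R) := measurable_fun setT a /\ exists M, forall x, `|a x| <= M.

Definition bmul := locked_with lkey (fun (a : T -> R) (u : L2) => toL2 (fun x => a x * u x)).

Lemma bmul_sqint a (u : L2) : bm a -> (fun x => a x * u x) \in sqint.
Proof.
case=> ma [M aM]; apply: (@sqint_le _ ((M *: u) : L2)).
- by apply: measurable_funM => //; exact: L2_measurable.
- exact: l2funP.
- move=> x; rewrite L2ZE !exprMn ler_wpM2r ?sqr_ge0 //.
  by rewrite -(real_normK (num_real (a x))) lerXn2r ?nnegrE// (le_trans _ (aM x)).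
Qed.

Lemma bmulE a u x : bm a -> bmul a u x = a x * u x.
Proof. by move=> ba; rewrite /bmul unlock toL2E //; exact: bmul_sqint. Qed.

Lemma L2_eqP (u v : L2) : (forall x, u x = v x) -> u = v.
Proof. by move=> uv; apply/val_inj/funext. Qed.

Lemma bmulD a u v : bm a -> bmul a (u + v) = bmul a u + bmul a v.
Proof. by move=> ba; apply: L2_eqP => x; rewrite L2DE !bmulE // L2DE mulrDr. Qed.
Lemma bmulZ a c u : bm a -> bmul a (c *: u) = c *: bmul a u.
Proof. by move=> ba; apply: L2_eqP => x; rewrite L2ZE !bmulE // L2ZE; ring. Qed.
Lemma bmulDl a b u : bm a -> bm b -> bmul (fun x => a x + b x) u = bmul a u + bmul b u.
Proof.
move=> ba bb; apply: L2_eqP => x; rewrite L2DE !bmulE // ?mulrDl//.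
case: ba bb => ma [M aM] [mb [N bN]]; split; first exact: measurable_funD.
by exists (M + N) => y; rewrite (le_trans (ler_normD _ _)) // lerD.
Qed.
Lemma ip_bmul a u v : bm a -> ip (bmul a u) v = ip u (bmul a v).
Proof. by move=> ba; rewrite !ipE; apply: eq_Rintegral => x _; rewrite !bmulE //; ring. Qed.

Lemma bmM a b : bm a -> bm b -> bm (fun x => a x * b x).
Proof.
case=> ma [M aM] [mb [N bN]]; split; first exact: measurable_funM.
by exists (M * N) => x; rewrite normrM ler_pM.
Qed.
Lemma bmD a b : bm a -> bm b -> bm (fun x => a x + b x).
Proof.
case=> ma [M aM] [mb [N bN]]; split; first exact: measurable_funD.
by exists (M + N) => x; rewrite (le_trans (ler_normD _ _)) // lerD.
Qed.
Lemma bm_cst c : bm (cst c).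
Proof. by split; [exact: measurable_cst|exists `|c|]. Qed.
End L2.

(** * Translations and Steklov averages *)

Notation E3 R := (measurableTypeR R * measurableTypeR R * measurableTypeR R)%type.

(** * Product measures and measurability of partial integrals *)

Section product_sigma_finite.
Context d1 d2 (T1 : measurableType d1) (T2 : measurableType d2) (R : realType).
Variables (m1 : {sigma_finite_measure set T1 -> \bar R}) (m2 : {sigma_finite_measure set T2 -> \bar R}).

(* A copy of the product measure: for [\x] itself the instance for products of
   subprobabilities hides the sigma-finite one. *)
Definition sprod : set (T1 * T2) -> \bar R := (m1 \x m2)%E.

HB.instance Definition _ := Measure.on sprod.

Lemma sprod_sigma_finite : sigma_finite setT sprod.
Proof.
have /sigma_finiteP[F [TF ndF Foo]] := sigma_finiteT m1.
have /sigma_finiteP[G [TG ndG Goo]] := sigma_finiteT m2.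
exists (fun n => F n `*` G n) => [|k].
  apply/seteqP; split => // -[x y] _.
  have [n _ Fx] : (\bigcup_i F i) x by rewrite -TF.
  have [m _ Gy] : (\bigcup_i G i) y by rewrite -TG.
  exists (maxn n m) => //; split => /=.
    by move: x Fx; apply/subsetPset/ndF/leq_maxl.
  by move: y Gy; apply/subsetPset/ndG/leq_maxr.
have [mF Ff] := Foo k; have [mG Gf] := Goo k.
split; first exact: measurableX.
by rewrite /sprod product_measure1E // lte_mul_pinfty // ge0_fin_numE.
Qed.

HB.instance Definition _ := Measure_isSigmaFinite.Build _ _ _ sprod sprod_sigma_finite.
End product_sigma_finite.

Section fubini_measurable.
Context d1 d2 (T1 : measurableType d1) (T2 : measurableType d2) (R : realType).
Variables (m1 : {sigma_finite_measure set T1 -> \bar R}) (m2 : {sigma_finite_measure set T2 -> \bar R}).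
Variable (f : T1 * T2 -> \bar R) (mf : measurable_fun setT f).

(** No integrability is assumed: Tonelli treats the positive and negative parts, and the difference
    is measurable as an extended real function. *)
Lemma measurable_integral2 : measurable_fun setT (fun x => \int[m2]_y f (x, y))%E.
Proof.
under eq_fun do rewrite integralE; apply: emeasurable_funB.
- have := measurable_fun_fubini_tonelli_F (m2 := m2) _ (measurable_funepos mf) (funepos_ge0 _).
  by congr measurable_fun; apply/funext => x; apply: eq_integral => y _; rewrite !funeposE.
- have := measurable_fun_fubini_tonelli_F (m2 := m2) _ (measurable_funeneg mf) (funeneg_ge0 _).
  by congr measurable_fun; apply/funext => x; apply: eq_integral => y _; rewrite !funenegE.
Qed.

Lemma measurable_integral1 : measurable_fun setT (fun y => \int[m1]_x f (x, y))%E.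
Proof.
under eq_fun do rewrite integralE; apply: emeasurable_funB.
- have := measurable_fun_fubini_tonelli_G (m1 := m1) _ (measurable_funepos mf) (funepos_ge0 _).
  by congr measurable_fun; apply/funext => x; apply: eq_integral => y _; rewrite !funeposE.
- have := measurable_fun_fubini_tonelli_G (m1 := m1) _ (measurable_funeneg mf) (funeneg_ge0 _).
  by congr measurable_fun; apply/funext => x; apply: eq_integral => y _; rewrite !funenegE.
Qed.
End fubini_measurable.

Section product3.
Context d1 d2 d3 (T1 : measurableType d1) (T2 : measurableType d2) (T3 : measurableType d3) (R : realType).
Variables (m1 : {sigma_finite_measure set T1 -> \bar R}) (m2 : {sigma_finite_measure set T2 -> \bar R}) (m3 : {sigma_finite_measure set T3 -> \bar R}).

Lemma fubini_tonelli3 (f : T1 * T2 * T3 -> \bar R) :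
  measurable_fun setT f -> (forall x, 0 <= f x)%E ->
  (\int[(m1 \x m2) \x m3]_x f x = \int[m1]_x1 \int[m2]_x2 \int[m3]_x3 f (x1, x2, x3))%E.
Proof.
move=> mf f0; rewrite (@fubini_tonelli1 _ _ _ _ R (sprod m1 m2) m3 f mf f0).
rewrite (@fubini_tonelli1 _ _ _ _ R m1 m2) //.
  exact: measurable_fun_fubini_tonelli_F.
by move=> x; apply: integral_ge0.
Qed.

Lemma sigma_finite_prod3 : sigma_finite setT ((m1 \x m2) \x m3)%E.
Proof. exact: (sigma_finiteT (sprod (sprod m1 m2) m3)). Qed.
End product3.

(** * Translation invariance of Lebesgue measure on R^3 *)

Section translation.
Context {R : realType}.
Implicit Types (v : R * R * R).
Local Notation leb := (@lebesgue_measure R).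

(** Lebesgue measure is determined by its values on half-open intervals, and a translation pulls
    such an interval back to one of the same length. *)
Lemma lebesgue_measureDr (c : R) (A : set R) : measurable A ->
  pushforward leb ((fun x => x + c) : _ -> measurableTypeR R) A = leb A.
Proof.
have mc : measurable_fun setT ((fun x => (x + c)%R) : R -> measurableTypeR R).
  by apply: measurable_funD => //; exact: measurable_cst.
pose mix := isMeasurableFun.Build _ _ _ _ _ mc.
pose mf : {mfun _ >-> _} := HB.pack ((fun x => (x + c)%R) : R -> measurableTypeR R) mix.
move=> mA; apply/esym; apply: (lebesgue_measure_unique (mu := pushforward leb mf)) => //= _ [[a b]] _ <-.
rewrite /pushforward.
have -> : ((fun x : R => x + c) @^-1` `]a, b]%classic) = `]a - c, b - c]%classic.
  by apply/seteqP; split => x /=; rewrite !in_itv/= lerBrDr ltrBlDr.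
by rewrite !lebesgue_measure_itv/= !lte_fin ltrD2r; case: ifP => // _; congr EFin; ring.
Qed.

Lemma ge0_integral_leb_shift (c : R) (f : measurableTypeR R -> \bar R) :
  measurable_fun setT f -> (forall x, 0 <= f x)%E ->
  (\int[leb]_x f ((x : R) + c)%R = \int[leb]_x f x)%E.
Proof.
move=> mf f0.
have mc : measurable_fun setT ((fun x => x + c) : measurableTypeR R -> measurableTypeR R).
  by apply: measurable_funD => //; exact: measurable_cst.
rewrite -[LHS](@ge0_integral_pushforward _ _ _ _ _ _ mc leb setT f) //.
by apply: eq_measure_integral => A mA _; exact: lebesgue_measureDr.
Qed.

Lemma leb3_tonelli (f : E3 R -> \bar R) :
  measurable_fun setT f -> (forall x, 0 <= f x)%E ->
  (\int[leb3]_x f x = \int[leb]_x1 \int[leb]_x2 \int[leb]_x3 f (x1, x2, x3))%E.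
Proof.
move=> mf f0.
by rewrite -(@fubini_tonelli3 _ _ _ _ _ _ R leb leb leb).
Qed.

Lemma measurable_E3D v : measurable_fun setT ((fun x => x + v) : E3 R -> E3 R).
Proof.
case: v => [[a b] c].
apply/measurable_fun_pairP; split; [apply/measurable_fun_pairP; split|].
- apply: (@measurable_funD _ _ _ _ (fst \o fst) (cst a)) => //.
  by apply: measurableT_comp.
- apply: (@measurable_funD _ _ _ _ (snd \o fst) (cst b)) => //.
  by apply: measurableT_comp.
- by apply: (@measurable_funD _ _ _ _ snd (cst c)).
Qed.

Lemma measurable_line v :
  measurable_fun setT ((fun p => p.1 + p.2 *: v) : E3 R * measurableTypeR R -> E3 R).
Proof.
case: v => [[a b] c].
apply/measurable_fun_pairP; split; [apply/measurable_fun_pairP; split|].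
- apply: (@measurable_funD _ _ _ _ (fst \o fst \o fst) (fun p : E3 R * measurableTypeR R => (p.2 : R) * a)) => //.
    by apply: measurableT_comp => //; apply: measurableT_comp.
  exact: (@measurable_funM _ _ _ _ snd (cst a)).
- apply: (@measurable_funD _ _ _ _ (snd \o fst \o fst) (fun p : E3 R * measurableTypeR R => (p.2 : R) * b)) => //.
    by apply: measurableT_comp => //; apply: measurableT_comp.
  exact: (@measurable_funM _ _ _ _ snd (cst b)).
- apply: (@measurable_funD _ _ _ _ (snd \o fst) (fun p : E3 R * measurableTypeR R => (p.2 : R) * c)) => //.
    by apply: measurableT_comp => //.
  exact: (@measurable_funM _ _ _ _ snd (cst c)).
Qed.

(** In the iterated integral the coordinates are shifted one at a time, innermost first. *)
Lemma ge0_integral_leb3_shift v (f : E3 R -> \bar R) :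
  measurable_fun setT f -> (forall x, 0 <= f x)%E ->
  (\int[leb3]_x f (x + v)%R = \int[leb3]_x f x)%E.
Proof.
move=> mf f0; rewrite leb3_tonelli //; last first.
  by apply: measurableT_comp => //; exact: measurable_E3D.
rewrite [RHS](leb3_tonelli mf f0).
case: v => [[a b] c].
transitivity (\int[leb]_x1 \int[leb]_x2 \int[leb]_x3 f ((x1 + a)%R, (x2 + b)%R, x3))%E.
  apply: eq_integral => x1 _; apply: eq_integral => x2 _.
  rewrite -[RHS](ge0_integral_leb_shift c) //.
  by apply: measurableT_comp.
have H1 : measurable_fun setT (fun p : measurableTypeR R * measurableTypeR R => \int[leb]_x3 f (p.1, p.2, x3))%E.
  rewrite [X in measurable_fun _ X](_ : _ = fun p => \int[leb]_x3 f (p, x3))%E; last by apply/funext => -[].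
  exact: (measurable_fun_fubini_tonelli_F f).
transitivity (\int[leb]_x1 \int[leb]_x2 \int[leb]_x3 f ((x1 + a)%R, x2, x3))%E.
  apply: eq_integral => x1 _.
  rewrite -[RHS](ge0_integral_leb_shift b (f := fun x2 => \int[leb]_x3 f ((x1 + a)%R, x2, x3)))%E//.
    exact: (measurableT_comp H1 (measurable_pair1 (T1 := measurableTypeR R) (T2 := measurableTypeR R) ((x1 : R) + a)%R)).
  by move=> x; exact: integral_ge0.
rewrite -[RHS](ge0_integral_leb_shift a (f := fun x1 => \int[leb]_x2 \int[leb]_x3 f (x1, x2, x3)))%E//.
  by apply: (measurable_fun_fubini_tonelli_F (m2 := leb) _ H1) => p; exact: integral_ge0.
by move=> x; apply: integral_ge0 => y _; exact: integral_ge0.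
Qed.

Lemma leb3_sigma_finite : sigma_finite setT (@leb3 R).
Proof.
exact: (@sigma_finite_prod3 _ _ _ _ _ _ R leb leb leb).
Qed.

HB.instance Definition _ := Measure_isSigmaFinite.Build _ _ _ (@leb3 R) leb3_sigma_finite.

End translation.

(** * Averages over the unit interval *)

Section I01.
Context {R : realType}.
Local Notation I01 := (uniform_prob (@ltr01 R)).

Lemma I01_cst (K : R) : (\int[I01]_t K%:E = K%:E)%E.
Proof. by rewrite integral_cst // [X in (_ * X)%E](probability_setT I01) mule1. Qed.

Lemma I01_Rintegral (h : R -> R) : measurable_fun setT h ->
  \int[I01]_t h t = \int[lebesgue_measure]_(t in `[0, 1]) h t.
Proof.
move=> mh; congr fine; rewrite integralE [RHS]integralE.
rewrite !integral_uniform //; last 2 first.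
- by apply: measurable_funeneg; exact/measurable_EFinP.
- by apply: measurable_funepos; exact/measurable_EFinP.
by rewrite subr0 invr1 !mul1e.
Qed.

Lemma I01_ae : {ae I01, forall t : R, 0 <= t <= 1}.
Proof.
exists (~` `[0, 1]%classic); split.
- by apply: measurableC; exact: measurable_itv.
- rewrite /uniform_prob integral_uniform_pdf setICl integral_set0 //.
- by move=> t /=; rewrite in_itv/= => H /H.
Qed.

(** Cauchy-Schwarz against the constant 1 for a probability measure. An infinite right-hand side is
    set apart, so square-integrability need not be assumed. *)
Lemma I01_jensen (h : measurableTypeR R -> R) : measurable_fun setT h ->
  (((\int[I01]_t h t)%R ^+ 2)%:E <= \int[I01]_t (h t ^+ 2)%:E)%E.
Proof.
move=> mh; have [hi|] := ltP (\int[I01]_t (h t ^+ 2)%:E)%E +oo%E; last first.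
  by rewrite leye_eq => /eqP ->; rewrite leey.
have hs : h \in sqint I01 by apply/sqintP.
have os : cst 1 \in sqint I01.
  apply/sqintP; split; first exact: measurable_cst.
  by under eq_integral do rewrite expr1n; rewrite I01_cst ltry.
have := ip_CS (MkL2 hs) (MkL2 os).
have -> : nrm2 (MkL2 os) = 1.
  by rewrite /nrm2 ipE /= mul1r /Rintegral I01_cst.
rewrite mulr1 -lee_fin nrm2E; congr (_ <= _)%E; congr ((_ ^+ 2)%:E); rewrite ipE.
by apply: eq_Rintegral => t _ /=; rewrite mulr1.
Qed.

Lemma I01_le (h : measurableTypeR R -> R) K : measurable_fun setT h -> 
  (forall t, 0 <= t <= 1 -> h t ^+ 2 <= K) -> (\int[I01]_t h t) ^+ 2 <= K.
Proof.
move=> mh hK; rewrite -lee_fin; apply: le_trans (I01_jensen mh) _.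
have K0 : 0 <= K by apply: le_trans (hK 0 _); rewrite ?sqr_ge0 // lexx ler01.
apply: (@le_trans _ _ (\int[I01]_t K%:E)%E); last first.
  by rewrite I01_cst.
apply: ae_ge0_le_integral => //.
- by move=> x _; rewrite lee_fin sqr_ge0.
- by apply/measurable_EFinP; exact: measurable_funX.
- case: I01_ae => A [mA A0 HA]; exists A; split => // t /= Ht; apply: HA => /= /hK h1; apply: Ht => _.
  by rewrite lee_fin.
Qed.

Lemma I01_integrable (h : measurableTypeR R -> R) K : measurable_fun setT h ->
  (forall t, `|h t| <= K) -> I01.-integrable setT (EFin \o h).
Proof.
move=> mh hK; apply: measurable_bounded_integrable => //.
  by apply: le_lt_trans (ltry 1); rewrite -(probability_setT I01).
exists K; split; first exact: num_real.
by move=> M KM x _; apply: le_trans (hK x) (ltW KM).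
Qed.
End I01.

(** * Steklov averages along a measure-preserving action *)

Section flow.
Context d (T : measurableType d) (R : realType) (mu : {sigma_finite_measure set T -> \bar R}).
Variables (E : lmodType R) (act : E -> T -> T).
Hypothesis act0 : forall x, act 0 x = x.
Hypothesis actD : forall v w x, act w (act v x) = act (v + w) x.
Hypothesis act_meas : forall v, measurable_fun setT (act v).
Hypothesis act_line : forall v, measurable_fun setT
  ((fun p => act ((p.2 : R) *: v) p.1) : T * measurableTypeR R -> T).
Hypothesis act_int : forall v (f : T -> \bar R),
  measurable_fun setT f -> (forall x, 0 <= f x)%E ->
  (\int[mu]_x f (act v x) = \int[mu]_x f x)%E.

Lemma Rintegral_act v (f : T -> R) : measurable_fun setT f ->
  \int[mu]_x f (act v x) = \int[mu]_x f x.
Proof.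
move=> mf; congr fine; rewrite integralE [RHS]integralE; congr (_ - _)%E.
- rewrite -[RHS](act_int v) //; last by apply: measurable_funepos; exact/measurable_EFinP.
  by apply: eq_integral => x _; rewrite ?funeposE ?funenegE.
- rewrite -[RHS](act_int v) //; last by apply: measurable_funeneg; exact/measurable_EFinP.
  by apply: eq_integral => x _; rewrite ?funeposE ?funenegE.
Qed.

Lemma sqint_act v (f : T -> R) : f \in sqint mu ->
  (fun x => f (act v x)) \in sqint mu.
Proof.
move=> /sqintP[mf fi]; apply/sqintP; split; first exact: (measurableT_comp mf).
rewrite (act_int v (f := fun x => (f x ^+ 2)%:E)) //.
  exact: measurable_sqrE.
by move=> x; rewrite lee_fin sqr_ge0.
Qed.

Local Notation V := (L2 mu).

Definition tau := locked_with lkey (fun v (u : V) => toL2 mu (fun x => u (act v x))).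

Lemma tauE v u x : tau v u x = u (act v x).
Proof. by rewrite /tau unlock toL2E //; apply: sqint_act; exact: l2funP. Qed.
Lemma tauD v u w : tau v (u + w) = tau v u + tau v w.
Proof. by apply: L2_eqP => x; rewrite L2DE !tauE. Qed.
Lemma tauZ v a u : tau v (a *: u) = a *: tau v u.
Proof. by apply: L2_eqP => x; rewrite L2ZE !tauE. Qed.
Lemma tauN v u : tau v (- u) = - tau v u.
Proof. by apply: L2_eqP => x; rewrite L2NE !tauE. Qed.
Lemma tauB v u w : tau v (u - w) = tau v u - tau v w.
Proof. by rewrite tauD tauN. Qed.
Lemma tau0 u : tau 0 u = u.
Proof. by apply: L2_eqP => x; rewrite tauE act0. Qed.
Lemma tau_tau v w u : tau v (tau w u) = tau (v + w) u.
Proof. by apply: L2_eqP => x; rewrite !tauE actD. Qed.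

Lemma ip_tau v u w : ip (tau v u) w = ip u (tau (- v) w).
Proof.
rewrite !ipE -[RHS](Rintegral_act v); last first.
  by apply: measurable_funM; exact: L2_measurable.
by apply: eq_Rintegral => x _; rewrite !tauE actD subrr act0.
Qed.
Lemma nrm2_tau v u : nrm2 (tau v u) = nrm2 u.
Proof. by rewrite /nrm2 ip_tau tau_tau addNr tau0. Qed.

(* [stek v u]: [u] averaged over the segment from [x] to [act v x] *)
Local Notation I01 := (uniform_prob (@ltr01 R)).

Definition stek := locked_with lkey (fun v (u : V) =>
  toL2 mu (fun x => \int[I01]_t u (act (t *: v) x))).

Let G v (u : V) (p : T * measurableTypeR R) : R := u (act ((p.2 : R) *: v) p.1).

Let mG v u : measurable_fun setT (G v u).
Proof. exact: (measurableT_comp (L2_measurable u) (act_line v)). Qed.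

(** Exchange the integrals, then for each [t] change variables by [act (t *: v)], which moves the
    shift from [u] onto the weight. *)
Lemma stek_tonelli v (u : V) (om : T -> R) : measurable_fun setT om -> (forall x, 0 <= om x) ->
  (\int[mu]_x \int[I01]_t (om x * (u (act (t *: v) x)) ^+ 2)%:E =
   \int[I01]_t \int[mu]_x (om (act (- (t *: v)) x) * u x ^+ 2)%:E)%E.
Proof.
move=> mo o0.
rewrite (fubini_tonelli (fun p : T * measurableTypeR R => (om p.1 * G v u p ^+ 2)%:E)); last 2 first.
- apply/measurable_EFinP; apply: measurable_funM.
    exact: measurableT_comp.
  by apply: measurable_funX.
- by move=> x; rewrite lee_fin mulr_ge0 // sqr_ge0.
apply: eq_integral => t _.
rewrite -[RHS](act_int (t *: v)); last 2 first.
- apply/measurable_EFinP; apply: measurable_funM; last by apply: measurable_funX; exact: L2_measurable.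
  exact: measurableT_comp.
- by move=> x; rewrite lee_fin mulr_ge0 // sqr_ge0.
by apply: eq_integral => x _; rewrite actD subrr act0.
Qed.


Lemma measurable_stek v (u : V) :
  measurable_fun setT (fun x => \int[I01]_t u (act (t *: v) x)).
Proof.
apply: (measurableT_comp (fine_measurable measurableT)).
by apply: (@measurable_integral2 _ _ _ _ _ I01 (EFin \o G v u)); exact/measurable_EFinP.
Qed.

(** Jensen in [t], then the exchange of integrals. A weight that changes by a bounded factor under
    short shifts is thus stable under averaging. *)
Lemma stek_le_weight v (u : V) (om : T -> R) : measurable_fun setT om -> (forall x, 0 <= om x) ->
  (\int[mu]_x (om x * (\int[I01]_t u (act (t *: v) x))%R ^+ 2)%:E <=
   \int[I01]_t \int[mu]_x (om (act (- (t *: v)) x) * u x ^+ 2)%:E)%E.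
Proof.
move=> mo o0; rewrite -stek_tonelli //.
have mt x : measurable_fun setT (fun t : measurableTypeR R => u (act ((t : R) *: v) x)).
  exact: (measurableT_comp (mG v u) (pair1_measurable _)).
apply: ge0_le_integral => //.
- by move=> x _; rewrite lee_fin mulr_ge0 ?sqr_ge0.
- apply/measurable_EFinP; apply: measurable_funM => //.
  by apply: measurable_funX; exact: measurable_stek.
- apply: (@measurable_fun_fubini_tonelli_F _ _ _ _ _ I01 (fun p => (om p.1 * G v u p ^+ 2)%:E)).
    apply/measurable_EFinP; apply: measurable_funM; first exact: measurableT_comp.
    exact: measurable_funX.
  by move=> p; rewrite lee_fin mulr_ge0 ?sqr_ge0.
- move=> x _; under eq_integral do rewrite EFinM.
  rewrite ge0_integralZl //.
  + by rewrite EFinM lee_wpmul2l ?lee_fin //; exact: I01_jensen.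
  + by apply/measurable_EFinP; exact: measurable_funX.
  + by move=> t _; rewrite lee_fin sqr_ge0.
  + by rewrite lee_fin.
Qed.

Lemma stek_le v (u : V) :
  (\int[mu]_x ((\int[I01]_t u (act (t *: v) x))%R ^+ 2)%:E <= (nrm2 u)%:E)%E.
Proof.
have := @stek_le_weight v u (cst 1) (measurable_cst _) (fun=> ler01).
under eq_integral do rewrite mul1r.
move=> /le_trans; apply.
under eq_integral do under eq_integral do rewrite mul1r.
by under eq_integral do rewrite -nrm2E; rewrite I01_cst.
Qed.

Lemma stekE v (u : V) x : stek v u x = \int[I01]_t u (act (t *: v) x).
Proof.
rewrite /stek unlock toL2E //; apply/sqintP; split; first exact: measurable_stek.
by rewrite (le_lt_trans (stek_le v u)) // ltry.
Qed.

Lemma nrm2_stek v u : nrm2 (stek v u) <= nrm2 u.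
Proof.
by rewrite -lee_fin nrm2E; under eq_integral do rewrite stekE; exact: stek_le.
Qed.

Lemma stek_weight v (u : V) (om : T -> R) : measurable_fun setT om -> (forall x, 0 <= om x) ->
  (\int[mu]_x (om x * (stek v u x) ^+ 2)%:E <=
   \int[I01]_t \int[mu]_x (om (act (- (t *: v)) x) * u x ^+ 2)%:E)%E.
Proof.
by move=> mo o0; under eq_integral do rewrite stekE; exact: stek_le_weight.
Qed.

Lemma ip_tau_bound v u w : `|ip (tau v u) w| <= nrm2 u + nrm2 w.
Proof.
have := ip_AMGM (tau v u) w ltr01; rewrite nrm2_tau invr1 !mul1r.
by have := nrm2_ge0 u; have := nrm2_ge0 w; have := normr_ge0 (ip (tau v u) w); lra.
Qed.

Let H2 v (u w : V) (p : T * measurableTypeR R) : R := G v u p * w p.1.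
Let mH2 v u w : measurable_fun setT (H2 v u w).
Proof. by apply: measurable_funM => //; apply: measurableT_comp => //; exact: L2_measurable. Qed.

Let H2_int v u w : (sprod mu I01).-integrable setT (EFin \o H2 v u w).
Proof.
apply/integrable21ltyP; first exact/measurable_EFinP.
apply: (@le_lt_trans _ _ (\int[I01]_t (nrm2 u + nrm2 w)%:E)%E); last first.
  by rewrite I01_cst ltry.
apply: ge0_le_integral => //.
- by move=> t _; apply: integral_ge0.
- apply: (@measurable_fun_fubini_tonelli_G _ _ _ _ _ mu (fun p => `|(H2 v u w p)%:E|)%E) => //.
  by apply: measurableT_comp => //; exact/measurable_EFinP.
- move=> t _; rewrite EFinD -(nrm2_tau (t *: v) u) !nrm2E -ge0_integralD //; last first.
  + by apply/measurable_EFinP; apply: measurable_funX; exact: L2_measurable.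
  + by move=> x _; rewrite lee_fin sqr_ge0.
  + by apply/measurable_EFinP; apply: measurable_funX; exact: L2_measurable.
  + by move=> x _; rewrite lee_fin sqr_ge0.
  apply: ge0_le_integral => //.
  + apply: measurableT_comp => //; apply/measurable_EFinP; exact: (measurableT_comp (mH2 v u w) (pair2_measurable _)).
  + by apply: emeasurable_funD; apply/measurable_EFinP; apply: measurable_funX; exact: L2_measurable.
  + move=> x _; rewrite /H2 /G /= -EFinD lee_fin tauE normrM.
    have := sqr_ge0 (`|u (act (t *: v) x)| - `|w x|).
    rewrite -(real_normK (num_real (u _))) -(real_normK (num_real (w x))).
    have := normr_ge0 (u (act (t *: v) x)); have := normr_ge0 (w x); nra.
Qed.

Lemma measurable_ip_tau v u w : measurable_fun setT (fun t : R => ip (tau (t *: v) u) w).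
Proof.
rewrite (_ : (fun _ => _) = fine \o (fun t => \int[mu]_x (H2 v u w (x, t))%:E)%E); last first.
  apply/funext => t /=; rewrite ipE /Rintegral; congr fine.
  by apply: eq_integral => x _; rewrite tauE.
apply: (measurableT_comp (fine_measurable measurableT)).
by apply: (@measurable_integral1 _ _ _ _ _ mu (EFin \o H2 v u w)); exact/measurable_EFinP.
Qed.

Lemma ip_tau_integrable v u w : I01.-integrable setT (EFin \o (fun t : R => ip (tau (t *: v) u) w)).
Proof.
apply: (@I01_integrable _ _ (nrm2 u + nrm2 w)); first exact: measurable_ip_tau.
by move=> t; exact: ip_tau_bound.
Qed.

Lemma ip_stek v u w : ip (stek v u) w = \int[I01]_t ip (tau (t *: v) u) w.
Proof.
have := integral12_prod_meas1 (H2_int v u w); rewrite -integral21_prod_meas1; last exact: H2_int.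
rewrite /fubini_F /fubini_G /= => E12; rewrite ipE; congr fine.
transitivity (\int[mu]_x \int[I01]_t (H2 v u w (x, t))%:E)%E; last first.
  rewrite E12; apply: eq_integral => t _.
  rewrite ipE /Rintegral fineK; last exact: integrable_fin_num (L2_int _ _).
  by apply: eq_integral => x _; rewrite tauE.
apply: ae_eq_integral => //.
- by apply/measurable_EFinP; apply: measurable_funM; exact: L2_measurable.
- by apply: (@measurable_integral2 _ _ _ _ _ I01 (EFin \o H2 v u w)); exact/measurable_EFinP.
have := ae_integrable1 (H2_int v u w); apply: filterS => x ix _.
(* Fubini gives integrability in [t] only after multiplication by [w x], which can be divided out
   where it is nonzero; where it vanishes both sides are 0. *)
rewrite stekE; have [w0|w0] := eqVneq (w x) 0.
  rewrite w0 mulr0; under eq_integral do rewrite /H2 w0 mulr0.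
  by rewrite integral0.
have iG : I01.-integrable setT (EFin \o (fun t => u (act (t *: v) x))).
  have := integrableZl measurableT (w x)^-1 ix.
  apply: eq_integrable => // t _; rewrite /= -EFinM /H2 /G /=; congr EFin.
  by rewrite mulrC mulfK.
rewrite -RintegralZr // /Rintegral fineK //.
by apply: integrable_fin_num => //; exact: (integrable_fin_num _ ix).
Qed.


(** Equality almost everywhere, in dual form. Every operation that has an adjoint preserves it,
    which avoids handling null sets. *)
Definition weq (u v : V) := forall z, ip u z = ip v z.

Lemma weq_sym u v : weq u v -> weq v u. Proof. by move=> h z. Qed.
Lemma weq_trans u v w : weq v u -> weq u w -> weq v w.
Proof. by move=> h k z; rewrite h. Qed.
Lemma weqD u v u' v' : weq u u' -> weq v v' -> weq (u + v) (u' + v').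
Proof. by move=> h k z; rewrite !ipDl h k. Qed.
Lemma weqN u u' : weq u u' -> weq (- u) (- u').
Proof. by move=> h z; rewrite !ipNl h. Qed.
Lemma weqB u v u' v' : weq u u' -> weq v v' -> weq (u - v) (u' - v').
Proof. by move=> h k; apply: weqD => //; exact: weqN. Qed.
Lemma weqZ a u u' : weq u u' -> weq (a *: u) (a *: u').
Proof. by move=> h z; rewrite !ipZl h. Qed.
Lemma weq_tau v u u' : weq u u' -> weq (tau v u) (tau v u').
Proof. by move=> h z; rewrite !ip_tau. Qed.

Lemma ip_stek_adj v u w : ip (stek v u) w = ip u (stek (- v) w).
Proof.
rewrite ip_stek ipC ip_stek; apply: eq_Rintegral => t _.
by rewrite ip_tau ipC scalerN.
Qed.
Lemma weq_stek v u u' : weq u u' -> weq (stek v u) (stek v u').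
Proof. by move=> h z; rewrite !ip_stek_adj. Qed.
Lemma stekD v u w : weq (stek v (u + w)) (stek v u + stek v w).
Proof. by move=> z; rewrite ipDl !ip_stek_adj ipDl. Qed.
Lemma stekZ v a u : weq (stek v (a *: u)) (a *: stek v u).
Proof. by move=> z; rewrite ipZl !ip_stek_adj ipZl. Qed.
Lemma stekB v u w : weq (stek v (u - w)) (stek v u - stek v w).
Proof. by move=> z; rewrite ipBl !ip_stek_adj ipBl. Qed.
Lemma tau_stek v w u : tau w (stek v u) = stek v (tau w u).
Proof.
apply: L2_eqP => x; rewrite tauE !stekE; apply: eq_Rintegral => t _.
by rewrite tauE !actD addrC.
Qed.
Lemma stekC v w u : weq (stek v (stek w u)) (stek w (stek v u)).
Proof.
move=> z; rewrite ip_stek_adj ip_stek [RHS]ip_stek; apply: eq_Rintegral => t _.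
by rewrite -ip_stek_adj tau_stek.
Qed.

(* [aD v u g]: [g] is the derivative of [u] in the direction [v] *)
Definition aD v (u g : V) :=
  forall t : R, weq (tau (t *: v) u - u) (t *: stek (t *: v) g).

Lemma aDD v u g u' g' : aD v u g -> aD v u' g' -> aD v (u + u') (g + g').
Proof.
move=> h k t z; rewrite tauD opprD addrACA ipDl h k -ipDl -scalerDr.
by apply: weqZ; apply: weq_sym; exact: stekD.
Qed.
Lemma aDZ v a u g : aD v u g -> aD v (a *: u) (a *: g).
Proof.
move=> h t z; rewrite tauZ -scalerBr ipZl h -ipZl scalerA mulrC -scalerA.
by apply: weqZ; apply: weq_sym; exact: stekZ.
Qed.
Lemma aD0 v : aD v 0 0.
Proof.
have t00 w : tau w 0 = 0 by rewrite -(scale0r 0) tauZ !scale0r.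
move=> t z; rewrite t00 subr0 ip0l ipZl ip_stek_adj ip0l mulr0 //.
Qed.
Lemma aD_weq v u g u' g' : weq u u' -> weq g g' -> aD v u g -> aD v u' g'.
Proof.
move=> hu hg h t z.
rewrite -(weqB (weq_tau (t *: v) hu) hu z) h.
by apply: weqZ; exact: weq_stek.
Qed.

Lemma aD_lip v u g t : aD v u g -> nrm2 (tau (t *: v) u - u) <= t ^+ 2 * nrm2 g.
Proof.
move=> h; rewrite /nrm2 h ipC h -/(nrm2 _) nrm2Z ler_wpM2l ?sqr_ge0 //.
exact: nrm2_stek.
Qed.

Lemma aD_stek_lip v u g t : aD v u g -> nrm2 (stek (t *: v) u - u) <= t ^+ 2 * nrm2 g.
Proof.
move=> h; set z := stek _ _ - u.
(* [nrm2 z] is the average over [s] of the pairings of [tau (s *: (t *: v)) u - u] with [z]; square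
   under the integral and use the Lipschitz bound at time [s * t]. *)
have K : nrm2 z ^+ 2 <= (t ^+ 2 * nrm2 g) * nrm2 z.
  rewrite [X in X ^+ 2](_ : _ = \int[I01]_s ip (tau (s *: (t *: v)) u - u) z); last first.
    rewrite {1}/nrm2 {1}/z ipBl ip_stek.
    have -> : ip u z = \int[I01]_s ip u z by rewrite /Rintegral I01_cst.
    rewrite -RintegralB //; first by apply: eq_Rintegral => s _; rewrite ipBl.
      exact: ip_tau_integrable.
    by apply: (@I01_integrable _ _ `|ip u z|).
  apply: I01_le.
    under eq_fun do rewrite ipBl; apply: measurable_funB => //.
    exact: measurable_ip_tau.
  move=> s /andP[s0 s1]; apply: le_trans (ip_CS _ _) _.
  rewrite ler_wpM2r ?nrm2_ge0 // scalerA.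
  apply: le_trans (aD_lip _ h) _; rewrite ler_wpM2r ?nrm2_ge0 // exprMn.
  by rewrite ler_piMl ?sqr_ge0 // expr_le1.
have [->|z0] := eqVneq (nrm2 z) 0; first by rewrite mulr_ge0 ?sqr_ge0 ?nrm2_ge0.
have zp : 0 < nrm2 z by rewrite lt_def z0 nrm2_ge0.
by rewrite -(ler_pM2r zp) -expr2.
Qed.

Lemma aD_tau v w u g : aD v u g -> aD v (tau w u) (tau w g).
Proof.
move=> h t.
have -> : tau (t *: v) (tau w u) - tau w u = tau w (tau (t *: v) u - u).
  by rewrite tauB !tau_tau (addrC w).
apply: weq_trans (weq_tau w (h t)) _.
by rewrite tauZ tau_stek.
Qed.

Lemma aD_stek v w u g : aD v u g -> aD v (stek w u) (stek w g).
Proof.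
move=> h t; rewrite tau_stek.
apply: weq_trans (weq_sym (stekB _ _ _)) _.
apply: weq_trans (weq_stek w (h t)) _.
apply: weq_trans (stekZ _ _ _) _.
by apply: weqZ; exact: stekC.
Qed.

Lemma sqr_small (x K : R) : (forall t : R, t != 0 -> x ^+ 2 <= t ^+ 2 * K) -> x = 0.
Proof.
move=> H; apply/eqP; rewrite -sqrf_eq0 eq_le sqr_ge0 andbT.
suff H' (e : R) : 0 < e -> x ^+ 2 <= e.
  by apply/ler_addgt0Pr => e e0; rewrite add0r; exact: H'.
move=> e0.
have K0 : 0 < `|K| + 1 by rewrite ltr_wpDl.
have q0 : 0 < e / (`|K| + 1) by rewrite divr_gt0.
have s0 : 0 < Num.sqrt (e / (`|K| + 1)) by rewrite sqrtr_gt0.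
apply: le_trans (H _ (lt0r_neq0 s0)) _.
rewrite (sqr_sqrtr (ltW q0)) -mulrA ler_piMr ?ltW // mulrC ltr_pdivrMr // mul1r (le_lt_trans (ler_norm _)) //; lra.
Qed.

(** Integration by parts. The identity [E1] moves a finite translation across the pairing exactly;
    replacing the averages by the functions themselves then changes the square of the sum by
    [O(t^2)], for every nonzero [t]. *)
Lemma aD_skew v u g w h : aD v u g -> aD v w h -> ip g w = - ip u h.
Proof.
move=> ug wh; apply/eqP; rewrite -subr_eq0 opprK; apply/eqP.
apply: (@sqr_small _ (4 * (nrm2 g * nrm2 h))) => t t0.
have E1 : ip (stek (t *: v) g) w = - ip u (stek (- (t *: v)) h).
  apply: (mulfI t0); rewrite -ipZl -ug ipBl ip_tau -ipBr ipC -scaleNr wh.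
  by rewrite ipZl ipC; ring.
have -> : ip g w + ip u h = - ip g (stek (- (t *: v)) w - w) - ip (stek (t *: v) u - u) h.
  by rewrite ipBr ipBl -ip_stek_adj E1 -ip_stek_adj; ring.
have := ip_CS g (stek (- (t *: v)) w - w).
have := ip_CS (stek (t *: v) u - u) h.
move: (ip g _) (ip _ h) => a b hb ha.
have hb' : b ^+ 2 <= t ^+ 2 * nrm2 g * nrm2 h.
  by apply: le_trans hb _; rewrite ler_wpM2r ?nrm2_ge0 //; exact: aD_stek_lip.
have ha' : a ^+ 2 <= t ^+ 2 * nrm2 g * nrm2 h.
  apply: le_trans ha _; rewrite [leRHS]mulrAC mulrC ler_wpM2r ?nrm2_ge0 //.
  by have := aD_stek_lip (- t) wh; rewrite scaleNr sqrrN.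
have := sqr_ge0 (a - b); nra.
Qed.

(* A rich enough class of test functions: the weak derivative is then unique and is a derivative *)
Variables (B : E -> V -> V -> Prop).
Hypothesis B_aD : forall v p q, B v p q -> aD v p q.
Hypothesis B_tau : forall v w p q, B v p q -> B v (tau w p) (tau w q).
Hypothesis B_total : forall v z, (forall p q, B v p q -> ip z p = 0) -> weq z 0.

Definition wD v u g := forall p q, B v p q -> ip u q = - ip g p.

(** For a test pair the increment of [p] is exactly [t] times an average of [q], and translates of
    test pairs are test pairs. Both sides therefore agree against every test function, and totality
    concludes. *)
Lemma wD_aD v u g : wD v u g -> aD v u g.
Proof.
move=> H t z; apply/eqP; rewrite -subr_eq0 -ipBl; apply/eqP.
rewrite -[RHS](ip0l z); apply: (@B_total v) => p q pq.
have -> : ip (tau (t *: v) u - u - t *: stek (t *: v) g) p =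
    ip (tau (- t *: v) p - p) u - t * ip (stek (t *: v) g) p.
  by rewrite ipBl ipZl !ipBl ip_tau !(ipC u) scaleNr.
rewrite (B_aD pq) ipZl ipC mulNr -opprD -mulrDr.
suff -> : ip u (stek (- t *: v) q) = - ip (stek (t *: v) g) p by rewrite addNr mulr0 oppr0.
rewrite scaleNr -ip_stek_adj !ip_stek.
rewrite -mulN1r -RintegralZl //; last exact: ip_tau_integrable.
by apply: eq_Rintegral => r _; rewrite !ip_tau mulN1r; apply/H/B_tau.
Qed.

Lemma aD_uniq v u g g' : aD v u g -> aD v u g' -> weq g g'.
Proof.
move=> h k z; apply/eqP; rewrite -subr_eq0 -ipBl; apply/eqP.
rewrite -[RHS](ip0l z); apply: (@B_total v) => p q /B_aD pq.
by rewrite ipBl (aD_skew h pq) (aD_skew k pq) subrr.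
Qed.

(** Averaging along [v] makes any square-integrable function differentiable along [v]. The second
    derivatives used later come from here. *)
Lemma aD_diff v u h : h != 0 -> aD v (stek (h *: v) u) (h^-1 *: (tau (h *: v) u - u)).
Proof.
move=> h0; apply: wD_aD => p q pq.
have := B_aD pq (- h) u; rewrite ipZl => E1.
have E2 : ip (tau (h *: v) u - u) p = ip (tau (- h *: v) p - p) u.
  by rewrite !ipBl ip_tau scaleNr !(ipC u).
rewrite ip_stek_adj -scaleNr ipZl E2 E1 (ipC u).
by rewrite mulNr mulrN opprK mulrA mulVf // mul1r.
Qed.

(** The product rule is asked for test pairs only; [aD_bmul] extends it by duality, through
    [aD_skew]. *)
Definition mult v a a' := [/\ bm a, bm a' &
  forall p q, B v p q -> aD v (bmul a p) (bmul a' p + bmul a q)].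

Lemma aD_bmul v a a' u g : mult v a a' -> aD v u g ->
  aD v (bmul a u) (bmul a' u + bmul a g).
Proof.
move=> [ba ba' H] ug; apply: wD_aD => p q pq.
have := aD_skew ug (H _ _ pq); rewrite ipDr.
by rewrite ipDl !ip_bmul //; lra.
Qed.

End flow.

(** * Smooth compactly supported functions *)

Section flat.
Context {R : realType}.
Implicit Types (P : {poly R}) (t : R).

(** The polynomial factor makes this family closed under differentiation; [P = 1] is the classical
    flat function. *)
Definition flat P t : R := if 0 < t then P.[t^-1] * expR (- t^-1) else 0.

Lemma exp_decay k (y : R) : 0 <= y -> y ^+ k * expR (- y) <= k`!%:R.
Proof.
move=> y0; rewrite expRN ler_pdivrMr ?expR_gt0 //.
case: k => [|k]; first by rewrite expr0 fact0 !mul1r -expR0 ler_expR.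
have := expR_ge1Dxn k y0.
have f0 : 0 < (k.+1)`!%:R :> R by rewrite ltr0n fact_gt0.
rewrite -ler_pdivrMl // mulrC; lra.
Qed.

Lemma poly_exp_bound P : exists C, forall y : R, 0 <= y -> `|P.[y] * expR (- y)| <= C.
Proof.
exists (\sum_(i < size P) `|P`_i| * i`!%:R) => y y0.
rewrite normrM (ger0_norm (expR_ge0 _)) horner_coef.
apply: le_trans (_ : (\sum_(i < size P) `|P`_i * y ^+ i|) * expR (- y) <= _).
  by rewrite ler_wpM2r ?expR_ge0 // ler_norm_sum.
rewrite mulr_suml ler_sum // => i _; rewrite normrM -mulrA ler_wpM2l //.
by rewrite ger0_norm ?exprn_ge0 // exp_decay.
Qed.

Lemma flat_bound P : exists C, forall t, `|flat P t| <= C.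
Proof.
have [C HC] := poly_exp_bound P; exists C => t; rewrite /flat.
case: ifPn => t0; first by rewrite HC // invr_ge0 ltW.
by rewrite normr0; apply: le_trans (HC 0 (lexx _)).
Qed.

Lemma flat_small P : exists C, forall t, `|flat P t| <= C * t ^+ 2.
Proof.
have [C HC] := poly_exp_bound (P * 'X^2); exists C => t; rewrite /flat.
have C0 : 0 <= C by apply: le_trans (HC 0 (lexx _)).
case: ifPn => t0; last by rewrite normr0 mulr_ge0 // sqr_ge0.
have t2 : 0 < t ^+ 2 by rewrite exprn_gt0.
rewrite -ler_pdivrMr // -[X in _ / X](ger0_norm (ltW t2)) -normfV -normrM.
have := HC t^-1; rewrite hornerM hornerXn exprVn => H.
by rewrite mulrAC H // invr_ge0 ltW.
Qed.

(** The chain rule produces a factor [t^-2], which is ['X^2] in the variable [t^-1]; the exponential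
    contributes [P] and the polynomial its derivative with a minus sign. *)
Definition flat' P := ('X^2 * (P - P^`()))%R.

Lemma is_derive_flat P t : is_derive t 1 (flat P) (flat (flat' P) t).
Proof.
have [t0|t0|<-] := ltgtP 0 t.
- have H : is_derive t 1 (fun s => P.[s^-1] * expR (- s^-1)) (flat (flat' P) t).
    have tn : t != 0 by rewrite gt_eqF.
    have V : is_derive t 1 (fun s : R => s^-1) (- t ^- 2).
      have := @is_deriveV R id t 1 1 tn (is_derive_id _ _).
      by move=> H; apply: (is_derive_eq H); rewrite /GRing.scale /= mulr1.
    have H1 := @is_derive1_comp R (horner P) (fun s => s^-1) t _ _ (is_derive_poly P t^-1) V.
    have H2 := @is_derive1_comp R expR (fun s => - s^-1) t _ _ (is_derive_expR _) (is_deriveN V).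
    have H := is_deriveM H1 H2; apply: (is_derive_eq H).
    rewrite /flat t0 /flat' !hornerE /=.
    rewrite /GRing.scale /=; field.
    by [].
  apply: near_eq_is_derive H.
  near=> s; rewrite /flat ifT //; near: s; exact: lt_nbhsr.
- have H : is_derive t 1 (cst 0 : R -> R) (flat (flat' P) t).
    by rewrite /flat ltNge (ltW t0) /=; exact: is_derive_cst.
  apply: near_eq_is_derive H.
  near=> s; rewrite /flat ifF //; apply/negbTE; rewrite -leNgt ltW //.
  near: s; exact: lt_nbhsl.
(* At 0 the quadratic bound makes the difference quotient at most [C * |h|], on both sides. *)
- have [C HC] := flat_small P.
  have L : C * `|h| @[h --> (0:R)^'] --> (0 : R).
    rewrite -[X in _ --> X](mulr0 C); apply: cvgMr.
    by rewrite -[X in _ --> X](normr0 R); apply: cvg_norm; exact: cvg_within.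
  have E : (fun h : R => h^-1 *: (flat P (h *: 1 + 0) - flat P 0)) @ 0^' --> (0 : R).
    apply: (@squeeze_cvgr _ _ _ _ (fun h => - (C * `|h|)) (fun h => C * `|h|)).
    + near=> h; have h0 : h != 0 by near: h; exact: nbhs_dnbhs_neq.
      rewrite -ler_norml [X in _ - X]/flat ltxx subr0 addr0 /GRing.scale /= mulr1 normrM normfV.
      rewrite ler_pdivrMl ?normr_gt0 //; apply: le_trans (HC h) _.
      by rewrite -(real_normK (num_real h)) expr2; lra.
    + by rewrite -[X in _ --> X]oppr0; exact: cvgN.
    + exact: L.
  rewrite /flat ltxx; apply: DeriveDef; last by apply/cvg_lim.
  by apply/cvg_ex; exists 0.
Unshelve. all: by end_near.
Qed.

Lemma continuous_flat P : continuous (flat P).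
Proof. by move=> t; apply: differentiable_continuous; apply/derivable1_diffP; have [] := is_derive_flat P t. Qed.

End flat.

Section coordinates.
Context {R : realType}.
Implicit Types (x v : R * R * R).

Definition co (i : 'I_3) x : R :=
  if val i == 0%N then x.1.1 else if val i == 1%N then x.1.2 else x.2.

Lemma coD i x y : co i (x + y) = co i x + co i y.
Proof. by rewrite /co; case: ifP => // _; case: ifP. Qed.
Lemma coZ i (a : R) x : co i (a *: x) = a * co i x.
Proof. by rewrite /co; case: ifP => // _; case: ifP. Qed.
Lemma co_unit i j : co i (unit_vec j) = (i == j)%:R :> R.
Proof. by case: i => [[|[|[|]]]] //= ?; case: j => [[|[|[|]]]]. Qed.
Lemma measurable_co i : measurable_fun setT (co i : E3 R -> R).
Proof.
case: i => [[|[|i]] ?]; rewrite /co /=.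
- exact: (@measurableT_comp _ _ _ _ _ _ fst _ fst).
- exact: (@measurableT_comp _ _ _ _ _ _ snd _ fst).
- exact: measurable_snd.
Qed.

Lemma continuous_co i : continuous (co i).
Proof.
case: i => [[|[|i]] ?] x; rewrite /co /=.
- by apply: (@cvg_comp _ _ _ fst fst); exact: cvg_fst.
- by apply: (@cvg_comp _ _ _ fst snd); [exact: cvg_fst|exact: cvg_snd].
- exact: cvg_snd.
Qed.

(* A directional derivative is a derivative along the line. *)
Lemma is_derive_line (f : R * R * R -> R) x v h0 l :
  is_derive (h0 *: v + x) v f l <-> is_derive (h0 : R) 1 (fun h : R => f (h *: v + x)) l.
Proof.
have E : (fun h : R => h^-1 *: (f (h *: v + (h0 *: v + x)) - f (h0 *: v + x))) =
  (fun h : R => h^-1 *: ((fun h => f (h *: v + x)) (h *: 1 + h0) - (fun h => f (h *: v + x)) h0)).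
  apply/funext => h; congr (_ *: (f _ - _)).
  by rewrite addrA -scalerDl; congr (_ *: _ + _); rewrite /GRing.scale /= mulr1.
by split => -[H1 H2]; split; move: H1 H2; rewrite /derivable /derive E.
Qed.

Lemma is_derive_affine (f : R -> R) (f' : R) (a c : R) i x v :
  is_derive (a + c * co i x) 1 f f' ->
  is_derive x v (fun y => f (a + c * co i y)) (f' * (c * co i v)).
Proof.
move=> H; rewrite -[x]add0r -(scale0r v); apply/is_derive_line.
pose g (h : R) := (a + c * co i x) + h * (c * co i v).
rewrite (_ : (fun h : R => _) = f \o g); last first.
  by apply/funext => h /=; rewrite /g coD coZ; congr f; ring.
apply: is_derive1_comp; first by rewrite /g mul0r addr0.
rewrite /g; have := @is_deriveD R R R (cst (a + c * co i x)) (fun h => h * (c * co i v)) 0 1 0 (c * co i v) (is_derive_cst _ _ _).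
rewrite add0r; apply.
have := @is_deriveM R R id (cst (c * co i v)) 0 1 _ _ (is_derive_id _ _) (is_derive_cst _ _ _).
move=> K; apply: (is_derive_eq K).
by rewrite /GRing.scale /= mulr0 add0r mulr1.
Qed.

(** A syntactic class: closure under derivatives and translations, continuity, measurability and
    boundedness all follow by induction, and it still contains enough bumps to be total. *)
Inductive smooth : (R * R * R -> R) -> Prop :=
| smooth_flat P a c i : smooth (fun x => flat P (a + c * co i x))
| smooth_cst a : smooth (fun=> a)
| smoothD f g : smooth f -> smooth g -> smooth (fun x => f x + g x)
| smoothM f g : smooth f -> smooth g -> smooth (fun x => f x * g x).

Lemma smooth_derive f v : smooth f ->
  exists2 f', smooth f' & forall x, is_derive x v f (f' x).
Proof.
elim=> [P a c i|a|g h _ [g' sg dg] _ [h' sh dh]|g h Sg [g' sg dg] Sh [h' sh dh]].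
- exists (fun x => flat (flat' P) (a + c * co i x) * (c * co i v)).
    by apply: smoothM; [exact: smooth_flat|exact: smooth_cst].
  by move=> x; apply: is_derive_affine; exact: is_derive_flat.
- by exists (fun=> 0); [exact: smooth_cst|move=> x; exact: is_derive_cst].
- by exists (fun x => g' x + h' x); [exact: smoothD|move=> x; exact: is_deriveD].
- exists (fun x => g x * h' x + h x * g' x); first by apply: smoothD; exact: smoothM.
  move=> x; exact: (is_deriveM (dg x) (dh x)).
Qed.

Lemma smooth_continuous f : smooth f -> continuous f.
Proof.
elim=> [P a c i|a|g h _ cg _ ch|g h _ cg _ ch] x.
- apply: (@continuous_comp _ _ _ (fun x => a + c * co i x) (flat P)); last exact: continuous_flat.
  by apply: cvgD; [exact: cvg_cst|apply: cvgMr; exact: continuous_co].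
- exact: cvg_cst.
- by apply: cvgD; [exact: cg|exact: ch].
- by apply: cvgM; [exact: cg|exact: ch].
Qed.

Lemma smooth_measurable f : smooth f -> measurable_fun setT (f : E3 R -> R).
Proof.
elim=> [P a c i|a|g h _ cg _ ch|g h _ cg _ ch].
- apply: (@measurableT_comp _ _ _ _ _ _ (flat P) _ (fun x => a + c * co i x)).
    by apply: continuous_measurable_fun; exact: continuous_flat.
  by apply: measurable_funD => //; apply: measurable_funM => //; exact: measurable_co.
- exact: measurable_cst.
- exact: measurable_funD.
- exact: measurable_funM.
Qed.

Lemma smooth_bounded f : smooth f -> exists M, forall x, `|f x| <= M.
Proof.
elim=> [P a c i|a|g h _ [M cg] _ [N ch]|g h _ [M cg] _ [N ch]].
- by have [C HC] := flat_bound P; exists C.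
- by exists `|a|.
- by exists (M + N) => x; rewrite (le_trans (ler_normD _ _)) // lerD.
- by exists (M * N) => x; rewrite normrM ler_pM.
Qed.

Lemma smooth_shift f v : smooth f -> smooth (fun x => f (x + v)).
Proof.
elim=> [P a c i|a|g h _ cg _ ch|g h _ cg _ ch].
- rewrite (_ : (fun _ => _) = (fun x => flat P ((a + c * co i v) + c * co i x))).
    exact: smooth_flat.
  by apply/funext => x; rewrite coD; congr flat; ring.
- exact: smooth_cst.
- exact: smoothD.
- exact: smoothM.
Qed.

Lemma smooth_Cn n f : smooth f -> Cn n f.
Proof.
elim: n f => [|n IH] f sf; split => //; try exact: smooth_continuous.
move=> j; have [f' sf' df] := smooth_derive (unit_vec j) sf.
split; first by move=> x; have [] := df x.
rewrite (_ : (fun x => _) = f'); first exact: IH.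
by apply/funext => x; have [] := df x.
Qed.

Definition in_box (N : R) x := forall i, `|co i x| <= N.

Definition box_supp (f : R * R * R -> R) := exists N, forall x, f x != 0 -> in_box N x.

Lemma in_boxE N x : in_box N x <-> `|x.1.1| <= N /\ `|x.1.2| <= N /\ `|x.2| <= N.
Proof.
split=> [H|[h1 [h2 h3]] i]; last by rewrite /co; case: ifP => _ //; case: ifP.
split; first exact: (H ord0).
by split; [exact: (H (@Ordinal 3 1 isT))|exact: (H ord_max)].
Qed.


Local Notation leb := (@lebesgue_measure R).

Lemma leb3_rect (A1 A2 A3 : set (measurableTypeR R)) :
  measurable A1 -> measurable A2 -> measurable A3 ->
  leb3 (A1 `*` A2 `*` A3) = (leb A1 * leb A2 * leb A3)%E.
Proof.
move=> m1 m2 m3; rewrite /leb3.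
rewrite (@product_measure1E _ _ _ _ R (sprod leb leb) leb) //; last exact: measurableX.
by congr (_ * _)%E; exact: (@product_measure1E _ _ _ _ R leb leb).
Qed.

Lemma in_boxE' N : in_box N = `[- N, N]%classic `*` `[- N, N]%classic `*` `[- N, N]%classic.
Proof.
apply/seteqP; split=> [x /in_boxE[h1 [h2 h3]]|x [[/= h1 h2] h3]].
  by split; [split|]; rewrite /= in_itv/= -ler_norml.
by apply/in_boxE; move: h1 h2 h3; rewrite /= !in_itv/= -!ler_norml.
Qed.

Lemma measurable_in_box N : measurable (in_box N : set (E3 R)).
Proof. by rewrite in_boxE'; do 2 (apply: measurableX; last exact: measurable_itv). Qed.

Lemma leb3_in_box N : (leb3 (in_box N) < +oo)%E.
Proof.
rewrite in_boxE' leb3_rect; try exact: measurable_itv.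
have [r ->] : exists r, leb `[(- N)%R, N]%classic = r%:E.
  by rewrite lebesgue_measure_itv /=; case: ifP => _; [exists (N - - N)|exists 0].
by rewrite -!EFinM ltry.
Qed.

Lemma box_sqint f : measurable_fun setT (f : E3 R -> R) -> (exists M, forall x, `|f x| <= M) ->
  box_supp f -> f \in sqint leb3.
Proof.
move=> mf [M fM] [N fN]; apply/sqintP; split => //.
apply: (@le_lt_trans _ _ (\int[leb3]_(x in in_box N) (M ^+ 2)%:E)%E).
  rewrite [leRHS]integral_mkcond; apply: ge0_le_integral => //.
  - by move=> x _; rewrite lee_fin sqr_ge0.
  - exact: measurable_sqrE.
  - apply/(measurable_restrictT _ (measurable_in_box N)) => //; exact: measurable_cst.
  - move=> x _; rewrite patchE; case: ifPn => xN.
      by rewrite lee_fin -(real_normK (num_real (f x))) lerXn2r ?nnegrE // (le_trans _ (fM x)).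
    rewrite (_ : f x = 0) ?expr0n //; apply/eqP; apply: contraNT xN => fx.
    by rewrite inE; exact: fN.
rewrite integral_cst //; last exact: measurable_in_box.
by rewrite lte_mul_pinfty // ?lee_fin ?sqr_ge0 //; exact: leb3_in_box.
Qed.

Definition e3shift (v : R * R * R) (x : E3 R) : E3 R := (x : R * R * R) + v.

Lemma e3shift0 x : e3shift 0 x = x. Proof. exact: addr0. Qed.
Lemma e3shiftD v w x : e3shift w (e3shift v x) = e3shift (v + w) x.
Proof. by rewrite /e3shift addrA. Qed.

Local Notation I01 := (uniform_prob (@ltr01 R)).

(** The fundamental theorem of calculus along a segment parametrised by the unit interval; it turns
    a classical derivative into one in the sense of [aD]. *)
Lemma ftc_line (f g : R * R * R -> R) v x (t : R) : (forall y, is_derive y v f (g y)) ->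
  continuous (fun s : R => g (s *: v + x)) -> (exists M : R, forall x, `|g x| <= M) ->
  f (x + t *: v) - f x = t * \int[I01]_s g (x + s *: (t *: v)).
Proof.
move=> df cg [M gM].
pose F (s : R) := f ((s * t) *: v + x).
pose G (s : R) := t * g ((s * t) *: v + x).
have cs : continuous (fun s : R => s * t).
  by move=> s; apply: cvgMl; exact: cvg_id.
have cG' : continuous (fun s : R => g ((s * t) *: v + x)).
  by move=> s; apply: (@continuous_comp R R R (fun s : R => s * t) (fun s : R => g (s *: v + x))); [exact: cs|exact: cg].
have cG : continuous G by move=> s; apply: cvgMr; exact: cG'.
have dF (s : R) : is_derive s 1 F (G s).
  have H := (is_derive_line f x v (s * t) (g ((s * t) *: v + x))).1 (df _).
  have K := @is_deriveM R R id (cst t) s 1 _ _ (is_derive_id _ _) (is_derive_cst _ _ _).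
  have L := @is_derive1_comp R (fun h => f (h *: v + x)) (fun s => s * t) s _ _ H K.
  apply: (is_derive_eq L).
  by rewrite /G /GRing.scale /= mulr0 add0r mulr1 mulrC.
have cF : continuous F.
  by move=> s; apply: differentiable_continuous; apply/derivable1_diffP; have [] := dF s.
have E : (\int[leb]_(s in `[0%R, 1%R]) (G s)%:E = (F 1)%:E - (F 0)%:E)%E.
  apply: continuous_FTC2 => //.
  - exact: continuous_subspaceT.
  - split=> [s _||]; first by have [] := dF s.
      by apply: cvg_at_right_filter; exact: cF.
    by apply: cvg_at_left_filter; exact: cF.
  - by move=> s _; rewrite derive1E; have [] := dF s.
have -> : f (x + t *: v) - f x = F 1 - F 0.
  by rewrite /F mul1r mul0r scale0r add0r (addrC x).
have <- : \int[I01]_s G s = F 1 - F 0.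
  rewrite I01_Rintegral; last exact: continuous_measurable_fun.
  by rewrite /Rintegral E.
rewrite -RintegralZl //.
  by apply: eq_Rintegral => s _; rewrite /G scalerA addrC.
under eq_fun do rewrite scalerA addrC.
apply: (@I01_integrable _ _ M) => //.
exact: continuous_measurable_fun.
Qed.

Local Notation V := (L2 (@leb3 R)).

Lemma aD_classical (f g : R * R * R -> R) v (fi : f \in sqint leb3) (gi : g \in sqint leb3) :
  (forall y, is_derive y v f (g y)) ->
  (forall x, continuous (fun s : R => g (s *: v + x))) -> (exists M : R, forall x, `|g x| <= M) ->
  aD e3shift v (MkL2 fi : V) (MkL2 gi).
Proof.
move=> df cg gM t z; congr (ip _ z).
apply: L2_eqP => x; rewrite L2BE L2ZE tauE; last 2 first.
- exact: measurable_E3D.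
- exact: ge0_integral_leb3_shift.
rewrite stekE; first have H := ftc_line t df (cg x) gM.
- exact: H.
- exact: e3shift0.
- exact: e3shiftD.
- exact: measurable_E3D.
- exact: measurable_line.
- exact: ge0_integral_leb3_shift.
Qed.

End coordinates.

(** * Totality of the test functions *)

Section null_integrals.
Context d (T : measurableType d) (R : realType) (mu : {measure set T -> \bar R}).

(** The sets over which [F] integrates to 0 form a Dynkin system; the vanishing of the full integral
    gives stability under complements. *)
Lemma integral_pisystem_eq0 (G : set (set T)) (F : T -> \bar R) :
  @measurable _ T = <<s G >> -> setI_closed G -> mu.-integrable setT F ->
  (\int[mu]_x F x = 0)%E -> (forall A, G A -> \int[mu]_(x in A) F x = 0)%E ->
  {ae mu, forall x, F x = 0%E}.
Proof.
move=> mG GI iF F0 GF.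
have mF : measurable_fun setT F := measurable_int mu iF.
have all0 A : measurable A -> (\int[mu]_(x in A) F x = 0)%E.
  rewrite mG; apply: (dynkin_induction (P := fun A => (\int[mu]_(x in A) F x = 0)%E)) => //.
  - move=> S mS S0.
    have := @integral_setU _ _ _ mu S (~` S) F mS (measurableC mS).
    rewrite setUv => /(_ mF); rewrite S0 F0 add0e => <- //.
    by apply/disj_setPS; rewrite setICr.
  - move=> H mH tH H0; rewrite integral_bigcup //.
      by rewrite eseries0 // => i _ _; exact: H0.
    by apply: (integrableS measurableT) => //; exact: bigcupT_measurable.
have := @integral_ae_eq _ _ _ mu setT measurableT (cst 0%E) F iF (measurable_cst _).
case/(_ _)/Wrap => [E _ mE|]; first by rewrite all0 // integral0.
by apply: filterS => x; exact.
Qed.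
End null_integrals.

Section test_functions.
Context {R : realType}.
Implicit Types (x v : R * R * R) (a c : 'I_3 -> R).

(** Open boxes form a pi-system generating the Borel sets, and their indicators are pointwise limits
    of the smooth bumps below. *)
Definition orect a c : set (E3 R) := [set x | forall i, a i < co i (x : R * R * R) < c i].

Definition orects : set (set (E3 R)) := [set A | exists a c, A = orect a c].

Lemma orectsI : setI_closed orects.
Proof.
move=> _ _ [a [c ->]] [a' [c' ->]].
exists (fun i => Num.max (a i) (a' i)), (fun i => Num.min (c i) (c' i)).
apply/seteqP; split => x /=.
  by move=> [h k] i; rewrite gt_max lt_min; move: (h i) (k i) => /andP[-> ->] /andP[-> ->].
by move=> h; split => i; have := h i; rewrite /= gt_max lt_min => /andP[/andP[h1 h2] /andP[h3 h4]]; rewrite ?h1 ?h2 ?h3 ?h4.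
Qed.

Lemma measurable_orect a c : measurable (orect a c).
Proof.
rewrite (_ : orect a c = \bigcap_(i in [set: 'I_3]) ((co i : E3 R -> R) @^-1` `]a i, c i[%classic)); last first.
  apply/seteqP; split => x /= h i; first by move=> _; rewrite /= in_itv/= h.
  by have := h i I; rewrite /= in_itv.
apply: fin_bigcap_measurable => // i _.
by rewrite -[_ @^-1` _]setTI; apply: (measurable_co i measurableT); exact: measurable_itv.
Qed.

Lemma measurable_co_orects i : @measurable_fun _ _ (g_sigma_algebraType orects) (measurableTypeR R) setT (co i).
Proof.
have H := @measurability _ _ (g_sigma_algebraType orects) (measurableTypeR R) setT (co i) (@RGenOInfty.G R).
apply: H.
  exact: RGenOInfty.measurableE.
move=> _ [_ [r ->] <-].
rewrite setTI.
(* A half-space in coordinate [i] is the union of the boxes with lower bound [r] in that coordinate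
   and all other bounds [n] or [- n]. *)
rewrite (_ : _ @^-1` _ = \bigcup_n orect (fun j => if j == i then r else - n%:R) (fun j => n%:R)).
  by apply: bigcupT_measurable => n; apply: sub_sigma_algebra; do 2 eexists.
apply/seteqP; split => [x /=|x [n _ /(_ i)]] /=; rewrite in_itv/= andbT; last by rewrite eqxx => /andP[].
move=> rx.
have [n Hn] : exists n : nat, forall j, `|co j x| < n%:R.
  pose M := \sum_j `|co j x|; exists (Num.truncn M).+1 => j.
  apply: le_lt_trans (truncnS_gt _); rewrite /M (bigD1 j) //= lerDl.
  by apply: sumr_ge0.
exists n => // j; have := Hn j; rewrite ltr_norml => /andP[h1 h2]; rewrite h2 andbT.
by case: eqP => [->|].
Qed.

Lemma measurable_orects : @measurable _ (E3 R) = <<s orects >>.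
Proof.
apply/seteqP; split; last first.
  by apply: smallest_sub; [exact: sigma_algebra_measurable|move=> _ [a [c ->]]; exact: measurable_orect].
move=> A mA.
have m0 : @measurable_fun _ _ (g_sigma_algebraType orects) (E3 R) setT (fun x : E3 R => x).
  have e x : (x.1.1 = co ord0 x) * (x.1.2 = co (@Ordinal 3 1 isT) x) * (x.2 = co ord_max x) by [].
  apply/measurable_fun_pairP; split; [apply/measurable_fun_pairP; split|].
  - exact: (measurable_co_orects ord0).
  - exact: (measurable_co_orects (@Ordinal 3 1 isT)).
  - exact: (measurable_co_orects ord_max).
by have := m0 measurableT A mA; rewrite setTI.
Qed.

(** As [flat 1 (n t)] tends to 1 for [t > 0] and vanishes for [t <= 0], the product tends to the
    indicator of the open box while staying below it. *)
Definition bump (n : nat) a c x : R :=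
  \prod_(i < 3) (flat 1 (- (n%:R * a i) + n%:R * co i x) * flat 1 (n%:R * c i + - n%:R * co i x)).

Lemma smooth_prod m (F : 'I_m -> R * R * R -> R) : (forall i, smooth (F i)) ->
  smooth (fun x => \prod_(i < m) F i x).
Proof.
elim: m F => [|m IH] F sF; first by under eq_fun do rewrite big_ord0; exact: smooth_cst.
under eq_fun do rewrite big_ord_recr /=.
by apply: smoothM => //; apply: IH.
Qed.

Lemma smooth_bump n a c : smooth (bump n a c).
Proof.
apply: (smooth_prod (F := fun i x => flat 1 (- (n%:R * a i) + n%:R * co i x) * flat 1 (n%:R * c i + - n%:R * co i x))) => i.
by apply: smoothM; exact: smooth_flat.
Qed.

Lemma flat1_01 (t : R) : 0 <= flat 1 t <= 1.
Proof.
rewrite /flat; case: ifPn => t0; last by rewrite lexx ler01.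
by rewrite hornerC mul1r expR_ge0 -expR0 ler_expR oppr_le0 invr_ge0 ltW.
Qed.

Lemma bump_01 n a c x : 0 <= bump n a c x <= 1.
Proof.
rewrite /bump; apply: (big_ind (fun z : R => 0 <= z <= 1)); first by rewrite ler01 lexx.
  by move=> y z /andP[y0 y1] /andP[z0 z1]; rewrite mulr_ge0 //= mulr_ile1.
move=> i _; have /andP[y0 y1] := flat1_01 (- (n%:R * a i) + n%:R * co i x).
by have /andP[z0 z1] := flat1_01 (n%:R * c i + - n%:R * co i x); rewrite mulr_ge0 //= mulr_ile1.
Qed.

Lemma bump_supp n a c x : bump n a c x != 0 -> orect a c x.
Proof.
move=> /prodf_neq0 H i; have /= := H i isT.
rewrite mulf_eq0 negb_or /flat; case: ifPn => [h1|_]; last by rewrite eqxx.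
have n0 : 0 < n%:R :> R by move: h1; case: n {H} => [|n] //; rewrite !mul0r oppr0 addr0 ltxx.
case: ifPn => [h2 _|_]; last by rewrite eqxx andbF.
by apply/andP; split; rewrite -(ltr_pM2l n0); lra.
Qed.

Lemma orect_box a c : exists N, forall x, orect a c x -> in_box N x.
Proof.
exists (\sum_i (`|a i| + `|c i|)) => x H i; apply: (@le_trans _ _ (`|a i| + `|c i|)).
  have /andP[h1 h2] := H i; rewrite ler_norml.
  have := ler_norm (c i); have := ler_norm (- a i); rewrite normrN.
  by have := normr_ge0 (a i); have := normr_ge0 (c i); move=> ? ? ? ?; apply/andP; split; lra.
by rewrite [leRHS](bigD1 i) //= lerDl sumr_ge0 // => j _; rewrite addr_ge0.
Qed.

Lemma flat1_cvg (t : R) : 0 < t -> flat 1 (n%:R * t) @[n --> \oo] --> (1 : R).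
Proof.
move=> t0; have H : expR (- (n%:R * t)^-1) @[n --> \oo] --> (1 : R).
  rewrite -[X in _ --> X]expR0; apply: continuous_cvg; first exact: continuous_expR.
  rewrite -[X in _ --> X]oppr0; apply: cvgN.
  rewrite (_ : (fun _ => _) = (fun n => n%:R^-1 * t^-1)); last by apply/funext => n; rewrite invfM.
  rewrite -[X in _ --> X](mul0r t^-1); apply: cvgMl.
  apply/gtr0_cvgV0; last exact: cvgr_idn.
  by near=> n; rewrite ltr0n; near: n; exists 1%N.
apply: cvg_trans H; apply: near_eq_cvg; near=> n; rewrite /flat ifT ?hornerC ?mul1r //.
by rewrite mulr_gt0 // ltr0n; near: n; exists 1%N.
Unshelve. all: by end_near. Qed.

Lemma bump_cvg a c x : bump n a c x @[n --> \oo] --> (\1_(orect a c) x : R).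
Proof.
have [xr|xr] := boolP (x \in orect a c); rewrite indicE; last first.
  rewrite (negbTE xr); apply: cvg_near_cst; apply: nearW => n; apply/eqP.
  by apply: contraNT xr => /bump_supp; rewrite inE.
rewrite xr /=; move: xr; rewrite inE => xr.
have K i : flat 1 (- (n%:R * a i) + n%:R * co i x) * flat 1 (n%:R * c i + - n%:R * co i x) @[n --> \oo] --> (1 * 1 : R).
  have /andP[h1 h2] := xr i; apply: cvgM.
    by under eq_fun do rewrite addrC -mulrBr; apply: flat1_cvg; lra.
  by under eq_fun do rewrite mulNr -mulrBr; apply: flat1_cvg; lra.
pose F i n := flat 1 (- (n%:R * a i) + n%:R * co i x) * flat 1 (n%:R * c i + - n%:R * co i x).
have E1 : (1 : R) = 1 * (1 * 1) * (1 * 1) * (1 * 1) by rewrite !mulr1.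
rewrite [X in _ --> X]E1.
rewrite (_ : (fun _ => _) = (fun n => 1 * F (widen_ord (leqnSn 2) (widen_ord (leqnSn 1) ord_max)) n * F (widen_ord (leqnSn 2) ord_max) n * F ord_max n)).
  by do 3 (apply: cvgM; last exact: K); exact: cvg_cst.
by apply/funext => n; rewrite /bump !big_ord_recr big_ord0.
Qed.

End test_functions.

Section bump_class.
Context {R : realType}.
Local Notation V := (L2 (@leb3 R)).
Implicit Types (x v : R * R * R).

Definition testpair v (p q : V) := exists f g : R * R * R -> R,
  [/\ smooth f /\ box_supp f, smooth g /\ box_supp g, forall x, is_derive x v f (g x),
      (p : _ -> _) = f & (q : _ -> _) = g].

Lemma smooth_line (g : R * R * R -> R) v x : smooth g -> continuous (fun s : R => g (s *: v + x)).
Proof.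
move=> /smooth_continuous cg s.
apply: (@continuous_comp R _ _ (fun s : R => s *: v + x) g); last exact: cg.
by apply: cvgD; [apply: cvgZl; exact: cvg_id|exact: cvg_cst].
Qed.

Lemma smooth_box_sqint (f : R * R * R -> R) : smooth f -> box_supp f -> f \in sqint leb3.
Proof.
by move=> sf bf; apply: box_sqint => //; [exact: smooth_measurable|exact: smooth_bounded].
Qed.

Lemma testpair_aD v p q : testpair v p q -> aD e3shift v p q.
Proof.
case: p q => p pi [q qi] [f [g [[sf bf] [sg bg] df /= pf qg]]]; subst p q.
apply: aD_classical => // [x|]; first exact: smooth_line.
exact: smooth_bounded.
Qed.

Lemma shift_box_supp (f : R * R * R -> R) v : box_supp f -> box_supp (fun x => f (x + v)).
Proof.
case=> N H; exists (N + \sum_i `|co i v|) => x /H h i.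
rewrite -(addrK v x) coD (le_trans (ler_normD _ _)) // lerD //.
by rewrite -scaleN1r coZ mulN1r normrN (bigD1 i) //= lerDl sumr_ge0.
Qed.

Lemma testpair_tau v w p q : testpair v p q -> testpair v (tau e3shift w p) (tau e3shift w q).
Proof.
case=> f [g [[sf bf] [sg bg] df pf qg]].
exists (fun x => f (x + w)), (fun x => g (x + w)); split.
- by split; [exact: smooth_shift|exact: shift_box_supp].
- by split; [exact: smooth_shift|exact: shift_box_supp].
- move=> x; have := df (x + w).
  have E : (fun h : R => h^-1 *: (f (h *: v + (x + w)) - f (x + w))) =
    (fun h : R => h^-1 *: ((fun x => f (x + w)) (h *: v + x) - (fun x => f (x + w)) x)).
    by apply/funext => h; rewrite addrA.
  by move=> -[H1 H2]; split; move: H1 H2; rewrite /derivable /derive E.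
- apply/funext => x; rewrite tauE ?pf //.
    exact: measurable_E3D.
  exact: ge0_integral_leb3_shift.
- apply/funext => x; rewrite tauE ?qg //.
    exact: measurable_E3D.
  exact: ge0_integral_leb3_shift.
Qed.

Lemma derive_box_supp (f g : R * R * R -> R) v : box_supp f ->
  (forall x, is_derive x v f (g x)) -> box_supp g.
Proof.
case=> N H df; exists N => x gx i; rewrite leNgt; apply/negP => Nx.
move/negP: gx; apply; apply/eqP.
have [_ <-] := df x; rewrite -[RHS](derive_cst (0 : R) x v).
apply: near_eq_derive.
have : \forall y \near x, N < `|co i y|.
  have c : continuous (fun y : R * R * R => `|co i y|).
    by move=> y; apply: cvg_norm; exact: continuous_co.
  exact: (c x [set r | N < r] (lt_nbhsr Nx)).
apply: filterS => y Ny; apply/eqP; apply/negPn/negP => /H /(_ i).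
by rewrite leNgt Ny.
Qed.

Lemma test_smooth (f : R * R * R -> R) v : smooth f -> box_supp f ->
  exists p q, testpair v p q /\ (p : _ -> _) = f.
Proof.
move=> sf bf; have [g sg df] := smooth_derive v sf.
have bg := derive_box_supp bf df.
by exists (MkL2 (smooth_box_sqint sf bf)), (MkL2 (smooth_box_sqint sg bg)); split => //; exists f, g.
Qed.

(** Bumps are test functions, so dominated convergence makes [z] integrate to 0 over every open
    box. *)
Lemma testpair_total v (z : V) : (forall p q, testpair v p q -> ip z p = 0) -> weq z 0.
Proof.
move=> H.
have H0 n a c : \int[leb3]_x (z x * bump n a c x) = 0.
  have bb : box_supp (bump n a c).
    by have [N HN] := orect_box a c; exists N => x /bump_supp; exact: HN.
  have [p [q [pq pE]]] := test_smooth v (smooth_bump n a c) bb.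
  by have := H _ _ pq; rewrite ipE pE.
have sI a c : (\1_(orect a c) : E3 R -> R) \in sqint leb3.
  apply: box_sqint.
  - by apply: measurable_indic; exact: measurable_orect.
  - by exists 1 => x; rewrite indicE; case: (_ \in _); rewrite ?normr1 ?normr0.
  - have [N HN] := orect_box a c; exists N => x; rewrite indicE.
    by case: (boolP (x \in _)) => [|_]; rewrite ?eqxx // inE => /HN.
have zint a c := L2_int z (MkL2 (sI a c)).
have Hrect a c : (\int[leb3]_x (z x * \1_(orect a c) x)%:E = 0)%E.
  have [|||||_ _ K] := @dominated_convergence _ _ _ (@leb3 R) setT measurableT
    (fun n x => (z x * bump n a c x)%:E) (fun x => (z x * \1_(orect a c) x)%:E)
    (fun x => `|(z x * \1_(orect a c) x)%:E|%E).
  - move=> n; apply/measurable_EFinP; apply: measurable_funM; first exact: L2_measurable.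
    by apply: smooth_measurable; exact: smooth_bump.
  - exact: (measurable_int _ (zint a c)).
  - apply: aeW => x _; apply: cvg_EFin; first exact: nearW.
    by apply: cvgMr; exact: bump_cvg.
  - exact: integrable_abse (zint a c).
  - apply: aeW => x n _; rewrite /= lee_fin !normrM ler_wpM2l //.
    rewrite indicE; case: (boolP (x \in _)) => [_|xr].
      by rewrite normr1; have /andP[b0 b1] := bump_01 n a c x; rewrite ger0_norm.
    rewrite (_ : bump n a c x = 0) ?normr0 //; apply/eqP.
    by apply: contraNT xr => /bump_supp; rewrite inE.
  have K0 n : (\int[leb3]_x (z x * bump n a c x)%:E = 0)%E.
    have bb : box_supp (bump n a c).
      by have [N HN] := orect_box a c; exists N => x /bump_supp; exact: HN.
    have := H0 n a c; rewrite /Rintegral => /eqP.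
    have fn := integrable_fin_num measurableT (L2_int z (MkL2 (smooth_box_sqint (smooth_bump n a c) bb))).
    by rewrite (fine_eq0 fn) => /eqP.
  move: K; under eq_fun do rewrite K0.
  by move=> /cvg_lim <- //; rewrite lim_cst.
(* A square-integrable [z] need not be integrable on the whole space, but it is on each cube [Q N],
   and the cubes exhaust the space. *)
pose Q (N : nat) := orect (fun=> - N%:R : R) (fun=> N%:R : R).
have aeQ N : {ae (@leb3 R), forall x, (z x * \1_(Q N) x)%:E = 0%E}.
  apply: (integral_pisystem_eq0 measurable_orects (@orectsI R)) => //.
  - exact: zint.
  - exact: Hrect.
  - move=> _ [a [c ->]]; rewrite integral_mkcond.
    have [a' [c' E]] : orects (orect a c `&` Q N).
      by apply: orectsI; [exists a, c|exists (fun=> - N%:R), (fun=> N%:R)].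
    rewrite -[RHS](Hrect a' c'); apply: eq_integral => x _; rewrite -E patchE !indicE.
    rewrite in_setI; case: (x \in orect a c) => //=; by rewrite mulr0.
have z0 : aeq leb3 z (0 : V).
  have /ae_foralln := aeQ; apply: filterS => x Hx.
  have [N HN] : exists N : nat, forall j, `|co j x| < N%:R.
    pose M := \sum_j `|co j x|; exists (Num.truncn M).+1 => j.
    apply: le_lt_trans (truncnS_gt _); rewrite /M (bigD1 j) //= lerDl.
    exact: sumr_ge0.
  have := Hx N => -[]; rewrite indicE mem_set ?mulr1 // => j.
  by rewrite -ltr_norml.
by move=> w; rewrite (ip_aeq _ z0).
Qed.

End bump_class.

(** * Directional derivatives in L_2 *)

Ltac e3flow := first [exact: e3shift0 | exact: e3shiftD | exact: measurable_E3D
  | exact: measurable_line | exact: ge0_integral_leb3_shift | exact: testpair_aD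
  | exact: testpair_tau | exact: testpair_total].

Section partial_derivatives.
Context {R : realType}.
Local Notation V := (L2 (@leb3 R)).
Implicit Types (u g w : V) (j k : 'I_3).

Definition pd j u g := aD e3shift (unit_vec j) u g.
Definition st j (h : R) u : V := stek e3shift (h *: unit_vec j) u.

Lemma pdD j u g u' g' : pd j u g -> pd j u' g' -> pd j (u + u') (g + g').
Proof. by move=> h k; apply: aDD h k; e3flow. Qed.
Lemma pdZ j a u g : pd j u g -> pd j (a *: u) (a *: g).
Proof. by move=> h; apply: aDZ h; e3flow. Qed.
Lemma pd0 j : pd j 0 0.
Proof. by apply: aD0; e3flow. Qed.
Lemma pd_weq j u g u' g' : weq u u' -> weq g g' -> pd j u g -> pd j u' g'.
Proof. by move=> h k l; apply: aD_weq h k l; e3flow. Qed.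
Lemma pd_skew j u g w h : pd j u g -> pd j w h -> ip g w = - ip u h.
Proof. by move=> a b; apply: (aD_skew _ _ _ _ _ a b); e3flow. Qed.
Lemma pd_uniq j u g g' : pd j u g -> pd j u g' -> weq g g'.
Proof. by move=> a b; apply: (aD_uniq _ _ _ _ _ (B := testpair) _ _ a b); e3flow. Qed.
Lemma pd_st k j h u g : pd k u g -> pd k (st j h u) (st j h g).
Proof. by move=> a; apply: (aD_stek _ _ _ _ _ _ a); e3flow. Qed.
Lemma st_lip j h u g : pd j u g -> nrm2 (st j h u - u) <= h ^+ 2 * nrm2 g.
Proof. by move=> a; apply: (aD_stek_lip _ _ _ _ _ _ a); e3flow. Qed.
Lemma pd_st_diff j h u : h != 0 ->
  pd j (st j h u) (h^-1 *: (tau e3shift (h *: unit_vec j) u - u)).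
Proof. by move=> a; apply: (aD_diff (B := testpair) _ _ _ _ _ _ _ _ _ _ a); e3flow. Qed.
Lemma weak_pd j u g :
  (forall p q, testpair (unit_vec j) p q -> ip u q = - ip g p) -> pd j u g.
Proof. by move=> H; apply: (wD_aD (B := testpair) _ _ _ _ _ _ _ _ H); e3flow. Qed.
Lemma nrm2_st j h u : nrm2 (st j h u) <= nrm2 u.
Proof. by apply: nrm2_stek; e3flow. Qed.
Lemma st_weq j h u u' : weq u u' -> weq (st j h u) (st j h u').
Proof. by move=> a; apply: weq_stek a; e3flow. Qed.
Lemma stD j h u u' : weq (st j h (u + u')) (st j h u + st j h u').
Proof. by apply: stekD; e3flow. Qed.
Lemma stB j h u u' : weq (st j h (u - u')) (st j h u - st j h u').
Proof. by apply: stekB; e3flow. Qed.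
Lemma stZ j h a u : weq (st j h (a *: u)) (a *: st j h u).
Proof. by apply: stekZ; e3flow. Qed.

Definition C1b j (a a' : E3 R -> R) :=
  [/\ bm a /\ bm a', forall x : R * R * R, is_derive x (unit_vec j) (a : R * R * R -> R) (a' x),
      continuous (a : R * R * R -> R) & continuous (a' : R * R * R -> R)].

(** Multiplied by a test function, [a] gives a bounded function of bounded support, hence a
    square-integrable one to which the classical product rule applies. *)
Lemma C1b_mult j a a' : C1b j a a' -> mult e3shift testpair (unit_vec j) a a'.
Proof.
move=> [[ba ba'] da ca ca']; split => // p q [f [g [[sf [N bf]] [sg [M bg]] df pf qg]]].
have [ma [A aA]] := ba; have [ma' [A' aA']] := ba'.
have [F fF] := smooth_bounded sf; have [G gG] := smooth_bounded sg.
have mf := smooth_measurable sf; have mg := smooth_measurable sg.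
have fi : (fun x => a x * f x) \in sqint (@leb3 R).
  apply: box_sqint; first exact: measurable_funM.
    by exists (A * F) => x; rewrite normrM ler_pM.
  by exists N => x; rewrite mulf_eq0 negb_or => /andP[_ /bf].
have gB : exists K : R, forall x, `|a x * g x + f x * a' x| <= K.
  exists (A * G + F * A') => x.
  by rewrite (le_trans (ler_normD _ _)) // lerD // normrM ler_pM.
have gi : (fun x => a x * g x + f x * a' x) \in sqint (@leb3 R).
  apply: box_sqint => //.
    by apply: measurable_funD; exact: measurable_funM.
  exists (Num.max N M) => x; have [->|f0 _] := eqVneq (f x) 0.
    rewrite mul0r addr0 mulf_eq0 negb_or => /andP[_ /bg] H i.
    by rewrite le_max (H i) orbT.
  by move=> i; rewrite le_max (bf _ f0 i).
have D x : is_derive x (unit_vec j) (fun x => a x * f x) (a x * g x + f x * a' x).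
  exact: (is_deriveM (da x) (df x)).
have cg : continuous (fun x : R * R * R => a x * g x + f x * a' x).
  move=> x; apply: cvgD; apply: cvgM; [exact: ca| |  |exact: ca'].
    exact: smooth_continuous.
  exact: smooth_continuous.
have L x : continuous (fun s : R => a (s *: unit_vec j + x) * g (s *: unit_vec j + x) + f (s *: unit_vec j + x) * a' (s *: unit_vec j + x)).
  move=> s; apply: (@continuous_comp R _ _ (fun s : R => s *: unit_vec j + x) (fun x : R * R * R => a x * g x + f x * a' x)); last exact: cg.
  by apply: cvgD; [apply: cvgZl; exact: cvg_id|exact: cvg_cst].
have := aD_classical fi gi D L gB.
suff [-> ->] : MkL2 fi = bmul a p /\ MkL2 gi = bmul a' p + bmul a q by [].
split; apply: L2_eqP => x; rewrite ?L2DE !bmulE //= pf ?qf //.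
by rewrite qg addrC (mulrC (f x)).
Qed.

Lemma pd_bmul j a a' u g : C1b j a a' -> pd j u g -> pd j (bmul a u) (bmul a' u + bmul a g).
Proof.
by move=> h k; apply: (aD_bmul (B := testpair) _ _ _ _ _ _ _ _ (C1b_mult h) k); e3flow.
Qed.

Lemma smooth_test_function (f : R * R * R -> R) : smooth f -> box_supp f -> test_function f.
Proof.
move=> sf [N bf]; split; first by move=> n; exact: smooth_Cn.
have cB : compact (`[- N, N]%classic `*` `[- N, N]%classic `*` `[- N, N]%classic : set (R * R * R)).
  by do 2 (apply: compact_setX; last exact: segment_compact); exact: segment_compact.
apply: (subclosed_compact _ cB); first exact: closed_closure.
rewrite closureE; apply: smallest_sub; last by move=> x /bf; rewrite in_boxE'.
by apply: compact_closed cB; exact: norm_hausdorff.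
Qed.

Lemma weak_partial_pd j u g : weak_partial_real j u g -> pd j u g.
Proof.
move=> H; apply: weak_pd => p q [f [f' [[sf bf] [sf' bf'] df pf qf]]].
have := H f (smooth_test_function sf bf).
rewrite !ipE pf qf => <-; apply: eq_Rintegral => x _.
by have [_ ->] := df x.
Qed.
End partial_derivatives.

(** * Resolvents of a symmetric relation *)

Section symmetric_relation.
Context {R : realType} (U : lmodType R).
Variable dot : U -> U -> R.
Hypothesis dotC : forall u v, dot u v = dot v u.
Hypothesis dotDl : forall u v w, dot (u + v) w = dot u w + dot v w.
Hypothesis dotZl : forall a u w, dot (a *: u) w = a * dot u w.
Hypothesis dot_ge0 : forall u, 0 <= dot u u.
Variable J : U -> U.
Hypothesis JD : forall u v, J (u + v) = J u + J v.
Hypothesis JZ : forall a u, J (a *: u) = a *: J u.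
Hypothesis J_skew : forall u v, dot (J u) v = - dot u (J v).
Hypothesis JJ : forall u v, dot (J (J u)) v = - dot u v.
Variable H : U -> U -> Prop.
Hypothesis HD : forall u h v k, H u h -> H v k -> H (u + v) (h + k).
Hypothesis HZ : forall a u h, H u h -> H (a *: u) (a *: h).
Hypothesis HJ : forall u h, H u h -> H (J u) (J h).
Hypothesis H_sym : forall u h v k, H u h -> H v k -> dot h v = dot u k.

Definition eqd u v := forall w, dot u w = dot v w.
(** The equation [(H - (l + i m)) u = f], with [J] in the role of [i] and [dot] in that of the real
    part of the Hermitian product. [H] is a relation because its values are only determined modulo
    [eqd]. *)
Definition sol (l m : R) u f := exists2 h, H u h & eqd (h - l *: u - m *: J u) f.

Let dotNl u w : dot (- u) w = - dot u w.
Proof. by rewrite -scaleN1r dotZl mulN1r. Qed.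
Let dotBl u v w : dot (u - v) w = dot u w - dot v w.
Proof. by rewrite dotDl dotNl. Qed.
Let dotDr u v w : dot w (u + v) = dot w u + dot w v.
Proof. by rewrite dotC dotDl !(dotC _ w). Qed.
Let dotZr a u w : dot w (a *: u) = a * dot w u.
Proof. by rewrite dotC dotZl (dotC _ w). Qed.
Let dotNr u w : dot w (- u) = - dot w u.
Proof. by rewrite dotC dotNl (dotC _ w). Qed.
Let dotBr u v w : dot w (u - v) = dot w u - dot w v.
Proof. by rewrite dotDr dotNr. Qed.
Let JN u : J (- u) = - J u.
Proof. by rewrite -scaleN1r JZ scaleN1r. Qed.
Let JB u v : J (u - v) = J u - J v. Proof. by rewrite JD JN. Qed.
Let dotJJ u v : dot (J u) (J v) = dot u v.
Proof. by rewrite J_skew dotC JJ opprK dotC. Qed.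
Let dotJ0 u : dot (J u) u = 0.
Proof. by have := J_skew u u; rewrite (dotC u); lra. Qed.

Let CS u v : dot u v ^+ 2 <= dot u u * dot v v.
Proof.
have [v0|v0] := eqVneq (dot v v) 0.
  have [->|c0] := eqVneq (dot u v) 0; first by rewrite expr0n mulr_ge0.
  have := dot_ge0 (u - ((dot u u + 1) / (2 * dot u v)) *: v).
  rewrite !(dotBl, dotBr, dotZl, dotZr) (dotC v) v0 !mulr0 subr0.
  have -> : (dot u u + 1) / (2 * dot u v) * dot u v = (dot u u + 1) / 2 by field.
  lra.
have vp : 0 < dot v v by rewrite lt_def v0 dot_ge0.
have := dot_ge0 (dot v v *: u - dot u v *: v).
rewrite !(dotBl, dotBr, dotZl, dotZr) (dotC v u) => h.
rewrite -subr_ge0 -(pmulr_rge0 _ vp); move: h; congr (_ <= _); ring.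
Qed.

Lemma solD l m u f v g : sol l m u f -> sol l m v g -> sol l m (u + v) (f + g).
Proof.
move=> [h uh ef] [k vk eg]; exists (h + k); first exact: HD.
move=> w; have e1 := ef w; have e2 := eg w.
move: e1 e2; rewrite JD !(dotDl, dotNl, dotZl) => <- <-; ring.
Qed.

Lemma solZ a l m u f : sol l m u f -> sol l m (a *: u) (a *: f).
Proof.
move=> [h uh ef]; exists (a *: h); first exact: HZ.
by move=> w; have := ef w; rewrite JZ !(dotBl, dotZl) => <-; ring.
Qed.

Lemma solJ l m u f : sol l m u f -> sol l m (J u) (J f).
Proof.
move=> [h uh ef]; exists (J h); first exact: HJ.
by move=> w; have := ef (J w); rewrite !(dotBl, dotZl) !J_skew => <-; ring.
Qed.

Lemma sol_eqd l m u f f' : eqd f f' -> sol l m u f -> sol l m u f'.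
Proof. by move=> e [h uh ef]; exists h => // w; rewrite ef e. Qed.

(** Pair with [J u]: as [H] is symmetric and commutes with [J], only [- m * dot u u] remains, and
    Cauchy-Schwarz applies. *)
Lemma sol_bound l m u f : sol l m u f -> m ^+ 2 * dot u u <= dot f f.
Proof.
move=> [h uh ef].
have E : - (m * dot u u) = dot f (J u).
  rewrite -ef !(dotBl, dotZl) dotJJ (H_sym uh (HJ uh)) (dotC u (J u)) dotJ0.
  suff -> : dot u (J h) = 0 by ring.
  by have := H_sym uh (HJ uh); have := J_skew u h; rewrite (dotC h) => e1 e2; lra.
have := CS f (J u); rewrite -E sqrrN dotJJ exprMn.
have [u0|u0] := eqVneq (dot u u) 0; first by move=> _; rewrite u0 mulr0; exact: dot_ge0.
have up : 0 < dot u u by rewrite lt_def u0 dot_ge0.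
by rewrite expr2 mulrA ler_pM2r.
Qed.

Lemma sol_uniq l m u v f : m != 0 -> sol l m u f -> sol l m v f -> eqd u v.
Proof.
move=> m0 su sv.
have := solD su (solZ (-1) sv); rewrite !scaleN1r => /sol_bound.
have -> : dot (f - f) (f - f) = 0 by rewrite subrr -(scale0r f) dotZl mul0r.
have m2 : 0 < m ^+ 2 by rewrite exprn_even_gt0.
rewrite pmulr_rle0 // => d0 w.
have := CS (u - v) w; have -> : dot (u - v) (u - v) = 0 by apply/eqP; rewrite eq_le d0 dot_ge0.
rewrite mul0r => h; have : dot (u - v) w ^+ 2 = 0 by apply/eqP; rewrite eq_le h sqr_ge0.
by move/eqP; rewrite sqrf_eq0 dotBl subr_eq0 => /eqP.
Qed.

(* [u = n (n + i H)^-1 f] is a contraction of [f], and its norm increases with [n]. *)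
Definition yos (n : R) u f := sol 0 n u (- n *: J f).

Lemma yos_bound (n : R) u f : 0 < n -> yos n u f -> dot u u <= dot f f.
Proof.
move=> n0 /sol_bound; rewrite dotZl dotZr dotJJ.
by rewrite (_ : - n * (- n * _) = n ^+ 2 * dot f f) ?ler_pM2l ?exprn_gt0 //; ring.
Qed.

Lemma yosE (n : R) u f : 0 < n -> yos n u f -> exists2 h, H u h & eqd (u + n^-1 *: J h) f.
Proof.
move=> n0 [h uh ef]; exists h => // w.
have := ef (J w); rewrite !(dotBl, dotZl) mul0r !dotJJ dotDl dotZl J_skew => e1.
have ni : n^-1 * n = 1 by rewrite mulVf // gt_eqF.
have -> : dot h (J w) = n * (dot u w - dot f w) by lra.
rewrite mulrN mulrA ni; ring.
Qed.

(** The difference [d] satisfies [d + m^-1 J (h - k) = c J k] weakly. Pairing with [v] and with [d]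
    gives [c * dot d v = m^-1 * dot d d], so [dot d v] is nonnegative and the square of [v + d] can
    be expanded. *)
Lemma yos_mono (n m : R) u v f : 0 < n -> n < m -> yos n v f -> yos m u f ->
  dot (u - v) (u - v) <= dot u u - dot v v.
Proof.
move=> n0 nm yv yu; have m0 := lt_trans n0 nm.
have [k vk ev] := yosE n0 yv; have [h uh eu] := yosE m0 yu.
set d := u - v; set c := n^-1 - m^-1.
have c0 : 0 < c by rewrite subr_gt0 ltf_pV2.
have dk : H d (h - k) by apply: HD => //; rewrite -scaleN1r -(scaleN1r k); exact: HZ.
have E w : dot d w + m^-1 * dot (J (h - k)) w = c * dot (J k) w.
  have := eu w; rewrite -ev /d /c JB !(dotDl, dotNl, dotZl); lra.
have Jk v' k' : H v' k' -> dot (J k') v' = 0.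
  move=> vk'; have := H_sym vk' (HJ vk'); rewrite J_skew (dotC v').
  by have := J_skew k' v'; rewrite J_skew => e1 e2; lra.
have E1 := E v; rewrite (Jk _ _ vk) mulr0 in E1.
have E2 := E d; rewrite (Jk _ _ dk) mulr0 addr0 in E2.
have E3 : dot (J (h - k)) v = - dot (J k) d.
  rewrite J_skew (H_sym dk (HJ vk)) (dotC d); ring.
rewrite E3 in E1.
have E4 : c * dot d v = m^-1 * dot d d 
  by have -> : dot d v = m^-1 * dot (J k) d by [lra]; rewrite E2; ring.
have dv0 : 0 <= dot d v.
  by rewrite -(pmulr_rge0 _ c0) E4 mulr_ge0 // invr_ge0 ltW.
have -> : dot u u = dot (v + d) (v + d) by rewrite /d addrC subrK.
clearbody d; rewrite !(dotDl, dotDr) (dotC v d); lra.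
Qed.

(** The squares of the [u n] increase and are bounded by that of [f]; beyond an index where they are
    within [e] of their supremum, [yos_mono] bounds the differences. *)
Lemma yos_cauchy (u : nat -> U) f : (forall n, yos n.+1%:R (u n) f) ->
  forall e, 0 < e -> exists N, forall n m, (N <= n <= m)%N ->
    dot (u m - u n) (u m - u n) <= e.
Proof.
move=> yu e e0.
have mono n m : (n <= m)%N -> dot (u m - u n) (u m - u n) <= dot (u m) (u m) - dot (u n) (u n).
  rewrite leq_eqVlt => /predU1P[->|nm].
    by rewrite !subrr -(scale0r (u m)) dotZl mul0r.
  by apply: yos_mono (yu n) (yu m); rewrite ?ltr0n // ltr_nat.
pose S := [set dot (u n) (u n) | n in [set: nat]]%classic.
have hS : has_sup S.
  split; first by exists (dot (u 0%N) (u 0%N)); exists 0%N.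
  by exists (dot f f) => _ [n _ <-]; apply: yos_bound (yu n); rewrite ltr0n.
have [_ [N _ <-] SN] := sup_adherent e0 hS.
exists N => n m /andP[Nn nm]; apply: le_trans (mono _ _ nm) _.
have h1 : dot (u m) (u m) <= sup S by apply: ub_le_sup; [case: hS|exists m].
have := mono _ _ Nn; have := dot_ge0 (u n - u N); lra.
Qed.

End symmetric_relation.

(** * Real spinors *)

Section weighted_form.
Context d (T : measurableType d) (R : realType) (mu : {measure set T -> \bar R}).
Local Notation V := (L2 mu).

Lemma psd_form m (a : 'I_m -> 'I_m -> T -> R) (v : 'I_m -> V) : (forall j k, bm (a j k)) ->
  (forall x (y : 'I_m -> R), 0 <= \sum_j \sum_k a j k x * y j * y k) ->
  0 <= \sum_j \sum_k ip (v j) (bmul (a j k) (v k)).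
Proof.
move=> ba H.
have e j k : ip (v j) (bmul (a j k) (v k)) = \int[mu]_x (a j k x * v j x * v k x).
  by rewrite ipE; apply: eq_Rintegral => x _; rewrite bmulE //; ring.
have I j k : mu.-integrable setT (EFin \o (fun x => a j k x * v j x * v k x)).
  have := L2_int (v j) (bmul (a j k) (v k)); apply: eq_integrable => // x _ /=.
  by rewrite bmulE //; congr EFin; ring.
have S0 (r : seq 'I_m) (F : 'I_m -> T -> R) : (forall j, mu.-integrable setT (EFin \o F j)) ->
    mu.-integrable setT (EFin \o (fun x => \sum_(j <- r) F j x)) /\
    \sum_(j <- r) \int[mu]_x F j x = \int[mu]_x \sum_(j <- r) F j x.
  move=> IF; elim: r => [|j r [IH1 IH2]].
    split; first by under eq_fun do rewrite big_nil; exact: integrable0.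
    by rewrite big_nil; under eq_Rintegral do rewrite big_nil; rewrite /Rintegral integral0.
  have -> : (fun x => \sum_(k <- j :: r) F k x) = (fun x => F j x + \sum_(k <- r) F k x).
    by apply/funext => x; rewrite big_cons.
  rewrite big_cons IH2 RintegralD //; split => //.
  exact: (@integrableD _ _ _ mu setT measurableT (EFin \o F j) (EFin \o _)).
under eq_bigr do under eq_bigr do rewrite e.
have -> : \sum_j \sum_k \int[mu]_x (a j k x * v j x * v k x) =
          \int[mu]_x \sum_j \sum_k (a j k x * v j x * v k x).
  under eq_bigr do rewrite (S0 _ _ (I _)).2.
  by apply: (S0 _ _ _).2 => j; apply: (S0 _ _ _).1.
by apply: Rintegral_ge0 => x _; exact: H.
Qed.

Lemma bmul_ge0 a (u : V) : bm a -> (forall x, 0 <= a x) -> 0 <= ip u (bmul a u).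
Proof.
move=> ba a0; rewrite ipE; apply: Rintegral_ge0 => x _; rewrite bmulE //.
by rewrite mulrCA mulr_ge0 // -expr2 sqr_ge0.
Qed.

Lemma ip_bmul_le a b (u : V) : bm a -> bm b -> (forall x, a x <= b x) ->
  ip u (bmul a u) <= ip u (bmul b u).
Proof.
move=> ba bb ab; rewrite -subr_ge0 -ipBr.
have -> : bmul b u - bmul a u = bmul (fun x => b x + (-1) * a x) u.
  apply: L2_eqP => x; rewrite L2BE !bmulE //; first by ring.
  by apply: bmD => //; apply: bmM => //; exact: bm_cst.
apply: bmul_ge0 => [|x]; last by rewrite mulN1r subr_ge0.
by apply: bmD => //; apply: bmM => //; exact: bm_cst.
Qed.

(** Pointwise, [b p^2 + b r^2 - 2 a p r] is half of [(b + a) (p - r)^2 + (b - a) (p + r)^2]; the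
    sign [e] provides the absolute value. *)
Lemma ip_bmul_AMGM a b (u v : V) (t : R) : bm a -> bm b -> (forall x, `|a x| <= b x) -> 0 < t ->
  2 * `|ip u (bmul a v)| <= t * ip u (bmul b u) + t^-1 * ip v (bmul b v).
Proof.
move=> ba bb ab t0.
have ti : t * t^-1 = 1 by rewrite divff // gt_eqF.
have key (e : R) : e ^+ 2 = 1 ->
    0 <= t * ip u (bmul b u) + t^-1 * ip v (bmul b v) - 2 * (e * ip u (bmul a v)).
  move=> e1.
  pose z := bmul b u. pose y := bmul b v.
  have -> : t * ip u (bmul b u) + t^-1 * ip v (bmul b v) - 2 * (e * ip u (bmul a v)) =
     ip (t *: u) (bmul b u) + ip (t^-1 *: v) (bmul b v) + ip ((- 2 * e) *: u) (bmul a v).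
    by rewrite !ipZl; ring.
  rewrite !ipE -!RintegralD //; try exact: L2_int; last first.
    have i1 := L2_int (t *: u) (bmul b u); have i2 := L2_int (t^-1 *: v) (bmul b v).
    exact: (integrableD measurableT i1 i2).
  apply: Rintegral_ge0 => x _; rewrite !bmulE // !L2ZE.
  have := ab x; rewrite ler_norml => /andP[a1 a2].
  have -> : t * u x * (b x * u x) + t^-1 * v x * (b x * v x) + - 2 * e * u x * (a x * v x) =
    t^-1 * (b x * (e * t * u x) ^+ 2 + b x * (v x) ^+ 2 - 2 * (a x) * ((e * t * u x) * v x)).
    rewrite !exprMn e1; field; lra.
  rewrite mulr_ge0 ?invr_ge0 ?(ltW t0) //.
  set p := e * t * u x; set r := v x.
  have -> : b x * p ^+ 2 + b x * r ^+ 2 - 2 * a x * (p * r) =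
    2^-1 * ((b x + a x) * (p - r) ^+ 2 + (b x - a x) * (p + r) ^+ 2) by field.
  by rewrite mulr_ge0 ?invr_ge0 // addr_ge0 // mulr_ge0 ?sqr_ge0 //; lra.
have k1 := key 1 (expr1n _ _); have k2 : _ := key (-1) (etrans (sqrrN 1) (expr1n _ _)).
have : `|2 * ip u (bmul a v)| <= t * ip u (bmul b u) + t^-1 * ip v (bmul b v).
  by rewrite ler_norml; apply/andP; split; lra.
by rewrite normrM ger0_norm.
Qed.
End weighted_form.

Section spinors.
Context {R : realType} (n : nat).
Local Notation V := (L2 (@leb3 R)).
Local Notation U := {ffun 'I_n -> V}.
Implicit Types (u v w g : U) (i : 'I_n) (j k : 'I_3) (M : 'M[R]_n).

Definition sdot u v : R := \sum_i ip (u i) (v i).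

Lemma sdotC u v : sdot u v = sdot v u.
Proof. by apply: eq_bigr => i _; rewrite ipC. Qed.
Lemma sdotDl u v w : sdot (u + v) w = sdot u w + sdot v w.
Proof. by rewrite -big_split; apply: eq_bigr => i _; rewrite ffunE ipDl. Qed.
Lemma sdotZl a u w : sdot (a *: u) w = a * sdot u w.
Proof. by rewrite big_distrr; apply: eq_bigr => i _; rewrite ffunE ipZl. Qed.
Lemma sdot_ge0 u : 0 <= sdot u u.
Proof. by apply: sumr_ge0 => i _; exact: nrm2_ge0. Qed.
Lemma sdotNl u w : sdot (- u) w = - sdot u w.
Proof. by rewrite -scaleN1r sdotZl mulN1r. Qed.
Lemma sdotDr u v w : sdot w (u + v) = sdot w u + sdot w v.
Proof. by rewrite sdotC sdotDl !(sdotC _ w). Qed.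
Lemma sdotZr a u w : sdot w (a *: u) = a * sdot w u.
Proof. by rewrite sdotC sdotZl (sdotC _ w). Qed.
Lemma sdotNr u w : sdot w (- u) = - sdot w u.
Proof. by rewrite sdotC sdotNl (sdotC _ w). Qed.
Lemma sdot0l u : sdot 0 u = 0.
Proof. by rewrite -(scale0r 0) sdotZl mul0r. Qed.
Lemma sdot_suml I r (P : pred I) (F : I -> U) w :
  sdot (\sum_(i <- r | P i) F i) w = \sum_(i <- r | P i) sdot (F i) w.
Proof. by apply: (big_morph (fun u => sdot u w)) => [u v|]; rewrite ?sdotDl ?sdot0l. Qed.
Lemma sdot_sumr I r (P : pred I) (F : I -> U) w :
  sdot w (\sum_(i <- r | P i) F i) = \sum_(i <- r | P i) sdot w (F i).
Proof. by rewrite sdotC sdot_suml; apply: eq_bigr => i _; rewrite sdotC. Qed.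

Definition ueq := eqd sdot.

Lemma ueqP u v : ueq u v <-> forall i, weq (u i) (v i).
Proof.
split=> [h i z|h w]; last by apply: eq_bigr => i _; exact: h.
have E y : sdot y [ffun k => if k == i then z else 0] = ip (y i) z.
  rewrite /sdot (bigD1 i) //= ffunE eqxx big1 ?addr0 // => k ki.
  by rewrite ffunE (negbTE ki) ip0r.
by rewrite -!E; exact: h.
Qed.

Definition mact M u : U := [ffun i => \sum_k M i k *: u k].

Lemma mactD M u v : mact M (u + v) = mact M u + mact M v.
Proof.
apply/ffunP => i; rewrite !ffunE -big_split; apply: eq_bigr => k _.
by rewrite ffunE scalerDr.
Qed.
Lemma mactZ M a u : mact M (a *: u) = a *: mact M u.
Proof.
apply/ffunP => i; rewrite !ffunE scaler_sumr; apply: eq_bigr => k _.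
by rewrite ffunE !scalerA mulrC.
Qed.
Lemma mactDl M M' u : mact (M + M') u = mact M u + mact M' u.
Proof.
apply/ffunP => i; rewrite !ffunE -big_split; apply: eq_bigr => k _.
by rewrite mxE scalerDl.
Qed.
Lemma mactZl a M u : mact (a *: M) u = a *: mact M u.
Proof.
apply/ffunP => i; rewrite !ffunE scaler_sumr; apply: eq_bigr => k _.
by rewrite mxE scalerA.
Qed.
Lemma mactM M M' u : mact (M *m M') u = mact M (mact M' u).
Proof.
apply/ffunP => i; rewrite !ffunE.
under [RHS]eq_bigr do rewrite ffunE scaler_sumr.
rewrite exchange_big; apply: eq_bigr => k _ /=.
by rewrite mxE scaler_suml; apply: eq_bigr => l _; rewrite scalerA.
Qed.
Lemma mact1 u : mact 1%:M u = u.
Proof.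
apply/ffunP => i; rewrite ffunE (bigD1 i) //= mxE eqxx scale1r big1 ?addr0 // => k ki.
by rewrite mxE eq_sym (negbTE ki) scale0r.
Qed.
Lemma mact_sum M I r (P : pred I) (F : I -> U) :
  mact M (\sum_(i <- r | P i) F i) = \sum_(i <- r | P i) mact M (F i).
Proof.
apply: (big_morph (mact M)) => [u v|]; first exact: mactD.
by rewrite -(scale0r 0) mactZ !scale0r.
Qed.
Lemma sdot_mact M u v : sdot (mact M u) v = sdot u (mact M^T v).
Proof.
rewrite /sdot; under eq_bigr do rewrite ffunE ip_suml.
rewrite exchange_big; apply: eq_bigr => k _; rewrite ffunE ip_sumr.
by apply: eq_bigr => i _; rewrite ipZl ipZr mxE.
Qed.

Definition PD j u g := forall i, pd j (u i) (g i).

Lemma pd_sum j (I : Type) (r : list I) (F G : I -> V) : (forall x, pd j (F x) (G x)) ->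
  pd j (\sum_(i <- r) F i) (\sum_(i <- r) G i).
Proof.
move=> H; elim: r => [|i r IH]; first by rewrite !big_nil; exact: pd0.
by rewrite !big_cons; exact: pdD.
Qed.

Lemma PDD j u g v h : PD j u g -> PD j v h -> PD j (u + v) (g + h).
Proof. by move=> a b i; rewrite !ffunE; exact: pdD. Qed.
Lemma PDZ j a u g : PD j u g -> PD j (a *: u) (a *: g).
Proof. by move=> h i; rewrite !ffunE; exact: pdZ. Qed.
Lemma PD_sum j (I : Type) (r : list I) (F G : I -> U) : (forall x, PD j (F x) (G x)) ->
  PD j (\sum_(i <- r) F i) (\sum_(i <- r) G i).
Proof.
move=> H; elim: r => [|i r IH]; last by rewrite !big_cons; exact: PDD.
by rewrite !big_nil => i; rewrite ffunE; exact: pd0.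
Qed.
Lemma PD_mact j M u g : PD j u g -> PD j (mact M u) (mact M g).
Proof. by move=> h i; rewrite !ffunE; apply: pd_sum => k; exact: pdZ. Qed.
Lemma PD_skew j u g w h : PD j u g -> PD j w h -> sdot g w = - sdot u h.
Proof. by move=> a b; rewrite /sdot -sumrN; apply: eq_bigr => i _; apply: pd_skew (a i) (b i). Qed.
Lemma PD_uniq j u g g' : PD j u g -> PD j u g' -> ueq g g'.
Proof. by move=> a b; apply/ueqP => i; apply: pd_uniq (a i) (b i). Qed.
Lemma PD_ueq j u g u' g' : ueq u u' -> ueq g g' -> PD j u g -> PD j u' g'.
Proof. by move=> /ueqP a /ueqP b h i; apply: pd_weq (a i) (b i) (h i). Qed.

Definition Bm (a : E3 R -> R) u : U := [ffun i => bmul a (u i)].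

Lemma BmE a u i : Bm a u i = bmul a (u i). Proof. by rewrite ffunE. Qed.
Lemma BmD a u v : bm a -> Bm a (u + v) = Bm a u + Bm a v.
Proof. by move=> ba; apply/ffunP => i; rewrite !ffunE bmulD. Qed.
Lemma BmZ a c u : bm a -> Bm a (c *: u) = c *: Bm a u.
Proof. by move=> ba; apply/ffunP => i; rewrite !ffunE bmulZ. Qed.
Lemma Bm_sum a (I : Type) (r : list I) (F : I -> U) : bm a ->
  Bm a (\sum_(i <- r) F i) = \sum_(i <- r) Bm a (F i).
Proof.
move=> ba; apply: (big_morph (Bm a)) => [u v|]; first exact: BmD.
by rewrite -(scale0r 0) BmZ // !scale0r.
Qed.
Lemma Bm_mact a M u : bm a -> Bm a (mact M u) = mact M (Bm a u).
Proof.
move=> ba; apply/ffunP => i; rewrite !ffunE; apply: L2_eqP => x.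
rewrite bmulE // !L2sumE mulr_sumr; apply: eq_bigr => k _.
by rewrite ffunE !L2ZE bmulE //; ring.
Qed.
Lemma sdot_Bm a u v : bm a -> sdot (Bm a u) v = sdot u (Bm a v).
Proof. by move=> ba; apply: eq_bigr => i _; rewrite !ffunE ip_bmul. Qed.
Lemma BmM a b u : bm a -> bm b -> Bm a (Bm b u) = Bm (fun x => a x * b x) u.
Proof.
move=> ba bb; apply/ffunP => i; rewrite !ffunE; apply: L2_eqP => x.
by rewrite !bmulE ?mulrA//; exact: bmM.
Qed.
Lemma BmDl a b u : bm a -> bm b -> Bm (fun x => a x + b x) u = Bm a u + Bm b u.
Proof. by move=> ba bb; apply/ffunP => i; rewrite !ffunE bmulDl. Qed.
Lemma Bm_suml (I : Type) (r : list I) (a : I -> E3 R -> R) u : (forall y, bm (a y)) ->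
  Bm (fun x => \sum_(i <- r) a i x) u = \sum_(i <- r) Bm (a i) u.
Proof.
move=> ba; suff [] : bm (fun x => \sum_(i <- r) a i x) /\
    Bm (fun x => \sum_(i <- r) a i x) u = \sum_(i <- r) Bm (a i) u by [].
elim: r => [|i r [IH1 IH2]].
  have -> : (fun x => \sum_(i <- [::]) a i x) = cst 0 by apply/funext => x; rewrite big_nil.
  split; first exact: bm_cst.
  rewrite big_nil; apply/ffunP => i; rewrite !ffunE; apply: L2_eqP => x.
  by rewrite (bmulE _ _ (@bm_cst _ _ _ 0)) mul0r.
have -> : (fun x => \sum_(j <- i :: r) a j x) = (fun x => a i x + \sum_(j <- r) a j x).
  by apply/funext => x; rewrite big_cons.
by rewrite big_cons BmDl // IH2; split => //; exact: bmD.
Qed.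
Lemma Bm_ueq a u v : bm a -> ueq u v -> ueq (Bm a u) (Bm a v).
Proof. by move=> ba h w; rewrite !sdot_Bm // h. Qed.
Lemma PD_Bm j a a' u g : C1b j a a' -> PD j u g -> PD j (Bm a u) (Bm a' u + Bm a g).
Proof. by move=> h k i; rewrite !ffunE; exact: pd_bmul. Qed.
Lemma Bm_ge0 a u : bm a -> (forall x, 0 <= a x) -> 0 <= sdot u (Bm a u).
Proof. by move=> ba a0; apply: sumr_ge0 => i _; rewrite ffunE; exact: bmul_ge0. Qed.
Lemma sdot_Bm_le a b u : bm a -> bm b -> (forall x, a x <= b x) ->
  sdot u (Bm a u) <= sdot u (Bm b u).
Proof. by move=> ba bb ab; apply: ler_sum => i _; rewrite !ffunE; exact: ip_bmul_le. Qed.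
Lemma Bm_AMGM a b u v (t : R) : bm a -> bm b -> (forall x, `|a x| <= b x) -> 0 < t ->
  2 * `|sdot u (Bm a v)| <= t * sdot u (Bm b u) + t^-1 * sdot v (Bm b v).
Proof.
move=> ba bb ab t0; apply: (@le_trans _ _ (2 * \sum_i `|ip (u i) (Bm a v i)|)).
  by rewrite ler_wpM2l // ler_norm_sum.
rewrite !mulr_sumr -big_split; apply: ler_sum => i _; rewrite !ffunE; exact: ip_bmul_AMGM.
Qed.
Lemma sdot_AMGM u v (t : R) : 0 < t ->
  2 * `|sdot u v| <= t * sdot u u + t^-1 * sdot v v.
Proof.
move=> t0; apply: (@le_trans _ _ (2 * \sum_i `|ip (u i) (v i)|)).
  by rewrite ler_wpM2l // ler_norm_sum.
rewrite !mulr_sumr -big_split; apply: ler_sum => i _; exact: ip_AMGM.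
Qed.
Lemma sdot_sqD u v : sdot (u + v) (u + v) <= 2 * sdot u u + 2 * sdot v v.
Proof.
rewrite /sdot !mulr_sumr -big_split; apply: ler_sum => i _; rewrite !ffunE; exact: nrm2D.
Qed.
Lemma Bm_psd m (a : 'I_m -> 'I_m -> E3 R -> R) (v : 'I_m -> U) : (forall x y, bm (a x y)) ->
  (forall x (y : 'I_m -> R), 0 <= \sum_j \sum_k a j k x * y j * y k) ->
  0 <= \sum_j \sum_k sdot (v j) (Bm (a j k) (v k)).
Proof.
move=> ba H; rewrite /sdot; under eq_bigr do rewrite exchange_big /=.
rewrite exchange_big; apply: sumr_ge0 => i _ /=.
under eq_bigr do under eq_bigr do rewrite ffunE.
exact: (@psd_form _ _ _ _ m a (fun x => v x i) ba H).
Qed.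

Definition St j (h : R) u : U := [ffun i => st j h (u i)].

Lemma St_ueq j h u v : ueq u v -> ueq (St j h u) (St j h v).
Proof. by move=> /ueqP a; apply/ueqP => i; rewrite !ffunE; exact: st_weq. Qed.
Lemma PD_St k j h u g : PD k u g -> PD k (St j h u) (St j h g).
Proof. by move=> a i; rewrite !ffunE; exact: pd_st. Qed.
Lemma St_lip j h u g : PD j u g -> sdot (St j h u - u) (St j h u - u) <= h ^+ 2 * sdot g g.
Proof.
move=> a; rewrite /sdot mulr_sumr; apply: ler_sum => i _; rewrite !ffunE.
exact: (st_lip h (a i)).
Qed.
Lemma St_le j h u : sdot (St j h u) (St j h u) <= sdot u u.
Proof. by apply: ler_sum => i _; rewrite ffunE; exact: nrm2_st. Qed.
Lemma StD j h u v : ueq (St j h (u + v)) (St j h u + St j h v).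
Proof. by apply/ueqP => i; rewrite !ffunE; exact: stD. Qed.
Lemma StZ j h a u : ueq (St j h (a *: u)) (a *: St j h u).
Proof. by apply/ueqP => i; rewrite !ffunE; exact: stZ. Qed.
Lemma StB j h u v : ueq (St j h (u - v)) (St j h u - St j h v).
Proof. by apply/ueqP => i; rewrite !ffunE; exact: stB. Qed.
Lemma StC j k h u : ueq (St j h (St k h u)) (St k h (St j h u)).
Proof. by apply/ueqP => i; rewrite !ffunE; apply: stekC; e3flow. Qed.
Lemma St_sum j h (I : Type) (r : list I) (F : I -> U) :
  ueq (St j h (\sum_(i <- r) F i)) (\sum_(i <- r) St j h (F i)).
Proof.
elim: r => [|i r IH] w.
  by rewrite !big_nil; have := StZ j h 0 0 w; rewrite scale0r => ->; rewrite sdotZl mul0r sdot0l.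
by rewrite !big_cons StD !sdotDl IH.
Qed.
Lemma St_mact j h M u : ueq (St j h (mact M u)) (mact M (St j h u)).
Proof.
apply/ueqP => i; rewrite !ffunE => z.
have S (r : list 'I_n) : ip (st j h (\sum_(k <- r) M i k *: u k)) z =
  ip (\sum_(k <- r) M i k *: St j h u k) z.
  elim: r => [|k r IH].
    by rewrite !big_nil; have := stZ j h 0 0 z; rewrite scale0r => ->; rewrite ipZl mul0r ip0l.
  by rewrite !big_cons stD !ipDl IH stZ !ipZl ffunE.
exact: S.
Qed.

Definition dq j (h : R) u : U :=
  [ffun i => h^-1 *: (tau e3shift (h *: unit_vec j) (u i) - u i)].
Lemma PD_St_dq j h u : h != 0 -> PD j (St j h u) (dq j h u).
Proof. by move=> h0 i; rewrite !ffunE; exact: pd_st_diff. Qed.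
Lemma PD_dq k j h u g : PD k u g -> PD k (dq j h u) (dq j h g).
Proof.
move=> a i; rewrite !ffunE; apply: pdZ; apply: pdD.
  by apply: aD_tau (a i); e3flow.
by rewrite -scaleN1r -(scaleN1r (g i)); exact: pdZ.
Qed.
End spinors.

(** * The squared Dirac operator *)

Section dirac_relation.
Context {R : realType} (n : nat).
Local Notation V := (L2 (@leb3 R)).
Local Notation U := {ffun 'I_n -> V}.
Variables (N : 'I_3 -> 'M[R]_n) (B J : 'M[R]_n).
Hypothesis N_anti : forall j, (N j)^T = - N j.
Hypothesis B_sym : B^T = B.
Hypothesis J_anti : J^T = - J.
Hypothesis NN : forall j k, N j *m N k + N k *m N j = - ((j == k)%:R *+ 2)%:M.
Hypothesis NB : forall j, N j *m B + B *m N j = 0.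
Hypothesis BB : B *m B = 1%:M.
Hypothesis JJ : J *m J = - 1%:M.
Hypothesis NJ : forall j, N j *m J = J *m N j.
Hypothesis BJ : B *m J = J *m B.
Implicit Types (u v w f z : U) (g : 'I_3 -> U) (j : 'I_3).

(** The graph of the Dirac operator, [N j] standing for [-i alpha_j]. The weak derivatives are
    existentially quantified and the value is free up to null sets. *)
Definition drel u h := exists g, (forall j, PD j u (g j)) /\
  ueq h (\sum_j mact (N j) (g j) + mact B u).

Local Notation act := (@mact R n).
Let dotJ u v : sdot (act J u) v = - sdot u (act J v).
Proof. by rewrite sdot_mact J_anti -scaleN1r mactZl sdotZr mulN1r. Qed.
Let dotJJ u v : sdot (act J (act J u)) v = - sdot u v.
Proof. by rewrite -mactM JJ -scaleN1r mactZl mact1 sdotZl mulN1r. Qed.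

Let actN M u : act (- M) u = - act M u.
Proof. by rewrite -scaleN1r mactZl scaleN1r. Qed.

Lemma mact_ueq M u v : ueq u v -> ueq (act M u) (act M v).
Proof. by move=> h w; rewrite !sdot_mact h. Qed.

Lemma drelD u h v k : drel u h -> drel v k -> drel (u + v) (h + k).
Proof.
move=> [g [ug hg]] [g' [vg kg]]; exists (fun j => g j + g' j); split=> [j|z].
  exact: PDD.
rewrite sdotDl hg kg -sdotDl mactD; congr (sdot _ z).
by rewrite (eq_bigr _ (fun j _ => mactD _ _ _)) big_split addrACA.
Qed.

Lemma drelZ a u h : drel u h -> drel (a *: u) (a *: h).
Proof.
move=> [g [ug hg]]; exists (fun j => a *: g j); split=> [j|z]; first exact: PDZ.
rewrite sdotZl hg -sdotZl mactZ; congr (sdot _ z).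
by rewrite (eq_bigr _ (fun j _ => mactZ _ _ _)) -scaler_sumr scalerDr.
Qed.

Lemma drelJ u h : drel u h -> drel (act J u) (act J h).
Proof.
move=> [g [ug hg]]; exists (fun j => act J (g j)); split=> [j|z]; first exact: PD_mact.
rewrite (mact_ueq J hg); congr (sdot _ z).
rewrite mactD mact_sum -!mactM BJ; congr (_ + _); apply: eq_bigr => j _.
by rewrite -!mactM NJ.
Qed.

Lemma drel_sym u h v k : drel u h -> drel v k -> sdot h v = sdot u k.
Proof.
move=> [g [ug hg]] [g' [vg kg]]; rewrite hg (sdotC u) kg !sdotDl !sdot_mact B_sym (sdotC v).
congr (_ + _); last by rewrite -{1}B_sym sdot_mact sdotC B_sym sdotC.
rewrite !sdot_suml; apply: eq_bigr => j _.
rewrite sdot_mact N_anti -scaleN1r mactZl sdotZr mulN1r.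
by rewrite (PD_skew (ug j) (PD_mact (N j) (vg j))) opprK sdotC.
Qed.

Definition dsol := sol (@sdot R n) (act J) drel.

Lemma dsolE l m u f : dsol l m u f <-> exists g, (forall j, PD j u (g j)) /\
  ueq f (\sum_j act (N j) (g j) + act (B - l%:M - m *: J) u).
Proof.
have E u' g : \sum_j act (N j) (g j) + act (B - l%:M - m *: J) u' =
    \sum_j act (N j) (g j) + act B u' - l *: u' - m *: act J u'.
  rewrite !(mactDl, actN, mactZl) -scalemx1 mactZl mact1.
  by rewrite !addrA.
split=> [[h [g [ug hg]] e]|[g [ug e]]].
  exists g; split => // z; rewrite -e E -!addrA sdotDl hg -sdotDl; congr sdot.
  by rewrite -!addrA.
exists (\sum_j act (N j) (g j) + act B u); first by exists g.
by move=> z; rewrite e E.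
Qed.

(** Averaging in all three coordinates gains one derivative in every direction, since the averages
    commute and any of them can be taken as the outermost. *)
Definition A3 (h : R) u : U := St (inord 0) h (St (inord 1) h (St (inord 2) h u)).

Lemma A3_ueq h u v : ueq u v -> ueq (A3 h u) (A3 h v).
Proof. by move=> e; do 3! apply: St_ueq. Qed.

Lemma A3_PD h j u (g : U) : PD j u g -> PD j (A3 h u) (A3 h g).
Proof. by move=> e; do 3! apply: PD_St. Qed.

Lemma A3_affine h g u M :
  ueq (A3 h (\sum_j act (N j) (g j) + act M u))
      (\sum_j act (N j) (A3 h (g j)) + act M (A3 h u)).
Proof.
have E l g' u' : ueq (St l h (\sum_j act (N j) (g' j) + act M u'))
   (\sum_j act (N j) (St l h (g' j)) + act M (St l h u')).
  move=> z; rewrite StD !sdotDl St_mact St_sum !sdot_suml; congr (_ + _).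
  by apply: eq_bigr => j _; rewrite St_mact.
move=> z; rewrite (St_ueq _ _ (St_ueq _ _ (E _ _ _))) (St_ueq _ _ (E _ _ _)) E.
by [].
Qed.

(** With the average in direction [k] outermost, the derivative is a difference quotient of the
    other two averages. Having it as an operator [D] that respects derivatives yields the symmetry
    of second derivatives in [helmholtz]. *)
Lemma A3_diff (h : R) : h != 0 -> forall k, exists D : U -> U,
  (forall u, PD k (A3 h u) (D u)) /\ (forall j u (g : U), PD j u g -> PD j (D u) (D g)).
Proof.
move=> h0 k.
have : [\/ k = inord 0, k = inord 1 | k = inord 2].
  by case: k => [[|[|[|//]]] ?]; [constructor 1|constructor 2|constructor 3]; apply/val_inj;
     rewrite /= inordK.
move=> [] ->.
- exists (fun u => dq (inord 0) h (St (inord 1) h (St (inord 2) h u))).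
  split=> [u|j u g ug]; first exact: PD_St_dq.
  by apply: PD_dq; do 2! apply: PD_St.
- exists (fun u => dq (inord 1) h (St (inord 0) h (St (inord 2) h u))).
  split=> [u|j u g ug]; last by apply: PD_dq; do 2! apply: PD_St.
  by apply: PD_ueq (PD_St_dq _ _ h0) => [z|//]; exact: StC.
- exists (fun u => dq (inord 2) h (St (inord 0) h (St (inord 1) h u))).
  split=> [u|j u g ug]; last by apply: PD_dq; do 2! apply: PD_St.
  apply: PD_ueq (PD_St_dq _ _ h0) => [z|//].
  by rewrite StC; apply: St_ueq => y; rewrite StC.
Qed.

Lemma A3_lip u g : (forall j, PD j u (g j)) ->
  exists C, forall h, sdot (A3 h u - u) (A3 h u - u) <= C * h ^+ 2.
Proof.
(* Each average sends a bound [c K] to [2 c K + 2 K], and three of them give 1, 4, 10. *)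
move=> ug; exists (10 * \sum_j sdot (g j) (g j)) => h.
have L j : sdot (St j h u - u) (St j h u - u) <= h ^+ 2 * \sum_j sdot (g j) (g j).
  apply: le_trans (St_lip h (ug j)) _; rewrite ler_wpM2l ?sqr_ge0 //.
  by rewrite (bigD1 j) //= lerDl sumr_ge0 // => k _; exact: sdot_ge0.
set K := h ^+ 2 * _ in L.
have L2 j v (c : R) : sdot (v - u) (v - u) <= c * K ->
    sdot (St j h v - u) (St j h v - u) <= 2 * (c * K) + 2 * K.
  move=> vu; have -> : sdot (St j h v - u) (St j h v - u) =
      sdot ((St j h (v - u)) + (St j h u - u)) ((St j h (v - u)) + (St j h u - u)).
    have e : ueq (St j h v - u) (St j h (v - u) + (St j h u - u)).
      by move=> z; rewrite !sdotDl StB !sdotDl !sdotNl; ring.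
    by rewrite e sdotC e.
  apply: le_trans (sdot_sqD _ _) _; apply: lerD; rewrite ler_wpM2l //.
  exact: le_trans (St_le _ _ _) vu.
have e2 : sdot (St (inord 2) h u - u) (St (inord 2) h u - u) <= 1 * K by rewrite mul1r.
have e1 : sdot (St (inord 1) h (St (inord 2) h u) - u) (St (inord 1) h (St (inord 2) h u) - u) <= 4 * K.
  by apply: le_trans (L2 _ _ _ e2) _; lra.
by apply: le_trans (L2 _ _ _ e1) _; rewrite -/K mulrAC -mulrA -/K; lra.
Qed.

(** Here [u = (H + z) w] and [f = (H - z) u]. After averaging, the first-order terms cancel, because
    [N k] anticommutes with [B] and commutes with [J], and the zero-order ones give [1 - z^2]. *)
Lemma helmholtz (h l m : R) w u f : h != 0 -> dsol (- l) (- m) w u -> dsol l m u f ->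
  exists (W : U) (G : 'I_3 -> U) (S : 'I_3 -> 'I_3 -> U),
  [/\ forall j, PD j W (G j), forall j k, PD k (G j) (S j k),
      forall j k, ueq (S j k) (S k j),
      ueq (A3 h u) (\sum_j act (N j) (G j) + act (B + l%:M + m *: J) W) &
      forall z, sdot (A3 h f) z = - \sum_j sdot (S j j) z -
        (l ^+ 2 - m ^+ 2 - 1) * sdot W z - 2 * l * m * sdot (act J W) z].
Proof.
move=> h0 /dsolE[g [wg eu]] /dsolE[gu [ug ef]].
have /choice[D HD] := A3_diff h0.
have DA k v : PD k (A3 h v) (D k v) by exact: (HD k).1.
set P := B + l%:M + m *: J; set Q := B - l%:M - m *: J in ef.
have Pe : B - (- l)%:M - (- m) *: J = P by rewrite scaleNr raddfN /= !opprK.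
rewrite Pe in eu.
pose W := A3 h w; pose G j := A3 h (g j); pose S j k := D k (g j).
have WG j : PD j W (G j) by exact: A3_PD.
have GS j k : PD k (G j) (S j k) by exact: DA.
have SS j k : ueq (S j k) (S k j).
  apply: (@PD_uniq _ _ j (D k w)); first exact: (HD k).2.
  apply: PD_ueq (GS k j) => // z; apply: (PD_uniq (WG k)); exact: DA.
have eAu : ueq (A3 h u) (\sum_j act (N j) (G j) + act P W).
  by move=> z; rewrite (A3_ueq h eu) A3_affine.
exists W, G, S; split => // z.
have guk k : ueq (A3 h (gu k)) (\sum_j act (N j) (S j k) + act P (G k)).
  apply: (@PD_uniq _ _ k (A3 h u)); first exact: A3_PD.
  apply: (@PD_ueq _ _ k (\sum_j act (N j) (G j) + act P W) (\sum_j act (N j) (S j k) + act P (G k))).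
  - by move=> y; rewrite eAu.
  - by [].
  - by apply: PDD; [apply: PD_sum => j|]; apply: PD_mact.
rewrite (A3_ueq h ef) A3_affine sdotDl sdot_suml.
have -> : sdot (act Q (A3 h u)) z = \sum_k sdot (act (Q *m N k) (G k)) z + sdot (act (Q *m P) W) z.
  rewrite (mact_ueq Q eAu) mactD mact_sum sdotDl sdot_suml -mactM; congr (_ + _).
  by apply: eq_bigr => k _; rewrite mactM.
have -> : \sum_k sdot (act (N k) (A3 h (gu k))) z =
   \sum_k \sum_j sdot (act (N k *m N j) (S j k)) z + \sum_k sdot (act (N k *m P) (G k)) z.
  rewrite -big_split; apply: eq_bigr => k _ /=.
  rewrite (mact_ueq (N k) (guk k)) mactD mact_sum sdotDl sdot_suml -mactM; congr (_ + _).
  by apply: eq_bigr => j _; rewrite mactM.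
have QP : Q *m P = (1 - l ^+ 2 + m ^+ 2)%:M - (2 * l * m) *: J.
  rewrite /Q /P !(mulmxDl, mulmxDr, mulNmx, mulmxN) -!scalemxAl -!scalemxAr.
  rewrite !mul_scalar_mx !mul_mx_scalar BB JJ BJ; move: (J *m B) => X.
  by apply/matrixP => i j; rewrite !mxE; case: (i == j); rewrite ?mulr1n ?mulr0n; ring.
have NQ k : N k *m P = - (Q *m N k).
  have := NB k; move/eqP; rewrite addr_eq0 => /eqP e.
  rewrite /Q /P !(mulmxDl, mulmxDr, mulNmx, mulmxN) -!scalemxAl -!scalemxAr.
  rewrite !mul_scalar_mx !mul_mx_scalar e NJ !opprD !opprK //.
(* By symmetry of [S] the sum may be added to itself with the factors [N k] and [N j] exchanged; the
   Clifford relations keep only the diagonal. *)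
have SN : \sum_k \sum_j sdot (act (N k *m N j) (S j k)) z = - \sum_j sdot (S j j) z.
  set X := \sum_k _.
  have X2 : X = \sum_k \sum_j sdot (act (N j *m N k) (S j k)) z.
    rewrite /X exchange_big; apply: eq_bigr => k _; apply: eq_bigr => j _ /=.
    exact: (mact_ueq _ (SS _ _)).
  have : X + X = - (2 * \sum_j sdot (S j j) z).
    rewrite {2}X2 /X -big_split mulr_sumr -sumrN; apply: eq_bigr => k _ /=.
    rewrite -big_split (bigD1 k) //= -sdotDl -mactDl NN eqxx big1 => [|j jk].
      rewrite actN -scalemx1 mactZl mact1 sdotNl sdotZl /=; ring.
    rewrite -sdotDl -mactDl NN eq_sym (negbTE jk) actN -scalemx1 mactZl mul0rn scale0r sdotNl sdot0l.
    by rewrite oppr0.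
  lra.
have -> : \sum_k sdot (act (N k *m P) (G k)) z = - \sum_k sdot (act (Q *m N k) (G k)) z.
  by rewrite -sumrN; apply: eq_bigr => k _; rewrite NQ actN sdotNl.
rewrite SN QP mactDl actN mactZl -scalemx1 mactZl mact1 !(sdotDl, sdotNl, sdotZl).
ring.
Qed.

End dirac_relation.

(** * Morawetz estimate *)

Section morawetz.
Context {R : realType} (n : nat).
Local Notation V := (L2 (@leb3 R)).
Local Notation U := {ffun 'I_n -> V}.
Variable J : 'M[R]_n.
Hypothesis J_anti : J^T = - J.
Hypothesis JJ : J *m J = - 1%:M.
Local Notation act := (@mact R n).
Variables (W F : U) (G : 'I_3 -> U) (S : 'I_3 -> 'I_3 -> U) (kappa nu : R).
Hypothesis WG : forall j, PD j W (G j).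
Hypothesis GS : forall j k, PD k (G j) (S j k).
Hypothesis SS : forall j k, ueq (S j k) (S k j).
Hypothesis HW : forall z, sdot F z =
  - \sum_j sdot (S j j) z - kappa * sdot W z - nu * sdot (act J W) z.

Let dotJ u v : sdot (act J u) v = - sdot u (act J v).
Proof. by rewrite sdot_mact J_anti -scaleN1r mactZl sdotZr mulN1r. Qed.
Let dotJ0 (u : U) : sdot (act J u) u = 0.
Proof. by have := dotJ u u; rewrite (sdotC u); lra. Qed.
Let dotJJ u v : sdot (act J u) (act J v) = sdot u v.
Proof. by rewrite dotJ -mactM JJ -(scaleN1r 1%:M) mactZl mact1 sdotZr; ring. Qed.

Let dotJB b (u : U) : bm b -> sdot (act J u) (Bm b u) = 0.
Proof.
move=> bb; have e : sdot (act J u) (Bm b u) = - sdot u (Bm b (act J u)) by rewrite dotJ Bm_mact.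
have e2 : sdot u (Bm b (act J u)) = sdot (act J u) (Bm b u) by rewrite -sdot_Bm // sdotC.
lra.
Qed.

Let ibp j (v g : U) : PD j v g -> sdot (S j j) v = - sdot (G j) g.
Proof. by move=> vg; exact: PD_skew (GS j j) vg. Qed.

(** Pair with [J W]: the remaining terms vanish because [J] is antisymmetric. This controls [nu]
    times the unweighted square of [W], however small [nu] is. *)
Lemma energy_J : nu * sdot W W = - sdot F (act J W).
Proof.
rewrite HW dotJJ big1 => [|j _]; first by rewrite sdotC dotJ0; ring.
by rewrite (ibp (PD_mact J (WG j))) sdotC dotJ0 oppr0.
Qed.

Lemma energy : \sum_j sdot (G j) (G j) = kappa * sdot W W + sdot F W.
Proof.
have -> : \sum_j sdot (G j) (G j) = - \sum_j sdot (S j j) W.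
  by rewrite -sumrN; apply: eq_bigr => j _; rewrite (ibp (WG j)) opprK.
by rewrite HW dotJ0; ring.
Qed.

Lemma energy_weighted b b' : (forall j, C1b j b (b' j)) ->
  \sum_j sdot (G j) (Bm b (G j)) =
  kappa * sdot W (Bm b W) + sdot F (Bm b W) - \sum_j sdot (G j) (Bm (b' j) W).
Proof.
move=> bb; have [[bmb _] _ _ _] := bb ord0.
have -> : \sum_j sdot (G j) (Bm b (G j)) =
    - \sum_j sdot (S j j) (Bm b W) - \sum_j sdot (G j) (Bm (b' j) W).
  rewrite -sumrN -sumrB; apply: eq_bigr => j _.
  by rewrite (ibp (PD_Bm (bb j) (WG j))) sdotDr; ring.
rewrite HW.
have -> : sdot (act J W) (Bm b W) = 0.
  exact: dotJB.
by ring.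
Qed.

(** Pair with [M = 2 a.grad W + d W]. As [d] is the divergence of [a], the map from [W] to [M] is
    skew and [kappa] disappears; integrating by parts in the second-order terms leaves the Jacobian
    of [a] and the gradient of [d]. *)
Lemma morawetz_identity a a' d d' : (forall j k, C1b j (a k) (a' j k)) ->
  (forall j, C1b j d (d' j)) -> (forall x, d x = \sum_k a' k k x) ->
  2 * \sum_j \sum_k sdot (G j) (Bm (a' j k) (G k)) + \sum_j sdot (G j) (Bm (d' j) W) =
  2 * nu * \sum_k sdot (act J W) (Bm (a k) (G k)) +
  (2 * \sum_k sdot F (Bm (a k) (G k)) + sdot F (Bm d W)).
Proof.
move=> aa dd da.
have ba k : bm (a k) by have [[]] := aa ord0 k.
have ba' j k : bm (a' j k) by have [[]] := aa j k.
have bd : bm d by have [[]] := dd ord0.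
have bd' j : bm (d' j) by have [[]] := dd j.
have Bd u : Bm d u = \sum_k Bm (a' k k) u.
  by rewrite -Bm_suml //; congr Bm; apply/funext.
pose M := (2 : R) *: (\sum_k Bm (a k) (G k)) + Bm d W.
have MP j : PD j M ((2 : R) *: (\sum_k (Bm (a' j k) (G k) + Bm (a k) (S k j))) +
    (Bm (d' j) W + Bm d (G j))).
  apply: PDD; last exact: PD_Bm.
  by apply: PDZ; apply: PD_sum => k; exact: PD_Bm.
have aS j k : 2 * sdot (G j) (Bm (a k) (S j k)) = - sdot (G j) (Bm (a' k k) (G j)).
  have := PD_skew (GS j k) (PD_Bm (aa k k) (GS j k)).
  by rewrite sdotDr sdotC sdot_Bm //; lra.
have aW k : 2 * sdot W (Bm (a k) (G k)) = - sdot W (Bm (a' k k) W).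
  have := PD_skew (WG k) (PD_Bm (aa k k) (WG k)).
  by rewrite sdotDr sdotC sdot_Bm //; lra.
have E0 : sdot (act J W) (Bm d W) = 0.
  exact: dotJB.
have E1 : sdot W M = 0.
  rewrite /M sdotDr sdotZr sdot_sumr Bd sdot_sumr mulr_sumr -big_split big1 // => k _ /=.
  by rewrite aW addNr.
have E2 j : sdot (S j j) M = - (2 * \sum_k sdot (G j) (Bm (a' j k) (G k)) +
    sdot (G j) (Bm (d' j) W)).
  rewrite (ibp (MP j)) !sdotDr sdotZr big_split /= sdotDr !sdot_sumr.
  have -> : \sum_k sdot (G j) (Bm (a k) (S k j)) = \sum_k sdot (G j) (Bm (a k) (S j k)).
    by apply: eq_bigr => k _; rewrite -!sdot_Bm // sdotC SS sdotC.
  rewrite Bd sdot_sumr.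
  have : 2 * \sum_k sdot (G j) (Bm (a k) (S j k)) + \sum_k sdot (G j) (Bm (a' k k) (G j)) = 0.
    by rewrite mulr_sumr -big_split big1 // => k _ /=; rewrite aS addNr.
  lra.
have := HW M; rewrite E1 (eq_bigr _ (fun j _ => E2 j)) sumrN opprK big_split /= -mulr_sumr.
by rewrite /M !sdotDr !sdotZr !sdot_sumr E0 => h; lra.
Qed.

End morawetz.

Lemma Bm_cst {R : realType} n (c : R) (u : {ffun 'I_n -> L2 (@leb3 R)}) : Bm (cst c) u = c *: u.
Proof.
apply/ffunP => i; rewrite !ffunE; apply: L2_eqP => x; rewrite bmulE ?L2ZE //.
exact: bm_cst.
Qed.

(* [a] is the field of the multiplier [2 a.grad + d] with [d = div a], and
   primes are partial derivatives *)
Record morawetz_weights {R : realType} (th C : R) (a : 'I_3 -> E3 R -> R)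
  (a' : 'I_3 -> 'I_3 -> E3 R -> R) (d : E3 R -> R) (d' : 'I_3 -> E3 R -> R)
  (b : E3 R -> R) (b' : 'I_3 -> E3 R -> R) (c : E3 R -> R) : Prop := MorawetzWeights {
  mw_a : forall j k, C1b j (a k) (a' j k);
  mw_d : forall j, C1b j d (d' j);
  mw_b : forall j, C1b j b (b' j);
  mw_c : bm c;
  mw_div : forall x, d x = \sum_k a' k k x;
  mw_a1 : forall k x, `|a k x| <= 1;
  mw_dC : forall x, `|d x| <= C;
  mw_d'C : forall j x, `|d' j x| <= C * b x;
  mw_b'C : forall j x, `|b' j x| <= C * b x;
  mw_cc : forall x, c x * c x = b x;
  mw_b1 : forall x, 0 <= b x <= 1;
  mw_psd : forall x (y : 'I_3 -> R),
    th * b x * (\sum_j y j ^+ 2) <= 2 * \sum_j \sum_k a' j k x * y j * y k }.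

Section arithmetic.
Variable R : realFieldType.

Let arith_Y (X Y Phi Z D2 kZ g f q rX rY : R) :
  X = kZ + f - g -> - f <= q -> g <= D2 -> 2 * q <= Phi + Z -> 2 * D2 <= rX + 3 * rY ->
  rX <= 1 / 16 * X -> rY <= 1 / 16 * Y -> Z <= Y / 256 -> Y - 2 * Z <= kZ ->
  0 <= X -> 0 <= Y -> 0 <= Phi -> Y <= 5 * X + 2 * Phi.
Proof. lra. Qed.

Let arith_X (tX tY tP Phi P A dW T q1 q2 D1 rX rY rrY : R) :
  2 * A + dW = T + (2 * q1 + q2) -> tX <= 2 * A -> - dW <= D1 -> 2 * D1 <= rX + 3 * rY ->
  T <= 360 * P + tY / 40 -> 2 * q1 <= 24 * P + tX / 8 -> 2 * q2 <= Phi + rrY ->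
  rX <= tX / 120 -> rY <= tY / 120 -> rrY <= tY / 1920 -> tY <= 5 * tX + 2 * tP ->
  0 <= tX -> 0 <= tP -> tX / 2 <= 384 * P + Phi / 2 + tP / 10.
Proof. lra. Qed.

(** [X] and [Y] stand for the weighted squares of [grad W] and [l W]. The weighted energy gives
    [Y <= 5 X + 2 Phi] ([arith_Y]); the multiplier identity bounds [th X] by multiples of [Phi] plus
    small multiples of [X] and [Y] ([arith_X]). The small parameter is [r]. *)
Lemma arith_estimate (th X Y Phi Z D2 kZ g f q r A dW T q1 q2 D1 : R) : 0 < th ->
  0 <= X -> 0 <= Y -> 0 <= Phi -> 0 <= r -> r <= 1 / 16 -> r <= th / 120 ->
  X = kZ + f - g -> - f <= q -> g <= D2 -> 2 * q <= Phi + Z -> 2 * D2 <= r * X + 3 * (r * Y) ->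
  Z <= Y / 256 -> Y - 2 * Z <= kZ ->
  2 * A + dW = T + (2 * q1 + q2) -> th * X <= 2 * A -> - dW <= D1 ->
  2 * D1 <= r * X + 3 * (r * Y) ->
  T <= 3 * (120 / th * Phi + th / 120 * Y) -> 2 * q1 <= 3 * (8 / th) * Phi + th / 8 * X ->
  2 * q2 <= Phi + r * (r * Y) ->
  X + Y <= (12 * (384 / th + 1 / 2 + th / 10) / th + 2) * Phi.
Proof.
move=> th0 X0 Y0 Phi0 r0 r16 rth M2 F3n D2n Q3 Db ZY kY M1 M4 D1n Dd M3 Q1 Q2.
have YX : Y <= 5 * X + 2 * Phi.
  by apply: (arith_Y M2 F3n D2n Q3 Db) => //; rewrite ler_wpM2r.
have key : th * X / 2 <= 384 * (th^-1 * Phi) + Phi / 2 + th * Phi / 10.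
  apply: (@arith_X _ (th * Y) _ _ _ A dW T q1 q2 D1 (r * X) (r * Y) (r * (r * Y))) => //.
  - by apply: le_trans M3 _; rewrite le_eqVlt; apply/orP; left; apply/eqP; field; rewrite gt_eqF.
  - by apply: le_trans Q1 _; rewrite le_eqVlt; apply/orP; left; apply/eqP; field; rewrite gt_eqF.
  - by rewrite mulrAC ler_wpM2r.
  - by rewrite mulrAC ler_wpM2r.
  - apply: (@le_trans _ _ (1 / 16 * (th / 120 * Y))); last by lra.
    by rewrite ler_pM ?ler_wpM2r // mulr_ge0.
  - have -> : 5 * (th * X) + 2 * (th * Phi) = th * (5 * X + 2 * Phi) by ring.
    by rewrite ler_wpM2l // ltW.
  - by rewrite mulr_ge0 // ltW.
  - by rewrite mulr_ge0 // ltW.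
set K1 := 384 / th + 1 / 2 + th / 10.
have XK : X <= 2 * K1 / th * Phi.
  have -> : 2 * K1 / th * Phi = (K1 * Phi) / (th / 2) by field; rewrite gt_eqF.
  rewrite ler_pdivlMr ?divr_gt0 // /K1.
  have -> : X * (th / 2) = th * X / 2 by ring.
  apply: le_trans key _; rewrite le_eqVlt; apply/orP; left; apply/eqP; field; by rewrite gt_eqF.
have -> : (12 * K1 / th + 2) * Phi = 6 * (2 * K1 / th * Phi) + 2 * Phi by ring.
have : 0 <= 2 * K1 / th * Phi by apply: le_trans XK.
lra.
Qed.
End arithmetic.

Section estimate.
Context {R : realType} (n : nat).
Local Notation V := (L2 (@leb3 R)).
Local Notation U := {ffun 'I_n -> V}.
Variable J : 'M[R]_n.
Hypothesis J_anti : J^T = - J.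
Hypothesis JJ : J *m J = - 1%:M.
Local Notation act := (@mact R n).
Variables (th C : R) (a : 'I_3 -> E3 R -> R) (a' : 'I_3 -> 'I_3 -> E3 R -> R) (d : E3 R -> R)
  (d' : 'I_3 -> E3 R -> R) (b : E3 R -> R) (b' : 'I_3 -> E3 R -> R) (c : E3 R -> R).
Hypothesis mw : morawetz_weights th C a a' d d' b b' c.
Hypotheses (th0 : 0 < th) (C0 : 0 <= C).

Let ba k : bm (a k). Proof. by have [[]] := mw_a mw ord0 k. Qed.
Let ba' j k : bm (a' j k). Proof. by have [[]] := mw_a mw j k. Qed.
Let bd : bm d. Proof. by have [[]] := mw_d mw ord0. Qed.
Let bd' j : bm (d' j). Proof. by have [[]] := mw_d mw j. Qed.
Let bb : bm b. Proof. by have [[]] := mw_b mw ord0. Qed.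
Let bb' j : bm (b' j). Proof. by have [[]] := mw_b mw j. Qed.
Let bc : bm c. Proof. exact: mw_c mw. Qed.
Let b0 x : 0 <= b x. Proof. by have /andP[] := mw_b1 mw x. Qed.

Lemma mw_sq (u : U) : sdot (Bm c u) (Bm c u) = sdot u (Bm b u) :> R.
Proof. by rewrite sdot_Bm // BmM //; congr (sdot u (Bm _ u)); apply/funext; exact: mw_cc mw. Qed.

Lemma mw_mult e M (v : U) : bm e -> (forall x, `|e x| <= M) ->
  sdot (Bm e v) (Bm b (Bm e v)) <= M ^+ 2 * sdot v (Bm b v).
Proof.
move=> be eM; rewrite sdot_Bm // -sdotZr -(Bm_cst (M ^+ 2)) !BmM //; try exact: bm_cst; try exact: bmM.
apply: sdot_Bm_le => [||x]; try (do ! apply: bmM => //; exact: bm_cst).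
rewrite /= mulrAC ler_wpM2r //.
by rewrite -expr2 -[_ ^+ 2]real_normK ?num_real // lerXn2r // nnegrE ?(le_trans _ (eM x)).
Qed.

Lemma mw_AMGM e (u v : U) (t : R) : bm e -> (forall x, `|e x| <= C * b x) -> 0 < t ->
  2 * `|sdot u (Bm e v)| <= C * (t * sdot u (Bm b u) + t^-1 * sdot v (Bm b v)).
Proof.
move=> be eC t0.
have bCb : bm (fun x => cst C x * b x) by apply: bmM => //; exact: bm_cst.
apply: le_trans (Bm_AMGM u v be bCb eC t0) _.
by rewrite -!BmM ?Bm_cst ?sdotZr //; try exact: bm_cst; lra.
Qed.

Variables (l m : R) (W F F' : U) (G : 'I_3 -> U) (S : 'I_3 -> 'I_3 -> U).
Hypothesis WG : forall j, PD j W (G j).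
Hypothesis GS : forall j k, PD k (G j) (S j k).
Hypothesis SS : forall j k, ueq (S j k) (S k j).
Hypothesis HW : forall z, sdot F z =
  - \sum_j sdot (S j j) z - (l ^+ 2 - m ^+ 2 - 1) * sdot W z - 2 * l * m * sdot (act J W) z.
Hypothesis FF' : ueq F (Bm c F').
Hypothesis m1 : `|m| <= 1.
Hypothesis lL : 16 + 16 * C + 120 * C / th <= `|l|.

Let X : R := \sum_j sdot (G j) (Bm b (G j)).
Let Z : R := sdot W (Bm b W).
Let Phi : R := sdot F' F'.
Let E : R := `|l|.
Let w : R := sdot W W.

Let dotJJ u v : sdot (act J u) (act J v) = sdot u v.
Proof.
by rewrite sdot_mact J_anti -(scaleN1r J) mactZl -mactM JJ -(scaleN1r 1%:M) mactZl mact1 !sdotZr; ring.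
Qed.

(** The factor [c] carried by [F] moves to [v], whose square then has the weight [c * c = b]. *)
Let FB (v : U) (t : R) : 0 < t -> 2 * `|sdot F v| <= t^-1 * Phi + t * sdot v (Bm b v).
Proof.
move=> t0; rewrite FF' sdot_Bm // -mw_sq.
by have := sdot_AMGM F' (Bm c v) (t := t^-1); rewrite invrK; apply; rewrite invr_gt0.
Qed.

Let E16 : 16 <= E.
Proof.
apply: le_trans lL; rewrite -addrA lerDl addr_ge0 ?mulr_ge0 ?invr_ge0 //.
exact: ltW.
Qed.
Let E0 : 0 < E. Proof. by apply: lt_le_trans E16; rewrite ltr0n. Qed.
Let eE : E^-1 * E = 1. Proof. by rewrite mulVf // gt_eqF. Qed.
Let e0 : 0 < E^-1. Proof. by rewrite invr_gt0. Qed.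
Let w0 : 0 <= w. Proof. exact: sdot_ge0. Qed.
Let Z0 : 0 <= Z. Proof. exact: Bm_ge0. Qed.
Let X0 : 0 <= X. Proof. by apply: sumr_ge0 => j _; exact: Bm_ge0. Qed.
Let Phi0 : 0 <= Phi. Proof. exact: sdot_ge0. Qed.
Let l2 : l ^+ 2 = E ^+ 2. Proof. by rewrite /E real_normK ?num_real. Qed.
Let m2 : m ^+ 2 <= 1.
Proof. by rewrite -[m ^+ 2]real_normK ?num_real // expr_le1. Qed.

(** The term of the multiplier identity without decaying weight. Unweighted Cauchy-Schwarz leaves
    [|nu| (4 E w + E^-1 |sdot F W|)]; [energy_J] then replaces [|nu| w] by a pairing with [F], which
    is weighted. No lower bound on [|m|] enters. *)
Let dissipation : 2 * (2 * l * m) * \sum_k sdot (act J W) (Bm (a k) (G k)) <=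
  3 * (120 / th * Phi + th / 120 * (E ^+ 2 * Z)).
Proof.
(* This share leaves [th / 40] times [Y]; as [Y <= 5 X + 2 Phi], it costs only [th X / 8] of the
   gain [th X]. *)
have t0 : 0 < th / 120 by rewrite divr_gt0.
have ti : (th / 120)^-1 = 120 / th by rewrite invf_div.
set t := th / 120 in t0 ti *.
set nu := 2 * l * m.
have nuE : `|nu| <= 2 * E.
  rewrite /nu normrM normrM (ger0_norm (ler0n R 2)) -[leRHS]mulr1.
  by rewrite ler_wpM2l // mulr_ge0.
have FJ : 2 * E * `|sdot F (act J W)| <= t^-1 * Phi + t * (E ^+ 2 * Z).
  have h : 0 < t * E by rewrite mulr_gt0.
  have := FB (act J W) h; rewrite Bm_mact // dotJJ -/Z => /(ler_wpM2l (ltW E0)).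
  have -> : E * ((t * E)^-1 * Phi + t * E * Z) = t^-1 * Phi + t * (E ^+ 2 * Z).
    by rewrite invfM; transitivity (E^-1 * E * (t^-1 * Phi) + t * (E ^+ 2 * Z)); [ring|rewrite eE mul1r].
  by move=> h'; lra.
have FW : 2 * `|sdot F W| <= t^-1 * Phi + t * (E ^+ 2 * Z).
  have h : 0 < t * E by rewrite mulr_gt0.
  have := FB W h; rewrite -/Z => h1; have : 2 * E * `|sdot F W| <= t^-1 * Phi + t * (E ^+ 2 * Z).
    move: h1 => /(ler_wpM2l (ltW E0)).
    have -> : E * ((t * E)^-1 * Phi + t * E * Z) = t^-1 * Phi + t * (E ^+ 2 * Z).
      by rewrite invfM; transitivity (E^-1 * E * (t^-1 * Phi) + t * (E ^+ 2 * Z)); [ring|rewrite eE mul1r].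
    by move=> h'; lra.
  have := normr_ge0 (sdot F W); set z : R := `|_| => z0 h2.
  by have : 1 * z <= E * z; [rewrite ler_wpM2r //; apply: le_trans E16; rewrite ler1n|lra].
have EJ : `|nu| * w = `|sdot F (act J W)|.
  have := energy_J J_anti JJ WG GS HW; rewrite -/nu -/w => e.
  by rewrite -(ger0_norm w0) -normrM e normrN.
have EG : \sum_k sdot (G k) (G k) <= E ^+ 2 * w + `|sdot F W|.
  rewrite (energy J_anti WG GS HW) -/w; apply: lerD; last exact: ler_norm.
  by rewrite ler_wpM2r // l2; have := sqr_ge0 m; lra.
have S1 : 2 * \sum_k `|sdot (act J W) (Bm (a k) (G k))| <= 3 * E * w + E^-1 * \sum_k sdot (G k) (G k).
  have -> : 3 * E * w + E^-1 * \sum_k sdot (G k) (G k) = \sum_k (E * w + E^-1 * sdot (G k) (G k)).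
    by rewrite big_split /= sumr_const card_ord -mulr_sumr; ring.
  rewrite mulr_sumr; apply: ler_sum => k _.
  apply: le_trans (sdot_AMGM _ _ E0) _; rewrite dotJJ -/w lerD2l ler_wpM2l ?(ltW e0) //.
  rewrite sdot_Bm // BmM //.
  have -> : sdot (G k) (G k) = sdot (G k) (Bm (cst 1) (G k)) by rewrite Bm_cst scale1r.
  apply: sdot_Bm_le => [||x]; [exact: bmM|exact: bm_cst|].
  by rewrite -expr2 -real_normK ?num_real // expr_le1 // (mw_a1 mw).
have S2 : 2 * nu * \sum_k sdot (act J W) (Bm (a k) (G k)) <=
    `|nu| * (2 * \sum_k `|sdot (act J W) (Bm (a k) (G k))|).
  apply: le_trans (ler_norm _) _; have -> (y : R) : 2 * nu * y = nu * (2 * y) by ring.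
  by rewrite normrM ler_wpM2l // normrM (ger0_norm (ler0n R 2)) ler_wpM2l // ler_norm_sum.
apply: le_trans S2 _.
apply: (@le_trans _ _ (`|nu| * (4 * E * w + E^-1 * `|sdot F W|))).
  rewrite ler_wpM2l //; apply: le_trans S1 _.
  have : E^-1 * \sum_k sdot (G k) (G k) <= E^-1 * (E ^+ 2 * w + `|sdot F W|).
    by rewrite ler_wpM2l // ltW.
  have -> : E^-1 * (E ^+ 2 * w + `|sdot F W|) = E^-1 * E * (E * w) + E^-1 * `|sdot F W| by ring.
  by rewrite eE; lra.
have -> : `|nu| * (4 * E * w + E^-1 * `|sdot F W|) =
  4 * E * (`|nu| * w) + `|nu| * (E^-1 * `|sdot F W|) by ring.
rewrite EJ.
have : `|nu| * (E^-1 * `|sdot F W|) <= 2 * E * (E^-1 * `|sdot F W|).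
  by rewrite ler_wpM2r // mulr_ge0 // ltW.
have -> : 2 * E * (E^-1 * `|sdot F W|) = 2 * (E^-1 * E * `|sdot F W|) by ring.
by rewrite eE mul1r -ti; lra.
Qed.

(** Subtract [th * b] from the diagonal of [2 a']: the form stays nonnegative pointwise, and
    [Bm_psd] integrates it. *)
Let psd : th * X <= 2 * \sum_j \sum_k sdot (G j) (Bm (a' j k) (G k)).
Proof.
have := @Bm_psd R n 3 (fun j k x => cst 2 x * a' j k x + cst (- (j == k)%:R * th) x * b x) G.
have bt j k : bm (fun x : E3 R => cst 2 x * a' j k x).
  by apply: bmM => //; exact: bm_cst.
have bs j k : bm (fun x : E3 R => cst (- ((j : 'I_3) == k)%:R * th) x * b x).
  by apply: bmM => //; exact: bm_cst.
move=> /(_ (fun j k => bmD (bt j k) (bs j k))).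
have -> : \sum_j \sum_k sdot (G j) (Bm (fun x => cst 2 x * a' j k x + cst (- (j == k)%:R * th) x * b x) (G k)) =
  2 * (\sum_j \sum_k sdot (G j) (Bm (a' j k) (G k))) - th * X.
  rewrite mulr_sumr /X mulr_sumr -sumrB; apply: eq_bigr => j _.
  have -> : th * sdot (G j) (Bm b (G j)) = \sum_k (j == k)%:R * th * sdot (G j) (Bm b (G k)).
    rewrite (bigD1 j) //= eqxx mul1r big1 ?addr0 // => k jk.
    by rewrite eq_sym (negbTE jk) !mul0r.
  rewrite mulr_sumr -sumrB; apply: eq_bigr => k _.
  rewrite BmDl // -!BmM //; try exact: bm_cst.
  by rewrite !Bm_cst sdotDr !sdotZr; ring.
move=> h; rewrite -subr_ge0; apply: h => x y.
have -> : \sum_j \sum_k (cst 2 x * a' j k x + cst (- (j == k)%:R * th) x * b x) * y j * y k =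
  2 * (\sum_j \sum_k a' j k x * y j * y k) - th * b x * \sum_j y j ^+ 2.
  rewrite !mulr_sumr -sumrB; apply: eq_bigr => j _.
  have -> : th * b x * y j ^+ 2 = \sum_k (j == k)%:R * (th * b x * (y j * y k)).
    rewrite (bigD1 j) //= eqxx mul1r big1 ?addr0 // => k jk.
    by rewrite eq_sym (negbTE jk) !mul0r.
  by rewrite mulr_sumr -sumrB; apply: eq_bigr => k _ /=; ring.
by rewrite subr_ge0; exact: (mw_psd mw).
Qed.

Lemma morawetz_estimate : X + l ^+ 2 * Z <= (12 * (384 / th + 1 / 2 + th / 10) / th + 2) * Phi.
Proof.
have cross e (H : forall j, bm (e j)) : (forall j x, `|e j x| <= C * b x) ->
    2 * `|\sum_j sdot (G j) (Bm (e j) W)| <= C * (E^-1 * X + 3 * (E * Z)).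
  move=> eC; apply: (@le_trans _ _ (\sum_j 2 * `|sdot (G j) (Bm (e j) W)|)).
    by rewrite -mulr_sumr ler_wpM2l // ler_norm_sum.
  have -> : C * (E^-1 * X + 3 * (E * Z)) = \sum_j (C * (E^-1 * sdot (G j) (Bm b (G j)) + E * Z)).
    by rewrite -mulr_sumr big_split -mulr_sumr /= sumr_const card_ord -/X; ring.
  by apply: ler_sum => j _; have := mw_AMGM (G j) W (H j) (eC j) e0; rewrite invrK.
have Dd := cross _ bd' (mw_d'C mw); have Db := cross _ bb' (mw_b'C mw).
set D1 : R := `|_| in Dd; set D2 : R := `|_| in Db.
have M1 := morawetz_identity J_anti WG GS SS HW (mw_a mw) (mw_d mw) (mw_div mw).
have M2 := energy_weighted J_anti WG GS HW (mw_b mw).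
rewrite -/X -/Z in M2.
have Q1 : 2 * \sum_k sdot F (Bm (a k) (G k)) <= 3 * (8 / th) * Phi + th / 8 * X.
  have t0 : 0 < th / 8 by rewrite divr_gt0.
  have -> : 3 * (8 / th) * Phi + th / 8 * X = \sum_k (8 / th * Phi + th / 8 * sdot (G k) (Bm b (G k))).
    by rewrite big_split /= sumr_const card_ord -mulr_sumr -/X; ring.
  rewrite mulr_sumr; apply: ler_sum => k _.
  apply: (@le_trans _ _ (2 * `|sdot F (Bm (a k) (G k))|)); first by rewrite ler_wpM2l // ler_norm.
  apply: le_trans (FB _ t0) _; rewrite invf_div lerD2l ler_wpM2l ?(ltW t0) //.
  by have := mw_mult (G k) (ba k) (mw_a1 mw k); rewrite expr1n mul1r.
have Q2 : 2 * sdot F (Bm d W) <= Phi + C ^+ 2 * Z.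
  have := FB (Bm d W) ltr01; have := mw_mult W bd (mw_dC mw); rewrite invr1 -/Z.
  by have := ler_norm (sdot F (Bm d W)); lra.
have Q3 : 2 * `|sdot F (Bm b W)| <= Phi + Z.
  have b1 x : `|b x| <= 1 by have /andP[h1 h2] := mw_b1 mw x; rewrite ger0_norm.
  have := FB (Bm b W) ltr01; have := mw_mult W bb b1; rewrite invr1 -/Z; lra.
have D1n := ler_norm (- \sum_j sdot (G j) (Bm (d' j) W)); rewrite normrN -/D1 in D1n.
have D2n := ler_norm (\sum_j sdot (G j) (Bm (b' j) W)); rewrite -/D2 in D2n.
have F3n := ler_norm (- sdot F (Bm b W)); rewrite normrN in F3n.
have M3 := dissipation; have M4 := psd.
(* Every cross term with a derivative of [d] or [b] carries the factor [r]; the threshold [lL] makes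
   [E] at least 16 and [r] at most [1 / 16] and [th / 120]. *)
pose Y := E ^+ 2 * Z; pose r := C * E^-1.
have Y0 : 0 <= Y by rewrite mulr_ge0 // sqr_ge0.
have r0 : 0 <= r by rewrite mulr_ge0 // ltW.
have rE : r * E = C by rewrite /r -mulrA eE mulr1.
have Cr : C * (E^-1 * X + 3 * (E * Z)) = r * X + 3 * (r * Y).
  have -> : C * (E^-1 * X + 3 * (E * Z)) = r * X + 3 * (C * E * Z) by rewrite /r; ring.
  by rewrite -rE /Y; ring.
have r16 : r <= 1 / 16.
  rewrite /r ler_pdivrMr //; apply: le_trans (_ : 1 / 16 * (16 * C) <= _); first by lra.
  rewrite ler_wpM2l //; apply: le_trans lL; have : 0 <= 120 * C / th by rewrite divr_ge0 ?mulr_ge0 // ltW.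
  lra.
have rth : r <= th / 120.
  rewrite /r ler_pdivrMr // mulrAC ler_pdivlMr // mulrC -ler_pdivrMl // mulrC.
  have -> : th^-1 * (C * 120) = 120 * C / th by ring.
  by have := lL; rewrite -/E; move: C0; set p : R := 120 * C / th; lra.
have CZ : C ^+ 2 * Z = r * (r * Y) by rewrite -rE /Y; ring.
have EY : E ^+ 2 * Z <= Y by [].
have ZY : Z <= Y / 256.
  have : 256 * Z <= E ^+ 2 * Z by rewrite ler_wpM2r // (_ : 256 = 16 ^+ 2 :> R); [rewrite lerXn2r ?nnegrE //; exact: ltW|ring].
  by rewrite /Y; lra.
have kY : (l ^+ 2 - m ^+ 2 - 1) * Z >= Y - 2 * Z.
  rewrite l2 /Y -mulrBl ler_wpM2r //; have := m2; set mm : R := m ^+ 2; set EE : R := E ^+ 2.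
  by move=> ?; lra.
rewrite Cr in Dd; rewrite Cr in Db; rewrite CZ in Q2.
rewrite l2 -/Y; rewrite -/Y in M3.
exact: (arith_estimate th0 X0 Y0 Phi0 r0 r16 rth M2 F3n D2n Q3 Db ZY kY M1 M4 D1n Dd M3 Q1 Q2).
Qed.
End estimate.

Lemma arith_K (R : realFieldType) (t : R) : 0 < t -> 0 <= 12 * (384 / t + 1 / 2 + t / 10) / t + 2.
Proof.
move=> t0; have y0 : 0 < t^-1 by rewrite invr_gt0.
have h2 : 0 <= 12 * (384 / t + 1 / 2 + t / 10) by lra.
by have := mulr_ge0 h2 (ltW y0); lra.
Qed.

Lemma arith_ge1 (R : realFieldType) (C t l : R) :
  0 <= C -> 0 < t -> 16 + 16 * C + 120 * C / t <= l -> 1 <= l.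
Proof.
move=> C0 t0; have y0 : 0 < t^-1 by rewrite invr_gt0.
by have := mulr_ge0 C0 (ltW y0); lra.
Qed.

(** * Removing the averages from the estimate *)

Section uniform_estimate.
Context {R : realType} (n : nat).
Local Notation V := (L2 (@leb3 R)).
Local Notation U := {ffun 'I_n -> V}.
Variables (N : 'I_3 -> 'M[R]_n) (B J : 'M[R]_n).
Hypothesis N_anti : forall j, (N j)^T = - N j.
Hypothesis B_sym : B^T = B.
Hypothesis J_anti : J^T = - J.
Hypothesis NN : forall j k, N j *m N k + N k *m N j = - ((j == k)%:R *+ 2)%:M.
Hypothesis NB : forall j, N j *m B + B *m N j = 0.
Hypothesis BB : B *m B = 1%:M.
Hypothesis JJ : J *m J = - 1%:M.
Hypothesis NJ : forall j, N j *m J = J *m N j.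
Hypothesis BJ : B *m J = J *m B.
Variables (th C : R) (a : 'I_3 -> E3 R -> R) (a' : 'I_3 -> 'I_3 -> E3 R -> R) (d : E3 R -> R)
  (d' : 'I_3 -> E3 R -> R) (b : E3 R -> R) (b' : 'I_3 -> E3 R -> R) (c : E3 R -> R).
Hypothesis mw : morawetz_weights th C a a' d d' b b' c.
Hypotheses (th0 : 0 < th) (C0 : 0 <= C).
(** Short averages preserve the weighted space. For the power weights this is [st_weight], with the
    4 coming from [wt_shift]. *)
Hypothesis stw : forall j h (v : U), `|h| <= 1 -> exists v' : U,
  ueq (St j h (Bm c v)) (Bm c v') /\ sdot v' v' <= 4 * sdot v v.
Local Notation act := (@mact R n).
Let q (v : U) : R := sdot v (Bm b v).

Let bb : bm b. Proof. by have [[]] := mw_b mw ord0. Qed.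
Let bc : bm c. Proof. exact: mw_c mw. Qed.

Let q0 v : 0 <= q v.
Proof. by apply: Bm_ge0 => // x; have /andP[] := mw_b1 mw x. Qed.
Let qD u v : q (u + v) <= 2 * q u + 2 * q v.
Proof. by rewrite /q -!(mw_sq mw) BmD //; exact: sdot_sqD. Qed.
Let qZ (k : R) u : q (k *: u) = k ^+ 2 * q u.
Proof. by rewrite /q BmZ // sdotZl sdotZr; ring. Qed.
Let q_ueq u v : ueq u v -> q u = q v.
Proof. by move=> e; rewrite /q e -sdot_Bm // sdotC e sdotC sdot_Bm. Qed.
Let q_le u : q u <= sdot u u.
Proof.
have -> : sdot u u = sdot u (Bm (cst 1) u) by rewrite Bm_cst scale1r.
apply: sdot_Bm_le => [||x] //; first exact: bm_cst.
by have /andP[] := mw_b1 mw x.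
Qed.
Let q_act M u : M^T *m M = 1%:M -> q (act M u) = q u.
Proof. by move=> MM; rewrite /q Bm_mact // sdotC sdot_mact -mactM MM mact1 sdotC. Qed.

Lemma N_isom j : (N j)^T *m N j = 1%:M.
Proof.
rewrite N_anti mulNmx; have := NN j j; rewrite eqxx /=; move: (N j *m N j) => P /matrixP e.
apply/matrixP => i k; have := e i k; rewrite !mxE.
by case: (i == k); rewrite ?mulr1n ?mulr0n; lra.
Qed.
Lemma B_isom : B^T *m B = 1%:M. Proof. by rewrite B_sym. Qed.
Lemma J_isom : J^T *m J = 1%:M. Proof. by rewrite J_anti mulNmx JJ opprK. Qed.

Let A3_weight (h : R) (v : U) : `|h| <= 1 -> exists v' : U,
  ueq (A3 h (Bm c v)) (Bm c v') /\ sdot v' v' <= 64 * sdot v v.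
Proof.
move=> h1; have [v1 [e1 n1]] := stw (inord 2) v h1; have [v2 [e2 n2]] := stw (inord 1) v1 h1.
have [v3 [e3 n3]] := stw (inord 0) v2 h1; exists v3; split; last by lra.
by move=> z; rewrite /A3 (St_ueq _ _ (St_ueq _ _ e1)) (St_ueq _ _ e2) e3.
Qed.

Let K0 := 12 * (384 / th + 1 / 2 + th / 10) / th + 2.

(** The averaged [u] is a combination of the [G j] and of [(B + z) W]; the factor [z] is paid for by
    the [l ^+ 2] in front of [q W]. The 64 is [4 ^ 3], for three averages. *)
Let smoothed (h l m : R) (w u f f' : U) : 0 < h <= 1 ->
  16 + 16 * C + 120 * C / th <= `|l| -> `|m| <= 1 ->
  dsol N B J (- l) (- m) w u -> dsol N B J l m u f -> ueq f (Bm c f') ->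
  q (A3 h u) <= 20 * (K0 * (64 * sdot f' f')).
Proof.
move=> /andP[h0 h1] lL m1 sw su ef.
have hn : h != 0 by rewrite gt_eqF.
have [W [G [S [WG GS SS eu HW]]]] := helmholtz NN NB BB JJ NJ BJ hn sw su.
have h1' : `|h| <= 1 by rewrite ger0_norm // ltW.
have [F' [eF nF]] := A3_weight f' h1'.
have FF' : ueq (A3 h f) (Bm c F') by move=> z; rewrite (A3_ueq h ef) eF.
have est := morawetz_estimate J_anti JJ mw th0 C0 WG GS SS HW FF' m1 lL.
have K00 : 0 <= K0.
  exact: arith_K.
have est' : \sum_j q (G j) + l ^+ 2 * q W <= K0 * (64 * sdot f' f').
  by apply: le_trans est _; rewrite ler_wpM2l.
(* The factor is [2 * 4] for the three derivative terms and [2 * 10] for [B], [l] and [m J]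
   together. *)
suff : q (A3 h u) <= 20 * (\sum_j q (G j) + l ^+ 2 * q W).
  by move=> /le_trans; apply; rewrite ler_wpM2l.
rewrite (q_ueq eu).
have s1 : q (\sum_j act (N j) (G j)) <= 4 * \sum_j q (G j).
  rewrite !big_ord_recl !big_ord0 !addr0 /=.
  apply: le_trans (qD _ _) _; rewrite q_act; last exact: N_isom.
  have := qD (act (N (lift ord0 ord0)) (G (lift ord0 ord0)))
    (act (N (lift ord0 (lift ord0 ord0))) (G (lift ord0 (lift ord0 ord0)))).
  rewrite !q_act; try exact: N_isom; set y0 := q (G ord0); have := q0 (G ord0); rewrite -/y0; lra.
have l1 : 1 <= l ^+ 2.
  have l16 : 1 <= `|l|.
    exact: arith_ge1 lL.
  by rewrite -real_normK ?num_real // exprn_ege1.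
have s2 : q (act (B + l%:M + m *: J) W) <= 10 * (l ^+ 2 * q W).
  rewrite !mactDl mactZl -scalemx1 mactZl mact1.
  apply: le_trans (qD _ _) _; rewrite qZ q_act; last exact: J_isom.
  have := qD (act B W) (l *: W); rewrite qZ q_act; [move=> e|exact: B_isom].
  have m2 : m ^+ 2 * q W <= 1 * q W.
    by rewrite ler_wpM2r // -real_normK ?num_real // exprn_ile1.
  have l2 : 1 * q W <= l ^+ 2 * q W by rewrite ler_wpM2r.
  by have := q0 W; lra.
apply: le_trans (qD _ _) _.
have : 0 <= \sum_j q (G j) by apply: sumr_ge0 => j _.
lra.
Qed.

(** The bound on [A3 h u] does not depend on [h], and [A3_lip] makes [A3 h u - u] small because [u]
    is differentiable. The constant is [2 * 20 * 64]. *)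
Lemma resolvent_estimate (l m : R) (w u f f' : U) :
  16 + 16 * C + 120 * C / th <= `|l| -> `|m| <= 1 ->
  dsol N B J (- l) (- m) w u -> dsol N B J l m u f -> ueq f (Bm c f') ->
  sdot u (Bm b u) <= 2560 * K0 * sdot f' f'.
Proof.
move=> lL m1 sw su ef; have /dsolE[g [ug _]] := su.
have [Cu HCu] := A3_lip ug.
apply/ler_addgt0Pr => e e0.
pose k : R := `|Cu| + 1; have k0 : 0 < k by rewrite /k ltr_wpDl.
pose h := Num.min 1 (e / (2 * k)).
have h0 : 0 < h by rewrite lt_min ltr01 divr_gt0 // mulr_gt0.
have h1 : h <= 1 by rewrite ge_min lexx.
have hk : 2 * (k * h) <= e.
  rewrite mulrA mulrC -ler_pdivlMr ?mulr_gt0 //.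
  by rewrite ge_min lexx orbT.
have h01 : 0 < h <= 1 by rewrite h0 h1.
have S := smoothed h01 lL m1 sw su ef.
have -> : sdot u (Bm b u) = q (A3 h u + (-1) *: (A3 h u - u)).
  by rewrite /q scaleN1r opprB addrC subrK.
apply: le_trans (qD _ _) _; rewrite qZ sqrrN expr1n mul1r.
have D : q (A3 h u - u) <= k * h.
  apply: le_trans (q_le _) _; apply: le_trans (HCu h) _.
  apply: (@le_trans _ _ (k * h ^+ 2)).
    by rewrite ler_wpM2r ?sqr_ge0 // /k; have := ler_norm Cu; lra.
  by rewrite ler_wpM2l ?(ltW k0) // expr2 ler_piMl // ltW.
have -> : 2560 * K0 * sdot f' f' = 2 * (20 * (K0 * (64 * sdot f' f'))) by ring.
lra.
Qed.
End uniform_estimate.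

(** * Polynomial weights *)

Section weights.
Context {R : realType}.
Implicit Types (x v : R * R * R) (al be : R) (j k : 'I_3).

Definition qq x : R := 1 + \sum_i co i x ^+ 2.
(* [<x>^(2 al)] *)
Definition wt al x : R := expR (al * ln (qq x)).

Lemma qq_ge1 x : 1 <= qq x.
Proof. by rewrite /qq lerDl; apply: sumr_ge0 => i _; exact: sqr_ge0. Qed.
Lemma qq_gt0 x : 0 < qq x.
Proof. exact: lt_le_trans (qq_ge1 x). Qed.
Lemma wt_gt0 al x : 0 < wt al x. Proof. exact: expR_gt0. Qed.
Lemma wtM al be x : wt al x * wt be x = wt (al + be) x.
Proof. by rewrite /wt -expRD -mulrDl. Qed.
Lemma wt1 x : wt 1 x = qq x.
Proof. by rewrite /wt mul1r lnK // posrE qq_gt0. Qed.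
Lemma wt0 x : wt 0 x = 1.
Proof. by rewrite /wt mul0r expR0. Qed.
Lemma wt_le al be x : al <= be -> wt al x <= wt be x.
Proof. by move=> ab; rewrite /wt ler_expR ler_wpM2r // ln_ge0 // qq_ge1. Qed.
(** A coordinate is at most [wt 2^-1], so it costs [2^-1] in the exponent. *)
Lemma co_wt k al be x : al + 2^-1 <= be -> `|co k x * wt al x| <= wt be x.
Proof.
move=> ab; apply: le_trans (wt_le _ ab).
rewrite normrM (ger0_norm (ltW (wt_gt0 _ _))) addrC -wtM ler_wpM2r ?(ltW (wt_gt0 _ _)) //.
rewrite -(@ler_pXn2r _ 2) ?nnegrE ?(ltW (wt_gt0 _ _)) // real_normK ?num_real //.
rewrite (expr2 (wt _ _)) wtM.
have -> : 2^-1 + 2^-1 = 1 :> R by field.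
rewrite wt1 /qq (bigD1 k) //= addrCA lerDl addr_ge0 // sumr_ge0 // => i _; exact: sqr_ge0.
Qed.

Lemma co_wt1 k al x : al <= - 2^-1 -> `|co k x * wt al x| <= 1.
Proof. by move=> h; have := @co_wt k al 0 x; rewrite wt0; apply; rewrite -lerBrDr sub0r. Qed.

Lemma wt_le1 al x : al <= 0 -> wt al x <= 1.
Proof. by move=> h; rewrite -(wt0 x); exact: wt_le. Qed.

Lemma continuous_qq : continuous qq.
Proof.
have -> : qq = (fun x => 1 + (co ord0 x ^+ 2 + (co (lift ord0 ord0) x ^+ 2 +
    co (lift ord0 (lift ord0 ord0)) x ^+ 2))).
  by apply/funext => x; rewrite /qq !big_ord_recl big_ord0 addr0.
have C k : continuous (fun x => co k x ^+ 2).
  have -> : (fun x => co k x ^+ 2) = (fun x : R * R * R => co k x * co k x) by apply/funext => x; rewrite expr2.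
  by move=> x; apply: cvgM; exact: continuous_co.
move=> x; apply: cvgD; first exact: cvg_cst.
by apply: cvgD; [exact: C|apply: cvgD; exact: C].
Qed.

Lemma continuous_wt al : continuous (wt al).
Proof.
move=> x; apply: (@continuous_comp _ _ _ (fun x => al * ln (qq x)) expR); last exact: continuous_expR.
have H : {for x, continuous (fun x => ln (qq x))}.
  apply: (@continuous_comp _ _ _ qq (@ln R)); first exact: continuous_qq.
  exact: continuous_ln (qq_gt0 x).
by apply: cvgMr; exact: H.
Qed.

Lemma measurable_wt al : measurable_fun setT (wt al : E3 R -> R).
Proof.
apply: (@measurableT_comp _ _ _ _ _ _ expR) => //.
apply: measurable_funM => //; apply: (@measurableT_comp _ _ _ _ _ _ (@ln R)) => //.
apply: measurable_funD => //; apply: measurable_sum => i; apply: measurable_funX.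
exact: measurable_co.
Qed.

Lemma is_derive_comp (f : R * R * R -> R) (g : R -> R) x v f' g' :
  is_derive x v f f' -> is_derive (f x) 1 g g' -> is_derive x v (fun y => g (f y)) (g' * f').
Proof.
move=> df dg; rewrite -[x]add0r -(scale0r v); apply/is_derive_line.
apply: (@is_derive1_comp _ g (fun h => f (h *: v + x))).
  by rewrite scale0r add0r.
by apply/is_derive_line; rewrite scale0r add0r.
Qed.

Lemma is_derive_co k x j : is_derive x (unit_vec j) (co k) ((j == k)%:R : R).
Proof.
have := @is_derive_affine R id 1 0 1 k x (unit_vec j) (is_derive_id _ _).
rewrite co_unit !mul1r eq_sym; congr (is_derive _ _ _ _).
by apply/funext => y; rewrite add0r mul1r.
Qed.

Lemma is_derive_qq x j : is_derive x (unit_vec j) qq (2 * co j x).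
Proof.
pose h (i : 'I_3) (y : R * R * R) : R := co i y * co i y.
have D i : is_derive x (unit_vec j) (h i) (co i x *: (j == i)%:R + co i x *: (j == i)%:R).
  exact: (is_deriveM (is_derive_co i x j) (is_derive_co i x j)).
have S := is_derive_sum D.
have := is_deriveD (is_derive_cst (1 : R) x (unit_vec j)) S.
have -> : cst (1 : R) + \sum_(i < 3) h i = qq.
  by apply/funext => y; rewrite /qq fctE /= fct_sumE; congr (_ + _); apply: eq_bigr => i _; rewrite expr2.
move=> H; apply: is_derive_eq.
rewrite add0r (bigD1 j) //= eqxx big1 => [|i ij].
  by rewrite addr0 /GRing.scale /=; ring.
by rewrite eq_sym (negbTE ij) scaler0 addr0.
Qed.

Lemma is_derive_wt al x j : is_derive x (unit_vec j) (wt al) (2 * al * (co j x * wt (al - 1) x)).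
Proof.
have L : is_derive (qq x) 1 (fun t => expR (al * ln t)) (expR (al * ln (qq x)) * (al * (qq x)^-1)).
  apply: (@is_derive1_comp _ expR (fun t => al * ln t)).
  have := is_derive1_ln (qq_gt0 x) => H.
  rewrite (_ : (fun t : R => al * ln t) = al *: (@ln R)) //.
  exact: (is_deriveZ al H).
apply: (is_derive_eq (is_derive_comp (is_derive_qq x j) L)).
rewrite -/(wt al x).
have -> : wt al x = wt (al - 1) x * qq x by rewrite -wt1 wtM subrK.
by field; rewrite gt_eqF // qq_gt0.
Qed.

Lemma bm_wt al : al <= 0 -> bm (wt al : E3 R -> R).
Proof.
move=> al0; split; first exact: measurable_wt.
by exists 1 => x; rewrite ger0_norm ?(ltW (wt_gt0 _ _)) // -(wt0 x) wt_le.
Qed.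

Lemma bm_co_wt k al : al <= - 2^-1 -> bm ((fun x => co k x * wt al x) : E3 R -> R).
Proof.
move=> al0; split; first by apply: measurable_funM; [exact: measurable_co|exact: measurable_wt].
by exists 1 => x; exact: co_wt1.
Qed.

Lemma bm_co2_wt j k al : al <= - 1 -> bm ((fun x => co j x * (co k x * wt al x)) : E3 R -> R).
Proof.
move=> al0; split.
  apply: measurable_funM; first exact: measurable_co.
  by apply: measurable_funM; [exact: measurable_co|exact: measurable_wt].
exists 1 => x; have -> : co j x * (co k x * wt al x) = co j x * wt (- 2^-1) x * (co k x * wt (al + 2^-1) x).
  by rewrite mulrACA wtM (addrC (- _)) addrK mulrA.
by rewrite normrM mulr_ile1 // co_wt1 // -lerBrDr (le_trans al0) //; lra.
Qed.

Lemma C1bD j (f f' g g' : E3 R -> R) : C1b j f f' -> C1b j g g' ->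
  C1b j (fun x => f x + g x) (fun x => f' x + g' x).
Proof.
move=> [[bf bf'] df cf cf'] [[bg bg'] dg cg cg']; split.
- by split; exact: bmD.
- by move=> x; exact: (is_deriveD (df x) (dg x)).
- by move=> x; apply: cvgD; [exact: cf|exact: cg].
- by move=> x; apply: cvgD; [exact: cf'|exact: cg'].
Qed.

Lemma C1bZ j (c : R) (f f' : E3 R -> R) : C1b j f f' ->
  C1b j (fun x => c * f x) (fun x => c * f' x).
Proof.
move=> [[bf bf'] df cf cf']; split.
- by split; (apply: bmM => //; exact: bm_cst).
- by move=> x; exact: (is_deriveZ c (df x)).
- by move=> x; apply: cvgMr; exact: cf.
- by move=> x; apply: cvgMr; exact: cf'.
Qed.

Lemma C1b_wt al j : al <= 0 -> C1b j (wt al) (fun x => 2 * al * (co j x * wt (al - 1) x)).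
Proof.
move=> al0; split.
- split; first exact: bm_wt.
  by apply: bmM; [exact: bm_cst|apply: bm_co_wt; lra].
- by move=> x; exact: is_derive_wt.
- exact: continuous_wt.
- move=> x; apply: cvgMr; apply: cvgM; first exact: continuous_co.
  exact: continuous_wt.
Qed.

Lemma C1b_co_wt al j k : al <= - 2^-1 -> C1b j (fun x => co k x * wt al x)
  (fun x => (j == k)%:R * wt al x + 2 * al * (co j x * (co k x * wt (al - 1) x))).
Proof.
move=> al0; split.
- split; first exact: bm_co_wt.
  apply: bmD; first by apply: bmM; [exact: bm_cst|apply: bm_wt; lra].
  by apply: bmM; [exact: bm_cst|apply: bm_co2_wt; lra].
- move=> x; apply: (is_derive_eq (is_deriveM (is_derive_co k x j) (is_derive_wt al x j))).
  by rewrite /GRing.scale /=; ring.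
- by move=> x; apply: cvgM; [exact: continuous_co|exact: continuous_wt].
- move=> x; apply: cvgD; first by apply: cvgMr; exact: continuous_wt.
  apply: cvgMr; apply: cvgM; first exact: continuous_co.
  by apply: cvgM; [exact: continuous_co|exact: continuous_wt].
Qed.
End weights.

(** * The weights of the multiplier *)

Section morawetz_instance.
Context {R : realType}.
Variable s : R.
Hypothesis s12 : 2^-1 < s < 1.
Implicit Types (x : E3 R) (j k : 'I_3).

Let ma k x : R := co k x * wt (- 2^-1) x + (- 2^-1) * (co k x * wt (- s) x).
Let ma' j k x : R :=
  ((j == k)%:R * wt (- 2^-1) x + 2 * - 2^-1 * (co j x * (co k x * wt (- 2^-1 - 1) x))) +
  (- 2^-1) * ((j == k)%:R * wt (- s) x + 2 * - s * (co j x * (co k x * wt (- s - 1) x))).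
Let md x : R := 2 * wt (- 2^-1) x + (wt (- 2^-1 - 1) x +
  ((s - 3 / 2) * wt (- s) x + (- s) * wt (- s - 1) x)).
Let md' j x : R :=
  2 * (2 * - 2^-1 * (co j x * wt (- 2^-1 - 1) x)) +
  (2 * (- 2^-1 - 1) * (co j x * wt (- 2^-1 - 1 - 1) x) +
   ((s - 3 / 2) * (2 * - s * (co j x * wt (- s - 1) x)) +
    (- s) * (2 * (- s - 1) * (co j x * wt (- s - 1 - 1) x)))).
Let mb' j x : R := 2 * - s * (co j x * wt (- s - 1) x).

(** Right minus left is twice the product in [h]. It is used with [Y = |y|^2] and
    [T = (x.y)^2 / <x>^2]; [ws <= w12] reflects [s > 1/2], and the factor [1 - s] needs [s < 1]. *)
Let psd_scalar (w12 ws Y T : R) : ws <= w12 -> 0 <= ws -> 0 <= T -> T <= Y ->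
  (2 * s - 1) * ws * Y <= 2 * ((w12 - ws / 2) * Y + (- (w12 * T) + s * (ws * T))).
Proof.
move: s12 => /andP[s0 s1] ww ws0 T0 TY.
have h : 0 <= (Y - T) * ((w12 - ws) + (1 - s) * ws).
  rewrite mulr_ge0 ?subr_ge0 // addr_ge0 ?subr_ge0 // mulr_ge0 // subr_ge0.
  exact: ltW.
nra.
Qed.

Let cauchy3 (x0 x1 x2 y0 y1 y2 : R) : (x0 * y0 + (x1 * y1 + x2 * y2)) ^+ 2 <=
  (x0 ^+ 2 + (x1 ^+ 2 + x2 ^+ 2)) * (y0 ^+ 2 + (y1 ^+ 2 + y2 ^+ 2)).
Proof.
rewrite -subr_ge0.
have -> : (x0 ^+ 2 + (x1 ^+ 2 + x2 ^+ 2)) * (y0 ^+ 2 + (y1 ^+ 2 + y2 ^+ 2)) -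
  (x0 * y0 + (x1 * y1 + x2 * y2)) ^+ 2 =
  (x0 * y1 - x1 * y0) ^+ 2 + (x0 * y2 - x2 * y0) ^+ 2 + (x1 * y2 - x2 * y1) ^+ 2 by ring.
by rewrite !addr_ge0 // sqr_ge0.
Qed.

Lemma weights_1 x : [/\ wt (- 2^-1) x <= 1, wt (- s) x <= wt (- 2^-1) x, wt (- 2^-1 - 1) x <= 1,
  wt (- s - 1) x <= 1 & wt (- s) x <= 1].
Proof.
move: s12 => /andP[s0 s1].
by split; [apply: wt_le1|apply: wt_le|apply: wt_le1|apply: wt_le1|apply: wt_le1]; lra.
Qed.

(** The 16 is a crude common bound: a derivative of [d] is a sum of four terms, each at most
    [4 * wt (- s)]. The [2 * s - 1] is what the subtracted part of the field gains in the radial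
    direction. *)
Lemma morawetz_weights_ex : exists a a' d d' b',
  morawetz_weights (2 * s - 1) 16 a a' d d' (wt (- s)) b' (wt (- (s / 2)) : E3 R -> R).
Proof.
have /andP[s0 s1] := s12.
exists ma, ma', md, md', mb'; split.
- move=> j k; apply: C1bD; first exact: C1b_co_wt.
  by apply: C1bZ; apply: C1b_co_wt; rewrite lerN2 ltW.
- move=> j; apply: C1bD; first by apply: C1bZ; apply: C1b_wt; lra.
  apply: C1bD; first by apply: C1b_wt; lra.
  by apply: C1bD; apply: C1bZ; apply: C1b_wt; lra.
- by move=> j; apply: C1b_wt; lra.
- by apply: bm_wt; lra.
- move=> x; rewrite /md /ma' !big_ord_recl big_ord0 /= addr0.
  have e1 : wt (- 2^-1) x = qq x * wt (- 2^-1 - 1) x by rewrite -wt1 wtM addrC subrK.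
  have e2 : wt (- s) x = qq x * wt (- s - 1) x by rewrite -wt1 wtM addrC subrK.
  rewrite e1 e2 /qq !big_ord_recl big_ord0 /= addr0.
  by field.
- move=> k x; have [h1 h2 _ _ _] := weights_1 x.
  have e : wt (- s) x = wt (- 2^-1) x * wt (- s + 2^-1) x by rewrite wtM (addrC (- s)) addKr.
  have -> : ma k x = co k x * wt (- 2^-1) x * (1 - wt (- s + 2^-1) x / 2).
    by rewrite /ma e; field.
  rewrite normrM mulr_ile1 ?co_wt1 //.
  have p := wt_gt0 (- s + 2^-1) x; have p1 : wt (- s + 2^-1) x <= 1 by apply: wt_le1; lra.
  by rewrite ler_norml; apply/andP; split; lra.
- move=> x; have [h1 h2 h3 h4 h5] := weights_1 x.
  have p1 := wt_gt0 (- 2^-1) x; have p2 := wt_gt0 (- 2^-1 - 1) x.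
  have p3 := wt_gt0 (- s) x; have p4 := wt_gt0 (- s - 1) x.
  by rewrite /md ler_norml; apply/andP; split; nra.
- move=> j x; rewrite /md'.
  have kt (k t : R) : `|k| <= 4 -> `|t| <= wt (- s) x -> `|k * t| <= 4 * wt (- s) x.
    by move=> h1 h2; rewrite normrM ler_pM.
  have t1 : `|co j x * wt (- 2^-1 - 1) x| <= wt (- s) x by apply: co_wt; lra.
  have t2 : `|co j x * wt (- 2^-1 - 1 - 1) x| <= wt (- s) x by apply: co_wt; lra.
  have t3 : `|co j x * wt (- s - 1) x| <= wt (- s) x by apply: co_wt; lra.
  have t4 : `|co j x * wt (- s - 1 - 1) x| <= wt (- s) x by apply: co_wt; lra.
  have k1 : `|2 * (2 * - 2^-1)| <= 4 :> R by rewrite ler_norml; apply/andP; split; lra.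
  have k2 : `|2 * (- 2^-1 - 1)| <= 4 :> R by rewrite ler_norml; apply/andP; split; lra.
  have k3 : `|(s - 3 / 2) * (2 * - s)| <= 4 by rewrite ler_norml; apply/andP; split; nra.
  have k4 : `|- s * (2 * (- s - 1))| <= 4 by rewrite ler_norml; apply/andP; split; nra.
  have := kt _ _ k1 t1; have := kt _ _ k2 t2; have := kt _ _ k3 t3; have := kt _ _ k4 t4.
  rewrite !ler_norml => /andP[? ?] /andP[? ?] /andP[? ?] /andP[? ?].
  by apply/andP; split; lra.
- move=> j x; rewrite /mb'.
  have : `|co j x * wt (- s - 1) x| <= wt (- s) x by apply: co_wt; lra.
  rewrite !ler_norml => /andP[h1 h2]; have := wt_gt0 (- s) x.
  by move=> h3; apply/andP; split; nra.
- by move=> x; rewrite wtM; rewrite -opprD -splitr.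
- by move=> x; have [_ _ _ _ h] := weights_1 x; rewrite h ltW // wt_gt0.
- move=> x y.
  set Y := \sum_j y j ^+ 2; pose p := \sum_j co j x * y j.
  have -> : \sum_j \sum_k ma' j k x * y j * y k =
    (wt (- 2^-1) x - wt (- s) x / 2) * Y +
    (- wt (- 2^-1 - 1) x + s * wt (- s - 1) x) * p ^+ 2.
    by rewrite /Y /p /ma' !big_ord_recl !big_ord0 /=; field.
  have e1 : wt (- 2^-1) x = qq x * wt (- 2^-1 - 1) x by rewrite -wt1 wtM addrC subrK.
  have e2 : wt (- s) x = qq x * wt (- s - 1) x by rewrite -wt1 wtM addrC subrK.
  pose T := (qq x)^-1 * p ^+ 2; have q0 := qq_gt0 x.
  have qT : p ^+ 2 = qq x * T by rewrite /T mulrA divff ?mul1r // gt_eqF.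
  have -> : (- wt (- 2^-1 - 1) x + s * wt (- s - 1) x) * p ^+ 2 =
    - (wt (- 2^-1) x * T) + s * (wt (- s) x * T) by rewrite qT e1 e2; ring.
  have [_ h2 _ _ _] := weights_1 x.
  have Y0 : 0 <= Y by apply: sumr_ge0 => j _; exact: sqr_ge0.
  apply: psd_scalar => //; first exact: ltW (wt_gt0 _ _).
    by rewrite mulr_ge0 ?sqr_ge0 // invr_ge0 ltW.
  rewrite /T ler_pdivrMl //; apply: (@le_trans _ _ ((qq x - 1) * Y)); last first.
    by rewrite ler_wpM2r // gerBl.
  rewrite /qq addrAC subrr add0r /p /Y !big_ord_recl !big_ord0 !addr0.
  exact: cauchy3.
Qed.
End morawetz_instance.

(** * Averages in weighted spaces *)

Section weighted_averages.
Context {R : realType}.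
Local Notation V := (L2 (@leb3 R)).
Variable s : R.
Hypothesis s01 : 0 <= s <= 1.
Implicit Types (x v : R * R * R).

(** A shift of length at most 1 multiplies [qq] by at most 4, and [4 ^ s <= 4] because [s <= 1]. *)
Lemma wt_shift x v : \sum_i co i v ^+ 2 <= 1 -> wt s (x + v) <= 4 * wt s x.
Proof.
move=> v1; have /andP[s0 s1] := s01.
have q4 : qq (x + v) <= 4 * qq x.
  have : \sum_i co i (x + v) ^+ 2 <= \sum_i (2 * co i x ^+ 2 + 2 * co i v ^+ 2).
    by apply: ler_sum => i _; rewrite coD; have := sqr_ge0 (co i x - co i v); lra.
  rewrite big_split -!mulr_sumr /= /qq; have : 0 <= \sum_i co i x ^+ 2.
    by apply: sumr_ge0 => i _; exact: sqr_ge0.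
  by lra.
have l4 : ln (qq (x + v)) <= ln 4 + ln (qq x).
  by rewrite -lnM ?posrE ?qq_gt0 // ler_ln ?posrE ?mulr_gt0 ?qq_gt0.
rewrite /wt; apply: (@le_trans _ _ (expR (s * ln 4 + s * ln (qq x)))).
  by rewrite ler_expR -mulrDr ler_wpM2l.
rewrite expRD ler_wpM2r ?expR_ge0 // -[leRHS]lnK ?posrE // ler_expR ler_piMl //.
by rewrite ln_ge0 // ler1n.
Qed.

Let c : E3 R -> R := wt (- (s / 2)).
Let bc : bm c. Proof. by apply: bm_wt; have /andP[] := s01; lra. Qed.

(** The witness is [wt (s / 2)] times the average; [stek_weight] moves the shift onto the weight,
    where [wt_shift] applies. *)
Lemma st_weight j (h : R) (v : V) : `|h| <= 1 -> exists v' : V,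
  st j h (bmul c v) = bmul c v' /\ nrm2 v' <= 4 * nrm2 v.
Proof.
move=> h1; set u := st j h (bmul c v).
pose g : E3 R -> R := fun x => wt (s / 2) x * u x.
have mg : measurable_fun setT g.
  by apply: measurable_funM; [exact: measurable_wt|exact: L2_measurable].
have I : (\int[leb3]_x ((g x) ^+ 2)%:E <= (4 * nrm2 v)%:E)%E.
  have e x : g x ^+ 2 = wt s x * u x ^+ 2.
    by rewrite /g exprMn; congr (_ * _); rewrite expr2 wtM -splitr.
  under eq_integral do rewrite e.
  have := @stek_weight _ _ _ (@leb3 R) _ e3shift _ _ _ _ _ (h *: unit_vec j) (bmul c v) (wt s).
  move=> H; apply: le_trans (H _ _ _ _ _ _ _) _; try e3flow.
  - exact: measurable_wt.
  - by move=> x; exact: ltW (wt_gt0 _ _).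
  set w := h *: unit_vec j.
  pose k (p : E3 R * measurableTypeR R) : \bar R :=
    (wt s (e3shift (- ((p.2 : R) *: w)) p.1) * (bmul c v p.1) ^+ 2)%:E.
  have mk : measurable_fun setT k.
    apply/measurable_EFinP; apply: measurable_funM.
      apply: (@measurableT_comp _ _ _ _ _ _ (wt s : E3 R -> R)); first exact: measurable_wt.
      have -> : (fun p : E3 R * measurableTypeR R => e3shift (- ((p.2 : R) *: w)) p.1) =
          (fun p => p.1 + (p.2 : R) *: (- w)).
        by apply/funext => p; rewrite /e3shift scalerN.
      exact: measurable_line.
    apply: measurable_funX; apply: (@measurableT_comp _ _ _ _ _ _ (bmul c v)) => //.
    exact: L2_measurable.
  have k0 p : (0 <= k p)%E by rewrite lee_fin mulr_ge0 ?sqr_ge0 // ltW // wt_gt0.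
  rewrite -(I01_cst (4 * nrm2 v)); apply: ae_ge0_le_integral => //.
  - by move=> t _; apply: integral_ge0 => x _; exact: (k0 (x, t)).
  - exact: (@measurable_fun_fubini_tonelli_G _ _ _ _ _ (@leb3 R) k).
  - by move=> t _; rewrite lee_fin mulr_ge0 // nrm2_ge0.
  case: (@I01_ae R) => A [mA A0 HA]; exists A; split => // t /= Ht; apply: HA => /= t01; apply: Ht => _.
  rewrite EFinM nrm2E -ge0_integralZl //; last 2 first.
  - by apply/measurable_EFinP; apply: measurable_funX; exact: L2_measurable.
  - by move=> x _; rewrite lee_fin sqr_ge0.
  apply: ge0_le_integral => //.
  - by move=> x _; exact: (k0 (x, t)).
  - exact: (measurableT_comp mk (pair2_measurable _)).
  - apply: measurable_funeM; apply/measurable_EFinP; apply: measurable_funX.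
    exact: L2_measurable.
  - move=> x _; rewrite -EFinM lee_fin bmulE //.
    have -> : 4 * v x ^+ 2 = 4 * wt s x * (c x * v x) ^+ 2.
      have e2 : c x ^+ 2 = wt (- s) x by rewrite /c expr2 wtM -opprD -splitr.
      have e3 : wt s x * wt (- s) x = 1 by rewrite wtM subrr wt0.
      rewrite exprMn e2; transitivity (4 * (wt s x * wt (- s) x) * v x ^+ 2); last by ring.
      by rewrite e3 mulr1.
    rewrite ler_wpM2r ?sqr_ge0 //; apply: wt_shift.
    rewrite (eq_bigr (fun i => (t * h) ^+ 2 * (i == j)%:R)); last first.
      by move=> i _; rewrite -scaleN1r coZ /w !coZ co_unit; case: (i == j) => /=; ring.
    rewrite -mulr_sumr (bigD1 j) //= eqxx big1 ?addr0 ?mulr1; last by move=> i /negbTE ->.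
    rewrite -real_normK ?num_real // exprn_ile1 // normrM mulr_ile1 //.
    by have /andP[t0 t1] := t01; rewrite ger0_norm.
have gi : g \in sqint leb3.
  by apply/sqintP; split => //; exact: le_lt_trans I (ltry _).
exists (MkL2 gi); split; last by rewrite -lee_fin nrm2E.
apply: L2_eqP => x; rewrite bmulE //= /g mulrA wtM.
by rewrite addNr wt0 mul1r.
Qed.

End weighted_averages.

(** * Approximation in weighted spaces *)

Section truncation.
Context {R : realType}.
Local Notation V := (L2 (@leb3 R)).

Definition trunc (k : nat) : E3 R -> R := fun x => (qq x <= k%:R :> R)%:R.

Lemma measurable_qq : measurable_fun setT (qq : E3 R -> R).
Proof.
by rewrite (_ : qq = wt 1); [exact: measurable_wt|apply/funext => x; rewrite wt1].
Qed.

Lemma measurable_trunc k : measurable_fun setT (trunc k).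
Proof.
rewrite (_ : trunc k = \1_[set x | qq x <= k%:R]); last first.
  by apply/funext => x; rewrite indicE mem_setE.
apply: measurable_indic; rewrite -[X in measurable X]setTI.
rewrite (_ : [set x | _] = (qq : E3 R -> R) @^-1` `]-oo, k%:R]%classic); last first.
  by apply/seteqP; split => x /=; rewrite in_itv.
exact: measurable_qq.
Qed.

Lemma trunc01 k x : trunc k x = 0 \/ trunc k x = 1.
Proof. by rewrite /trunc; case: (_ <= _); [right|left]. Qed.

Lemma trunc_ge0 k x : 0 <= trunc k x.
Proof. by case: (trunc01 k x) => ->. Qed.

Lemma bm_trunc k : bm (trunc k).
Proof.
split; first exact: measurable_trunc.
by exists 1 => x; case: (trunc01 k x) => ->; rewrite ?normr0 ?normr1.
Qed.

Lemma integral_trunc_le (F : E3 R -> R) (A : R) : measurable_fun setT F -> (forall x, 0 <= F x) ->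
  (forall k, \int[leb3]_x (trunc k x * F x)%:E <= A%:E)%E -> (\int[leb3]_x (F x)%:E <= A%:E)%E.
Proof.
move=> mF F0 H.
have L x : (fun k => (trunc k x * F x)%:E) @ \oo --> (F x)%:E.
  apply: cvg_near_cst; near=> k; rewrite /trunc.
  rewrite (_ : qq x <= k%:R) ?mul1r //; near: k.
  exact: nbhs_infty_ger.
have C := @cvg_monotone_convergence _ (E3 R) R (@leb3 R) setT measurableT
  (fun k x => (trunc k x * F x)%:E).
have {}C : (\int[leb3]_x (trunc k x * F x)%:E)%E @[k --> \oo] --> (\int[leb3]_x (F x)%:E)%E.
  have -> : (\int[leb3]_x (F x)%:E)%E = (\int[leb3]_x limn (fun k => (trunc k x * F x)%:E))%E.
    by apply: eq_integral => x _; apply/esym/cvg_lim => //; exact: L.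
  apply: C.
  - move=> k; apply/measurable_EFinP; apply: measurable_funM => //; exact: measurable_trunc.
  - by move=> k x _; rewrite lee_fin mulr_ge0 // /trunc ler0n.
  - move=> x _ k m km; rewrite lee_fin ler_wpM2r // /trunc ler_nat.
    by have [h|//] := boolP (qq x <= k%:R); rewrite (le_trans h) // ler_nat.
rewrite -(cvg_lim _ C) //; apply: lime_le; first by apply/cvg_ex; eexists; exact: C.
exact: nearW.
Unshelve. all: by end_near. Qed.

(** Truncation is an orthogonal projection, so the squared error is [nrm2 v - nrm2 u]. If it always
    exceeded [e], monotone convergence would give [nrm2 v <= nrm2 v - e]. *)
Lemma bmul_trunc_small (v : V) (e : R) : 0 < e -> exists k, nrm2 (v - bmul (trunc k) v) <= e.
Proof.
move=> e0; apply: contrapT => /forallNP H.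
suff : ((nrm2 v)%:E <= (nrm2 v - e)%:E)%E by rewrite lee_fin lerBrDr gerDl leNgt e0.
rewrite nrm2E; apply: integral_trunc_le => [|x|k].
- by apply: measurable_funX; exact: L2_measurable.
- exact: sqr_ge0.
have -> : (\int[leb3]_x (trunc k x * v x ^+ 2)%:E = (nrm2 (bmul (trunc k) v))%:E)%E.
  rewrite nrm2E; apply: eq_integral => x _; rewrite bmulE; last exact: bm_trunc.
  by case: (trunc01 k x) => ->; rewrite ?mul0r ?expr0n ?mul1r.
rewrite lee_fin; have /negP := H k; rewrite -ltNge => /ltW.
set u := bmul _ _; have -> : nrm2 (v - u) = nrm2 v - nrm2 u; last by lra.
have uv : ip u v = nrm2 u.
  rewrite /nrm2 /u ip_bmul //; last exact: bm_trunc.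
  rewrite [RHS]ip_bmul //; last exact: bm_trunc.
  congr (ip v _); apply: L2_eqP => x; rewrite !bmulE; try exact: bm_trunc.
  by case: (trunc01 k x) => ->; rewrite ?mul0r ?mul1r.
rewrite {1}/nrm2 !(ipDl, ipDr, ipNl, ipNr) (ipC v u) uv -/(nrm2 v) -/(nrm2 u); ring.
Qed.
End truncation.

Section bounded_weight.
Context {R : realType}.
Local Notation V := (L2 (@leb3 R)).
Variable e : R.
Hypothesis e0 : 0 < e.
Implicit Types (x : R * R * R).

(* A bounded approximation of the weight [<x>], with gradient at most 1 *)
Definition om x : R := wt 2^-1 x / (1 + e * wt 2^-1 x).
Definition om' (j : 'I_3) x : R := co j x * wt (- 2^-1) x * ((1 + e * wt 2^-1 x)^-1) ^+ 2.

Let d1 x : 1 <= 1 + e * wt 2^-1 x.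
Proof. by rewrite lerDl mulr_ge0 ?ltW // wt_gt0. Qed.
Let d0 x : 0 < 1 + e * wt 2^-1 x. Proof. exact: lt_le_trans (d1 x). Qed.
Let i01 x : 0 <= (1 + e * wt 2^-1 x)^-1 <= 1.
Proof. by rewrite invr_ge0 ltW //= invf_le1. Qed.

Lemma om_ge0 x : 0 <= om x.
Proof. by rewrite /om divr_ge0 // ltW // wt_gt0. Qed.

Lemma om_le x : om x <= wt 2^-1 x.
Proof. by rewrite /om ler_piMr ?(ltW (wt_gt0 _ _)) //; have /andP[] := i01 x. Qed.

Lemma om'_le j x : `|om' j x| <= 1.
Proof.
have /andP[h1 h2] := i01 x.
by rewrite /om' normrM mulr_ile1 ?co_wt1 // ger0_norm ?exprn_ge0 // exprn_ile1.
Qed.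

Lemma continuous_den : continuous (fun x => (1 + e * wt 2^-1 x)^-1).
Proof.
move=> x; apply: cvgV; first by rewrite gt_eqF.
by apply: cvgD; [exact: cvg_cst|apply: cvgMr; exact: continuous_wt].
Qed.

Lemma C1b_om j : C1b j om (om' j).
Proof.
have mi : measurable_fun setT ((fun x => (1 + e * wt 2^-1 x)^-1) : E3 R -> R).
  rewrite (_ : (fun x => _) = (fun x => (1 + e * wt 2^-1 x) `^ (-1))); last first.
    by apply/funext => x; rewrite powR_inv1 // ltW.
  apply: (@measurableT_comp _ _ _ _ _ _ (fun t : R => t `^ (-1))).
    exact: measurable_powR.
  by apply: measurable_funD => //; apply: measurable_funM => //; exact: measurable_wt.
split.
- split; split.
  + by apply: measurable_funM => //; exact: measurable_wt.
  + exists e^-1 => x; rewrite ger0_norm ?om_ge0 // /om ler_pdivrMr // mulrDr mulr1 mulKf ?gt_eqF //.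
    by rewrite lerDr invr_ge0 ltW.
  + apply: measurable_funM; last exact: measurable_funX.
    by apply: measurable_funM; [exact: measurable_co|exact: measurable_wt].
  + by exists 1 => x; exact: om'_le.
- move=> x; pose g (t : R) := t * (1 + e * t)^-1.
  set r := wt 2^-1 x.
  have D : is_derive r 1 (fun t : R => 1 + e * t) e.
    have := is_deriveD (is_derive_cst (1 : R) r 1) (is_deriveZ e (is_derive_id r (1 : R))).
    by move=> H; apply: (is_derive_eq H); rewrite add0r /GRing.scale /= mulr1.
  have nz : 1 + e * r != 0 by rewrite gt_eqF // d0.
  have G : is_derive r 1 g ((1 + e * r)^-1 ^+ 2).
    have := is_deriveM (is_derive_id r (1 : R)) (@is_deriveV R (fun t : R => 1 + e * t) r e 1 nz D).
    move=> H; apply: (is_derive_eq H); rewrite /GRing.scale /= mulr1.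
    by field.
  have := is_derive_comp (is_derive_wt 2^-1 x j) G.
  move=> H; apply: (is_derive_eq H).
  have -> : 2^-1 - 1 = - 2^-1 :> R by field.
  by rewrite /om' -/r; field.
- by move=> x; apply: cvgM; [exact: continuous_wt|exact: continuous_den].
- move=> x; apply: cvgM.
    by apply: cvgM; [exact: continuous_co|exact: continuous_wt].
  have E : (fun x => (1 + e * wt 2^-1 x)^-1 ^+ 2) =
      (fun x => (1 + e * wt 2^-1 x)^-1 * (1 + e * wt 2^-1 x)^-1).
    by apply/funext => y; rewrite expr2.
  have C : continuous (fun x => (1 + e * wt 2^-1 x)^-1 ^+ 2).
    by rewrite E => y; apply: cvgM; exact: continuous_den.
  exact: C.
Qed.
End bounded_weight.

(** * Interpolation between L_2 and L_{2,1} *)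

Section weighted_representative.
Context {R : realType}.
Local Notation V := (L2 (@leb3 R)).
Variable s : R.
Hypothesis s01 : 0 < s < 1.
Local Notation c := (wt (- (s / 2)) : E3 R -> R).

(** Cut at [ln (qq x) = y]: below, the constant dominates; above, [qq ^ (s - 1)] is at most its
    value at the cut. As [s < 1], a large [y] makes the coefficient of [qq] as small as wanted. *)
Lemma wt_interpolate (y : R) (x : R * R * R) :
  wt s x <= expR (s * y) + expR ((s - 1) * y) * qq x.
Proof.
have /andP[s0 s1] := s01; have q0 := qq_gt0 x.
have [ty|yt] := leP (ln (qq x)) y.
  apply: (@le_trans _ _ (expR (s * y))); first by rewrite /wt ler_expR ler_wpM2l // ltW.
  by rewrite lerDl mulr_ge0 ?expR_ge0 // ltW.
apply: (@le_trans _ _ (expR ((s - 1) * y) * qq x)); last by rewrite lerDr expR_ge0.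
have -> : qq x = expR (ln (qq x)) by rewrite lnK.
rewrite -expRD /wt ler_expR.
have : 0 <= (1 - s) * (ln (qq x) - y) by rewrite mulr_ge0 // subr_ge0 ltW.
lra.
Qed.

(** Where [qq x <= k], also [<x> <= k], so for [e = 1 / (k + 1)] the denominator of [om e] is at
    most 2. *)
Lemma om_qq (k : nat) (x : R * R * R) : qq x <= k%:R -> qq x <= 4 * om (k.+1%:R^-1) x ^+ 2.
Proof.
move=> qk; set e : R := k.+1%:R^-1; set r := wt 2^-1 x.
have r0 : 0 < r by exact: wt_gt0.
have rr : r ^+ 2 = qq x.
  by rewrite /r expr2 wtM -[2^-1]mul1r -splitr wt1.
have rk : r <= k%:R.
  by apply: le_trans qk; rewrite -wt1; apply: wt_le; rewrite invf_le1 // ler1n.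
have er : 0 <= e * r <= 1.
  rewrite /e mulr_ge0 ?invr_ge0 ?(ltW r0) //= ler_pdivrMl ?ltr0n // mulr1.
  by apply: le_trans rk _; rewrite ler_nat.
have /andP[er0 er1] := er.
have h : r / 2 <= om e x.
  rewrite /om -/r ler_wpM2l ?(ltW r0) // lef_pV2 ?posrE //; lra.
have : (r / 2) ^+ 2 <= om e x ^+ 2.
  have r20 : 0 <= r / 2 by rewrite divr_ge0 // ltW.
  by rewrite lerXn2r // nnegrE (le_trans r20).
by rewrite exprMn rr; lra.
Qed.

(** A bound on [om e] times [d] uniform in [e] gives one on [<x> d], truncation by truncation.
    Interpolation then bounds [d] in weight [s], with smallness inherited from L_2. *)
Lemma wt_rep (d : V) (A y : R) : (forall e : R, 0 < e -> nrm2 (bmul (om e : E3 R -> R) d) <= A) ->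
  exists g : V, d = bmul c g /\ nrm2 g <= expR (s * y) * nrm2 d + expR ((s - 1) * y) * (4 * A).
Proof.
move=> H; have md := L2_measurable d.
have md2 : measurable_fun setT (fun x => d x ^+ 2) by exact: measurable_funX.
have Q : (\int[leb3]_x (qq x * d x ^+ 2)%:E <= (4 * A)%:E)%E.
  apply: integral_trunc_le => [|x|k].
  - by apply: measurable_funM => //; exact: measurable_qq.
  - by rewrite mulr_ge0 ?sqr_ge0 // ltW // qq_gt0.
  have e0 : 0 < (k.+1%:R : R)^-1 by rewrite invr_gt0 ltr0n.
  have [[bo _] _ _ _] := C1b_om e0 ord0.
  have mo : measurable_fun setT (fun x => om k.+1%:R^-1 x * d x).
    by apply: measurable_funM => //; case: bo.
  pose o : E3 R -> R := om k.+1%:R^-1.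
  apply: (@le_trans _ _ (4%:E * (nrm2 (bmul o d))%:E)%E); last first.
    by rewrite -EFinM lee_fin ler_wpM2l // H.
  rewrite nrm2E -ge0_integralZl //; last 2 first.
  - by apply/measurable_EFinP; apply: measurable_funX; exact: L2_measurable.
  - by move=> x _; rewrite lee_fin sqr_ge0.
  apply: ge0_le_integral => //.
  - move=> x _; rewrite lee_fin mulr_ge0 ?trunc_ge0 // mulr_ge0 ?sqr_ge0 //.
    exact: ltW (qq_gt0 _).
  - apply/measurable_EFinP; apply: measurable_funM; first exact: measurable_trunc.
    by apply: measurable_funM => //; exact: measurable_qq.
  - apply: measurable_funeM; apply/measurable_EFinP; apply: measurable_funX; exact: L2_measurable.
  - move=> x _; rewrite -EFinM lee_fin bmulE // /trunc.
    have [qk|_] := boolP (qq x <= k%:R :> R); last by rewrite mul0r mulr_ge0 // sqr_ge0.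
    by rewrite mul1r exprMn (mulrA 4) ler_wpM2r ?sqr_ge0 // om_qq.
pose g : E3 R -> R := fun x => wt (s / 2) x * d x.
have mg : measurable_fun setT g by apply: measurable_funM => //; exact: measurable_wt.
have I : (\int[leb3]_x ((g x) ^+ 2)%:E <=
    (expR (s * y) * nrm2 d + expR ((s - 1) * y) * (4 * A))%:E)%E.
  apply: (@le_trans _ _ (\int[leb3]_x ((expR (s * y))%:E * (d x ^+ 2)%:E +
      (expR ((s - 1) * y))%:E * (qq x * d x ^+ 2)%:E))%E).
    apply: ge0_le_integral => //.
    - by move=> x _; rewrite lee_fin sqr_ge0.
    - by apply/measurable_EFinP; exact: measurable_funX.
    - apply: emeasurable_funD; apply: measurable_funeM; apply/measurable_EFinP => //.
      by apply: measurable_funM => //; exact: measurable_qq.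
    - move=> x _; rewrite -!EFinM -EFinD lee_fin /g exprMn (expr2 (wt _ _)) wtM -splitr.
      rewrite (mulrA (expR ((s - 1) * y))) -mulrDl ler_wpM2r ?sqr_ge0 //; exact: wt_interpolate.
  rewrite ge0_integralD //.
  - rewrite !ge0_integralZl //.
    + by rewrite EFinD EFinM -nrm2E leeD2l // EFinM lee_wpmul2l // lee_fin expR_ge0.
    + by apply/measurable_EFinP; apply: measurable_funM => //; exact: measurable_qq.
    + by move=> x _; rewrite lee_fin mulr_ge0 ?sqr_ge0 // ltW // qq_gt0.
    + exact/measurable_EFinP.
    + by move=> x _; rewrite lee_fin sqr_ge0.
  - by move=> x _; rewrite mule_ge0 // lee_fin ?expR_ge0 ?sqr_ge0.
  - by apply: measurable_funeM; apply/measurable_EFinP.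
  - by move=> x _; rewrite mule_ge0 // lee_fin ?expR_ge0 // mulr_ge0 ?sqr_ge0 // ltW // qq_gt0.
  - apply: measurable_funeM; apply/measurable_EFinP.
    by apply: measurable_funM => //; exact: measurable_qq.
have gi : g \in sqint leb3 by apply/sqintP; split => //; exact: le_lt_trans I (ltry _).
exists (MkL2 gi); split; last by rewrite -lee_fin nrm2E.
apply: L2_eqP => x; rewrite bmulE //=; last by apply: bm_wt; have /andP[] := s01; lra.
by rewrite /g mulrA wtM addNr wt0 mul1r.
Qed.

Lemma Bm_rep n (d : {ffun 'I_n -> V}) (A y : R) :
  (forall e : R, 0 < e -> sdot (Bm (om e) d) (Bm (om e) d) <= A) ->
  exists g, d = Bm c g /\
    sdot g g <= expR (s * y) * sdot d d + expR ((s - 1) * y) * (n%:R * (4 * A)).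
Proof.
move=> H.
have /choice[g Hg] i : exists g : V, d i = bmul c g /\
    nrm2 g <= expR (s * y) * nrm2 (d i) + expR ((s - 1) * y) * (4 * A).
  apply: wt_rep => e e0; apply: le_trans (H e e0).
  rewrite /sdot (bigD1 i) //= ffunE -/(nrm2 _) lerDl; apply: sumr_ge0 => k _.
  exact: nrm2_ge0.
exists [ffun i => g i]; split.
  by apply/ffunP => i; rewrite !ffunE; exact: (Hg i).1.
apply: (@le_trans _ _ (\sum_(i < n) (expR (s * y) * nrm2 (d i) + expR ((s - 1) * y) * (4 * A)))).
  by apply: ler_sum => i _; rewrite ffunE; exact: (Hg i).2.
rewrite big_split /= sumr_const card_ord -mulr_sumr (mulr_natl _ n) mulrnAr; exact: lexx.
Qed.
End weighted_representative.

(** * Strong convergence of the resolvents *)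

Section truncation_spinor.
Context {R : realType}.
Local Notation V := (L2 (@leb3 R)).

Lemma trunc_mono (k m : nat) (v : V) : (k <= m)%N ->
  nrm2 (v - bmul (trunc m) v) <= nrm2 (v - bmul (trunc k) v).
Proof.
move=> km.
have bt i : bm (fun x : E3 R => 1 + (-1) * trunc i x).
  apply: bmD; first exact: (@bm_cst _ _ _ 1).
  by apply: bmM; [exact: (@bm_cst _ _ _ (-1))|exact: bm_trunc].
have E i : nrm2 (v - bmul (trunc i) v) = ip v (bmul (fun x => 1 + (-1) * trunc i x) v).
  have -> : v - bmul (trunc i) v = bmul (fun x => 1 + (-1) * trunc i x) v.
    by apply: L2_eqP => x; rewrite L2BE !bmulE //; [ring|exact: bm_trunc].
  rewrite /nrm2 ip_bmul //; congr (ip v _); apply: L2_eqP => x; rewrite !bmulE //.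
  by case: (trunc01 i x) => ->; ring.
rewrite !E; apply: ip_bmul_le => // x; rewrite !mulN1r lerD2l lerN2 /trunc.
have [h|_] := boolP (qq x <= k%:R :> R); last by rewrite ler0n.
by rewrite (le_trans h) // ler_nat.
Qed.

Lemma Bm_trunc_small n (u : {ffun 'I_n -> V}) (e : R) : 0 < e ->
  exists k, sdot (u - Bm (trunc k) u) (u - Bm (trunc k) u) <= e.
Proof.
move=> e0; have e1 : 0 < e / n.+1%:R by rewrite divr_gt0 // ltr0n.
have /choice[k Hk] i := bmul_trunc_small (u i) e1.
exists (\max_i k i)%N; apply: (@le_trans _ _ (\sum_(i < n) e / n.+1%:R)).
  apply: ler_sum => i _; rewrite !ffunE; apply: le_trans (Hk i).
  by apply: trunc_mono; exact: leq_bigmax.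
rewrite sumr_const card_ord -(mulr_natr _ n) mulrAC ler_pdivrMr ?ltr0n //.
by rewrite ler_wpM2l ?(ltW e0) // ler_nat.
Qed.
End truncation_spinor.

Lemma BmN {R : realType} n a (u : {ffun 'I_n -> L2 (@leb3 R)}) : bm a -> Bm a (- u) = - Bm a u.
Proof. by move=> ba; rewrite -(scaleN1r u) BmZ // scaleN1r. Qed.

(** Three uses of [q (u + v) <= 2 q u + 2 q v] give the four summands the factors 8, 8, 4 and 2,
    whence the 32 and the 16. *)
Lemma arith_split (R : realFieldType) (e t K a1 a2 a3 a4 b2 b3 b4 : R) :
  16 * (K + 1) * t = e -> 0 < t -> 0 <= K -> a1 <= e / 32 -> a2 <= K * t -> a3 <= t ->
  a4 <= K * t -> b2 <= 2 * a1 + 2 * a2 -> b3 <= 2 * b2 + 2 * a3 -> b4 <= 2 * b3 + 2 * a4 ->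
  b4 <= e.
Proof. by move=> <- t0 K0; have := mulr_ge0 K0 (ltW t0); lra. Qed.

Section resolvent_convergence.
Context {R : realType} (n : nat).
Local Notation V := (L2 (@leb3 R)).
Local Notation U := {ffun 'I_n -> V}.
Variables (N : 'I_3 -> 'M[R]_n) (B J : 'M[R]_n).
Hypothesis N_anti : forall j, (N j)^T = - N j.
Hypothesis B_sym : B^T = B.
Hypothesis J_anti : J^T = - J.
Hypothesis NN : forall j k, N j *m N k + N k *m N j = - ((j == k)%:R *+ 2)%:M.
Hypothesis NB : forall j, N j *m B + B *m N j = 0.
Hypothesis BB : B *m B = 1%:M.
Hypothesis JJ : J *m J = - 1%:M.
Hypothesis NJ : forall j, N j *m J = J *m N j.
Hypothesis BJ : B *m J = J *m B.
Local Notation act := (@mact R n).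
Local Notation dsol := (dsol N B J).
Local Notation yos := (yos (@sdot R n) (act J) (drel N B)).
Implicit Types (u v f : U) (l m : R).

Let dotJ u v : sdot (act J u) v = - sdot u (act J v).
Proof. by rewrite sdot_mact J_anti -scaleN1r mactZl sdotZr mulN1r. Qed.
Let dotJJ u v : sdot (act J (act J u)) v = - sdot u v.
Proof. by rewrite -mactM JJ -(scaleN1r 1%:M) mactZl mact1 sdotZl mulN1r. Qed.
Let isoJ u v : sdot (act J u) (act J v) = sdot u v.
Proof. by rewrite dotJ sdotC dotJJ opprK sdotC. Qed.

Let cD := @sdotDl R n. Let cZ := @sdotZl R n. Let cC := @sdotC R n. Let c0 := @sdot_ge0 R n.
Let jD := @mactD R n J. Let jZ := @mactZ R n J.
Let hD := @drelD R n N B. Let hZ := @drelZ R n N B. Let hJ := drelJ NJ BJ.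
Let hS := drel_sym N_anti B_sym.

Lemma dsolD l m u f v g : dsol l m u f -> dsol l m v g -> dsol l m (u + v) (f + g).
Proof. exact: (solD cD cZ jD hD). Qed.
Lemma dsolZ a l m u f : dsol l m u f -> dsol l m (a *: u) (a *: f).
Proof. exact: (solZ cD cZ jZ hZ). Qed.
Lemma dsolJ l m u f : dsol l m u f -> dsol l m (act J u) (act J f).
Proof. exact: (solJ cD cZ dotJ hJ). Qed.
Lemma dsol_ueq l m u f f' : ueq f f' -> dsol l m u f -> dsol l m u f'.
Proof. exact: sol_eqd. Qed.
Lemma dsol_uniq l m u v f : m != 0 -> dsol l m u f -> dsol l m v f -> ueq u v.
Proof. exact: (sol_uniq cC cD cZ c0 jD jZ dotJ dotJJ hD hZ hJ hS). Qed.
Lemma dsol_le l m u f : dsol l m u f -> m ^+ 2 * sdot u u <= sdot f f.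
Proof. exact: (sol_bound cC cD cZ c0 dotJ dotJJ hJ hS). Qed.
Lemma dyos_le k u f : 0 < k -> yos k u f -> sdot u u <= sdot f f.
Proof. exact: (yos_bound cC cD cZ c0 dotJ dotJJ hJ hS). Qed.
Lemma dyosE k u f : 0 < k -> yos k u f ->
  exists2 h, drel N B u h & ueq (u + k^-1 *: act J h) f.
Proof. exact: (yosE cC cD cZ dotJ dotJJ). Qed.
Lemma dyos_cauchy (u : nat -> U) f : (forall k, yos k.+1%:R (u k) f) ->
  forall e : R, 0 < e -> exists K, forall k m : nat, (K <= k <= m)%N ->
    sdot (u m - u k) (u m - u k) <= e.
Proof. exact: (yos_cauchy cC cD cZ c0 jD jZ dotJ dotJJ hD hZ hJ hS). Qed.

(* Weights commute with the resolvent up to a bounded term. *)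
Lemma yos_weight (k : R) u f (e : R) : 1 <= k -> 0 < e -> yos k u f ->
  sdot (Bm (om e) u) (Bm (om e) u) <= 2 * sdot (Bm (om e) f) (Bm (om e) f) + 24 * sdot f f.
Proof.
move=> k1 e0 yu; have k0 : 0 < k by apply: lt_le_trans k1.
have C j := C1b_om e0 j.
have [[bo _] _ _ _] := C ord0; have bo' j : bm (om' e j : E3 R -> R) by have [[]] := C j.
have uf := dyos_le k0 yu.
have /dsolE[g [ug eq]] := yu.
set M := B - 0%:M - k *: J in eq.
set v := Bm (om e) u.
(* The commutator of the weight with the Dirac operator: it contains only [om'], bounded by 1
   uniformly in [e]. *)
pose F1 := \sum_j act (N j) (Bm (om' e j) u).
pose F2 := - k *: act J (Bm (om e) f).
have sv : dsol 0 k v (F1 + F2).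
  apply/dsolE; exists (fun j => Bm (om' e j) u + Bm (om e) (g j)); split=> [j|z].
    exact: PD_Bm.
  have -> : F2 = Bm (om e) (- k *: act J f) by rewrite BmZ // Bm_mact.
  rewrite sdotDl (Bm_ueq bo eq) BmD // Bm_sum // Bm_mact // !sdotDl !sdot_suml addrA.
  congr (_ + _); rewrite -big_split; apply: eq_bigr => j _ /=.
  by rewrite Bm_mact // mactD sdotDl.
have := dsol_le sv => h1.
have h2 : sdot F2 F2 = k ^+ 2 * sdot (Bm (om e) f) (Bm (om e) f).
  by rewrite /F2 sdotZl sdotZr isoJ; ring.
have h3 : sdot F1 F1 <= 12 * sdot f f.
  have w j : sdot (act (N j) (Bm (om' e j) u)) (act (N j) (Bm (om' e j) u)) <= sdot f f.
    rewrite sdot_mact -mactM (N_isom N_anti NN) mact1; apply: le_trans uf.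
    rewrite sdot_Bm // BmM //.
    have -> : sdot u u = sdot u (Bm (cst 1) u) by rewrite Bm_cst scale1r.
    apply: sdot_Bm_le => [||x]; [exact: bmM|exact: bm_cst|].
    by rewrite -expr2 -real_normK ?num_real // exprn_ile1 // om'_le.
  rewrite /F1 !big_ord_recl big_ord0 addr0.
  set w0 := act _ _; set w1 := act _ _; set w2 := act _ _.
  have a0 : sdot w0 w0 <= sdot f f by exact: w.
  have a1 : sdot w1 w1 <= sdot f f by exact: w.
  have a2 : sdot w2 w2 <= sdot f f by exact: w.
  have := sdot_sqD w0 (w1 + w2); have := sdot_sqD w1 w2; have := sdot_ge0 f; lra.
have h4 := sdot_sqD F1 F2.
have k2 : 1 <= k ^+ 2 by rewrite exprn_ege1.
rewrite -(ler_pM2l (lt_le_trans ltr01 k2)); apply: le_trans h1 _; apply: le_trans h4 _.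
have : 1 * sdot f f <= k ^+ 2 * sdot f f by rewrite ler_wpM2r // sdot_ge0.
by rewrite h2; move: h3; set x := sdot F1 F1; set y := k ^+ 2; lra.
Qed.


Variable s : R.
Hypothesis s12 : 2^-1 < s < 1.
(** Existence is all that is taken from the given resolvents; uniqueness and the L_2 bounds follow
    from symmetry. *)
Hypothesis ex : forall l m f, m != 0 -> exists u, dsol l m u f.
Local Notation c := (wt (- (s / 2)) : E3 R -> R).
Local Notation b := (wt (- s) : E3 R -> R).
Let q u : R := sdot u (Bm b u).

Let s0 : 0 < s. Proof. by have /andP[h _] := s12; apply: lt_trans h; rewrite invr_gt0. Qed.
Let s1 : s < 1. Proof. by have /andP[] := s12. Qed.
Let s01 : 0 < s < 1. Proof. by rewrite s0 s1. Qed.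
Let bc : bm c. Proof. by apply: bm_wt; move: s0; lra. Qed.
Let bb : bm b. Proof. by apply: bm_wt; move: s0; lra. Qed.

Let q_sq u : q u = sdot (Bm c u) (Bm c u).
Proof.
rewrite /q sdot_Bm // BmM //; congr (sdot u (Bm _ u)).
by apply/funext => x; rewrite wtM -opprD -splitr.
Qed.
Let qD u v : q (u + v) <= 2 * q u + 2 * q v.
Proof. by rewrite !q_sq BmD //; exact: sdot_sqD. Qed.
Let qN u : q (- u) = q u.
Proof. by rewrite !q_sq BmN // sdotNl sdotNr opprK. Qed.
Let q0 u : 0 <= q u. Proof. by rewrite q_sq sdot_ge0. Qed.
Let q_ueq u v : ueq u v -> q u = q v.
Proof. by move=> e; rewrite /q e -sdot_Bm // sdotC e sdotC sdot_Bm. Qed.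
Let q_le u : q u <= sdot u u.
Proof.
have -> : sdot u u = sdot u (Bm (cst 1) u) by rewrite Bm_cst scale1r.
apply: sdot_Bm_le => [||x] //; first exact: bm_cst.
by apply: wt_le1; move: s0; lra.
Qed.

Lemma resolvent_bounded : exists K L : R, 0 <= K /\ forall l m u f f', L <= `|l| ->
  0 < `|m| <= 1 -> dsol l m u f -> ueq f (Bm c f') -> q u <= K * sdot f' f'.
Proof.
have [a [a' [d [d' [b' mw]]]]] := morawetz_weights_ex s12.
have th0 : 0 < 2 * s - 1 by have /andP[h _] := s12; move: h; lra.
have stw j (h : R) (v : U) : `|h| <= 1 -> exists v' : U,
    ueq (St j h (Bm c v)) (Bm c v') /\ sdot v' v' <= 4 * sdot v v.
  move=> h1; have s01' : 0 <= s <= 1 by rewrite !ltW.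
  have /choice[g Hg] i := st_weight s01' j (v i) h1.
  exists [ffun i => g i]; split.
    by apply/ueqP => i; rewrite !ffunE (Hg i).1.
  by rewrite /sdot mulr_sumr; apply: ler_sum => i _; rewrite ffunE; exact: (Hg i).2.
have C0 : (0 : R) <= 16 by [].
have T := resolvent_estimate N_anti B_sym J_anti NN NB BB JJ NJ BJ mw th0 C0 stw.
exists (2560 * (12 * (384 / (2 * s - 1) + 1 / 2 + (2 * s - 1) / 10) / (2 * s - 1) + 2)).
exists (16 + 16 * 16 + 120 * 16 / (2 * s - 1)); split.
  by apply: mulr_ge0; [rewrite ler0n|exact: arith_K].
move=> l m u f f' Ll /andP[m0 m1] su ef.
have m0' : - m != 0 by rewrite oppr_eq0 -normr_eq0 gt_eqF.
(* [w] is the resolvent at [-z] applied to [u], that is, [u = (H + z) w]. *)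
have [w sw] := ex (- l) u m0'.
exact: T Ll m1 sw su ef.
Qed.

Lemma om_trunc_le k (f : U) (e : R) : 0 < e ->
  sdot (Bm (om e) (Bm c (Bm (trunc k) f))) (Bm (om e) (Bm c (Bm (trunc k) f))) <=
  k%:R * sdot f f.
Proof.
move=> e0; have [[bo _] _ _ _] := C1b_om e0 ord0; have bt := @bm_trunc R k.
have b1 := bmM bc bt; have b2 := bmM bo b1.
rewrite (BmM _ bc bt) (BmM _ bo b1) (sdot_Bm _ _ b2) (BmM _ b2 b2).
have -> : k%:R * sdot f f = sdot f (Bm (cst k%:R) f) by rewrite Bm_cst sdotZr.
apply: sdot_Bm_le => [||x]; [exact: bmM|exact: bm_cst|].
have c1 : 0 < c x <= 1 by rewrite wt_gt0 wt_le1 //; move: s0; lra.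
have /andP[cx0 cx1] := c1; have o0 := om_ge0 e0 x; have ol := om_le e0 x.
rewrite /= -expr2 /trunc; have [h|_] := boolP (qq x <= k%:R :> R); last by rewrite !mulr0 expr0n ler0n.
rewrite mulr1; apply: le_trans h; rewrite -(wt1 x).
have -> : wt 1 x = wt 2^-1 x ^+ 2 by rewrite expr2 wtM -[2^-1]mul1r -splitr.
have oc0 : 0 <= om e x * c x by apply: mulr_ge0 => //; exact: ltW.
have oc1 : om e x * c x <= wt 2^-1 x by apply: le_trans ol; exact: ler_piMr.
by rewrite lerXn2r // nnegrE // ltW // wt_gt0.
Qed.

Lemma yos_sequence k (f' : U) : exists (u : nat -> U) (A : R),
  (forall i, yos i.+1%:R (u i) (Bm c (Bm (trunc k) f'))) /\
  forall i e, 0 < e -> sdot (Bm (om e) (u i)) (Bm (om e) (u i)) <= A.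
Proof.
set f1 := Bm c _.
have E i : exists u, yos i.+1%:R u f1.
  by apply: ex; rewrite gt_eqF // ltr0n.
have [u Hu] := choice E.
exists u, (2 * (k%:R * sdot f' f') + 24 * sdot f1 f1); split => // i e e0.
have k1 : 1 <= (i.+1%:R : R) by rewrite ler1n.
apply: le_trans (yos_weight k1 e0 (Hu i)) _.
by rewrite lerD2r ler_wpM2l // om_trunc_le.
Qed.

Lemma norm_lmJ l m v : sdot (l *: v + m *: act J v) (l *: v + m *: act J v) =
  (l ^+ 2 + m ^+ 2) * sdot v v.
Proof.
have J0 : sdot v (act J v) = 0 by have := dotJ v v; rewrite sdotC; lra.
by rewrite !(sdotDl, sdotDr, sdotZl, sdotZr) isoJ (sdotC (act J v)) J0; ring.
Qed.

Lemma drel_dsol l m u h : drel N B u h -> dsol l m u (h - l *: u - m *: act J u).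
Proof. by move=> uh; exists h. Qed.

(* [R(z) u = z^-1 (R(z) H u - u)] is [O(1/|z|)] for regular [u]. *)
Lemma resolvent_regular (u u' h h' : U) : drel N B u h -> u = Bm c u' -> ueq h (Bm c h') ->
  exists C L : R, forall l m v, L <= `|l| -> 0 < `|m| <= 1 -> dsol l m v u -> l ^+ 2 * q v <= C.
Proof.
move=> uh uu hh; have [K [L [K0 HK]]] := resolvent_bounded.
exists (2 * (K * sdot h' h') + 2 * q u), L => l m v lL m1 sv.
have m0 : m != 0 by have /andP[] := m1; rewrite normr_gt0.
have [y sy] := ex l h m0.
(* Both sides solve the equation with right-hand side [z u]. *)
have e : ueq (y - u) (l *: v + m *: act J v).
  apply: (@dsol_uniq l m _ _ (l *: u + m *: act J u) m0); last first.
    by apply: dsolD; apply: dsolZ => //; exact: dsolJ.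
  have := dsolD sy (dsolZ (-1) (drel_dsol l m uh)); rewrite !scaleN1r.
  by rewrite !opprD !opprK !addrA subrr add0r.
have qy : q y <= K * sdot h' h' by exact: HK lL m1 sy hh.
have : q (y - u) <= 2 * q y + 2 * q u.
  by apply: le_trans (qD _ _) _; rewrite qN.
rewrite (q_ueq e).
have -> : q (l *: v + m *: act J v) = (l ^+ 2 + m ^+ 2) * q v.
  by rewrite !q_sq BmD // !BmZ // Bm_mact // norm_lmJ.
have := q0 v; have : 0 <= m ^+ 2 * q v by rewrite mulr_ge0 ?sqr_ge0.
rewrite mulrDl; move: qy; set a := l ^+ 2 * _; set a' := m ^+ 2 * _; lra.
Qed.

(** The solution is split along the data [u i0], [u j - u i0], [f1 - u j] and the truncation error.
    The index [i0] is chosen before [l] and [m], and [j] after them: [v1] is small because [|l|] is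
    large, [v2] and [v4] by uniform boundedness, [v3] because [j] is large. *)
Lemma resolvent_to_zero (f' : U) (eps : R) : 0 < eps -> exists L : R, forall l m u f,
  L <= `|l| -> 0 < `|m| <= 1 -> ueq f (Bm c f') -> dsol l m u f -> q u <= eps.
Proof.
move=> eps0; have [K [L [K0 HK]]] := resolvent_bounded.
pose del := eps / (16 * (K + 1)).
have K1 : 0 < K + 1 by rewrite ltr_wpDl.
have del0 : 0 < del by rewrite divr_gt0 // mulr_gt0.
have delE : 16 * (K + 1) * del = eps by rewrite /del mulrC divfK // gt_eqF // mulr_gt0.
have [k Hk] := Bm_trunc_small f' del0.
set f1' := Bm (trunc k) f' in Hk; set f2' := f' - f1' in Hk.
have [u [A [Hu HA]]] := yos_sequence k f'; rewrite -/f1' in Hu.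
set f1 := Bm c f1' in Hu.
have A0 : 0 <= A by apply: le_trans (HA 0%N 1 ltr01); exact: sdot_ge0.
have dA i j e : 0 < e -> sdot (Bm (om e) (u j - u i)) (Bm (om e) (u j - u i)) <= 4 * A.
  move=> e0; have [[bo _] _ _ _] := C1b_om e0 ord0.
  have -> : Bm (om e) (u j - u i) = Bm (om e) (u j) + (-1) *: Bm (om e) (u i).
    by rewrite -BmZ // -BmD // scaleN1r.
  apply: le_trans (sdot_sqD _ _) _.
  by rewrite sdotZl sdotZr; have := HA j e e0; have := HA i e e0; lra.
(* The cut [y] is fixed first, to make the L_{2,1} share of the interpolation small; the Cauchy
   index [i0] then compensates the factor [expR (s * y)]. *)
have [y Hy] : exists y, expR ((s - 1) * y) * (n%:R * (4 * (4 * A))) <= del / 2.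
  set T : R := n%:R * _; have T0 : 0 <= T by rewrite /T; do 3! apply: mulr_ge0 => //.
  have sn : s - 1 != 0 by rewrite lt_eqF // subr_lt0.
  have T1 : 0 < T + 1 by exact: ltr_wpDl.
  have X0 : 0 < del / 2 / (T + 1) by apply: divr_gt0 => //; exact: divr_gt0.
  exists (ln (del / 2 / (T + 1)) / (s - 1)).
  rewrite (mulrCA (s - 1)) divff // mulr1 lnK ?posrE //.
  rewrite mulrAC ler_pdivrMr //; apply: ler_wpM2l; first exact: ltW (divr_gt0 _ _).
  by rewrite lerDl.
have eta0 : 0 < del / 2 / expR (s * y) by apply: divr_gt0; [exact: divr_gt0|exact: expR_gt0].
have [i0 Hi0] := dyos_cauchy Hu eta0.
have cauchy j : (i0 <= j)%N -> exists g, u j - u i0 = Bm c g /\ sdot g g <= del.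
  move=> ij; have [g [eg Hg]] := Bm_rep s01 y (dA i0 j).
  exists g; split => //; apply: le_trans Hg _.
  have := Hi0 i0 j; rewrite leqnn ij => /(_ isT).
  rewrite ler_pdivlMr ?expR_gt0 // => h.
  by rewrite (mulrC (expR (s * y))); lra.
have [g0 [eg0 _]] := Bm_rep s01 0 (HA i0).
have i0p : 0 < (i0.+1%:R : R) by rewrite ltr0n.
have [h uh eh] := dyosE i0p (Hu i0).
(* The image of [u i0] under the operator is [i0.+1] times [J (u i0 - f1)], and both [u i0] and [f1]
   lie in the weighted space. *)
pose h' := i0.+1%:R *: act J (g0 - f1').
have hh' : ueq h (Bm c h').
  move=> z; rewrite /h' BmZ // Bm_mact // sdotZl.
  have -> : Bm c (g0 - f1') = u i0 - f1.
    by rewrite eg0 /f1 BmD // BmN.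
  have := eh (act J z); rewrite sdotDl sdotZl isoJ => e.
  rewrite dotJ sdotDl sdotNl -e.
  by have : i0.+1%:R * (i0.+1%:R : R)^-1 = 1 by [rewrite divff // gt_eqF]; move: (_^-1) => r re;
     rewrite !opprD !addrA subrr sub0r opprK mulrA re mul1r.
have [C [L' HC]] := resolvent_regular uh eg0 hh'.
exists (Num.max 1 (Num.max L (Num.max L' (32 * C / eps)))) => l m v f lL m1 ef sv.
move: lL; rewrite !ge_max => /andP[l1 /andP[lL /andP[lL' lC]]].
have m0 : m != 0 by have /andP[] := m1; rewrite normr_gt0.
(* A crude bound for [v3], which blows up as [m] tends to 0 but gets divided by the square of
   [j.+1]; [j] may depend on [l] and [m]. *)
set Q := (2 + 2 * ((l ^+ 2 + m ^+ 2) / m ^+ 2)) * sdot f1 f1.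
have m2 : 0 < m ^+ 2 by rewrite exprn_even_gt0.
have Q0 : 0 <= Q.
  by rewrite mulr_ge0 ?sdot_ge0 // addr_ge0 // mulr_ge0 // divr_ge0 ?(ltW m2) // addr_ge0 ?sqr_ge0.
have [j ij Hj] : exists2 j, (i0 <= j)%N & Q / j.+1%:R ^+ 2 <= del.
  have Qd : 0 <= Q / del by apply: divr_ge0 => //; exact: ltW.
  have := archi_boundP Qd; set j := Num.bound _; rewrite ltr_pdivrMr // => Hj.
  exists (maxn i0 j); first exact: leq_maxl.
  rewrite ler_pdivrMr ?exprn_gt0 ?ltr0n //; apply: le_trans (ltW Hj) _.
  rewrite mulrC ler_pM2l // -natrX ler_nat; apply: leq_trans (leq_maxr i0 j) _.
  by rewrite -mulnn; apply: leq_trans (leqnSn _) _; exact: leq_pmulr.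
have [g [eg Hg]] := cauchy j ij.
have jp : 0 < (j.+1%:R : R) by rewrite ltr0n.
have [v1 sv1] := ex l (u i0) m0.
have [v2 sv2] := ex l (u j - u i0) m0.
have [v' sv'] := ex l (u j) m0.
have [v4 sv4] := ex l (Bm c f2') m0.
have [hj ujh ehj] := dyosE jp (Hu j).
(* [f1 - u j] is [J hj] divided by [j.+1], and the solution for [hj] is [u j + z v']. *)
pose v3 := j.+1%:R^-1 *: act J (u j + (l *: v' + m *: act J v')).
have sv3 : dsol l m v3 (f1 - u j).
  have s1' : dsol l m (u j + (l *: v' + m *: act J v')) hj.
    have := dsolD (drel_dsol l m ujh) (dsolD (dsolZ l sv') (dsolZ m (dsolJ sv'))).
    have -> : hj - l *: u j - m *: act J (u j) = hj - (l *: u j + m *: act J (u j)).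
      by rewrite opprD addrA.
    by rewrite subrK.
  apply: dsol_ueq (dsolZ (j.+1%:R^-1) (dsolJ s1')) => z.
  by rewrite [RHS]sdotDl sdotNl -ehj sdotDl; ring.
have q1 : q v1 <= eps / 32.
  have h1 := HC l m v1 lL' m1 sv1.
  have l2 : `|l| <= l ^+ 2 by rewrite -[l ^+ 2]real_normK ?num_real // expr2 ler_peMr.
  have l20 : 0 < l ^+ 2 by apply: lt_le_trans l2; exact: lt_le_trans l1.
  rewrite -(ler_pM2l l20); apply: le_trans h1 _.
  have := le_trans lC l2; rewrite ler_pdivrMr // => h2.
  by rewrite mulrA ler_pdivlMr // mulrC.
have q2 : q v2 <= K * del.
  by apply: le_trans (HK _ _ _ _ _ lL m1 sv2 _) _; [by rewrite eg|rewrite ler_wpM2l].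
have q4 : q v4 <= K * del.
  by apply: le_trans (HK _ _ _ _ _ lL m1 sv4 _) _; [by []|rewrite ler_wpM2l].
have q3 : q v3 <= del.
  apply: le_trans (q_le _) _; apply: le_trans Hj.
  pose w := u j + (l *: v' + m *: act J v').
  have -> : sdot v3 v3 = sdot w w / j.+1%:R ^+ 2.
    by rewrite /v3 sdotZl sdotZr isoJ -exprVn; ring.
  rewrite ler_pM2r ?invr_gt0 ?exprn_gt0 //.
  apply: le_trans (sdot_sqD _ _) _; rewrite norm_lmJ /Q.
  have uj := dyos_le jp (Hu j); have vj := dsol_le sv'.
  have hv : (l ^+ 2 + m ^+ 2) * sdot v' v' <= (l ^+ 2 + m ^+ 2) / m ^+ 2 * sdot f1 f1.
    rewrite -mulrA ler_wpM2l ?addr_ge0 ?sqr_ge0 // ler_pdivlMl //; exact: le_trans vj uj.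
  move: hv uj; set X : R := _ / _; set p : R := _ * sdot v' v'; set F : R := sdot f1 f1.
  rewrite (_ : (2 + 2 * X) * F = 2 * F + 2 * (X * F)); last by ring.
  by move=> hp huF; rewrite lerD // ler_wpM2l.
have e : ueq v (v1 + v2 + v3 + v4).
  apply: (@dsol_uniq l m _ _ _ m0 sv); apply: dsol_ueq (dsolD (dsolD (dsolD sv1 sv2) sv3) sv4) => z.
  rewrite ef; congr (sdot _ z).
  have -> : u i0 + (u j - u i0) + (f1 - u j) = f1 by rewrite (addrC (u i0)) subrK addrC subrK.
  by rewrite /f1 -BmD // /f2' addrC subrK.
rewrite (q_ueq e).
exact: (arith_split delE del0 K0 q1 q2 q3 q4 (qD v1 v2) (qD _ v3) (qD _ v4)).
Qed.
End resolvent_convergence.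

Local Open Scope complex_scope.

(** * Complex spinors as real spinors *)

Section realification.
Context {R : realType}.
Implicit Types (x y z : R[i]).

Lemma cReD x y : complex.Re (x + y) = complex.Re x + complex.Re y.
Proof. by case: x y => ? ? []. Qed.
Lemma cImD x y : complex.Im (x + y) = complex.Im x + complex.Im y.
Proof. by case: x y => ? ? []. Qed.
Lemma cReN x : complex.Re (- x) = - complex.Re x. Proof. by case: x. Qed.
Lemma cImN x : complex.Im (- x) = - complex.Im x. Proof. by case: x. Qed.
Lemma cReM x y : complex.Re (x * y) = complex.Re x * complex.Re y - complex.Im x * complex.Im y.
Proof. by case: x y => ? ? []. Qed.
Lemma cImM x y : complex.Im (x * y) = complex.Re x * complex.Im y + complex.Im x * complex.Re y.
Proof. by case: x y => ? ? []. Qed.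
Lemma cRe_sum I r (P : pred I) (F : I -> R[i]) :
  complex.Re (\sum_(i <- r | P i) F i) = \sum_(i <- r | P i) complex.Re (F i).
Proof. by apply: (big_morph _ cReD). Qed.
Lemma cIm_sum I r (P : pred I) (F : I -> R[i]) :
  complex.Im (\sum_(i <- r | P i) F i) = \sum_(i <- r | P i) complex.Im (F i).
Proof. by apply: (big_morph _ cImD). Qed.

Local Notation mRe := (map_mx (@complex.Re R)).
Local Notation mIm := (map_mx (@complex.Im R)).

Lemma mReM m n p (A : 'M[R[i]]_(m, n)) (B : 'M[R[i]]_(n, p)) :
  mRe (A *m B) = mRe A *m mRe B - mIm A *m mIm B.
Proof.
apply/matrixP => i j; rewrite !mxE cRe_sum -sumrB; apply: eq_bigr => k _.
by rewrite cReM !mxE.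
Qed.
Lemma mImM m n p (A : 'M[R[i]]_(m, n)) (B : 'M[R[i]]_(n, p)) :
  mIm (A *m B) = mRe A *m mIm B + mIm A *m mRe B.
Proof.
apply/matrixP => i j; rewrite !mxE cIm_sum -big_split; apply: eq_bigr => k _ /=.
by rewrite cImM !mxE.
Qed.

(** The action of [A] on complex columns, written as real columns with the real parts on top. *)
Definition rmx n (A : 'M[R[i]]_n) : 'M[R]_(n + n) :=
  block_mx (mRe A) (- mIm A) (mIm A) (mRe A).
Definition realcol n (v : 'cV[R[i]]_n) : 'cV[R]_(n + n) := col_mx (mRe v) (mIm v).

Lemma rmxD n (A B : 'M[R[i]]_n) : rmx (A + B) = rmx A + rmx B.
Proof.
rewrite /rmx add_block_mx -opprD.
by congr (block_mx _ (- _) _ _); apply/matrixP => i j; rewrite !mxE ?cReD ?cImD.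
Qed.
Lemma rmxN n (A : 'M[R[i]]_n) : rmx (- A) = - rmx A.
Proof.
rewrite /rmx opp_block_mx.
by congr (block_mx _ (- _) _ _); apply/matrixP => i j; rewrite !mxE ?cReN ?cImN.
Qed.
Lemma rmxM n (A B : 'M[R[i]]_n) : rmx (A *m B) = rmx A *m rmx B.
Proof.
rewrite /rmx mulmx_block mReM mImM !mulmxN !mulNmx -opprD.
by congr (block_mx _ (- _) _ _); rewrite addrC.
Qed.
Lemma rmx_adj n (A : 'M[R[i]]_n) : rmx (map_mx conjc A^T) = (rmx A)^T.
Proof.
rewrite /rmx tr_block_mx; congr block_mx; apply/matrixP => i j; rewrite !mxE;
  by case: (A j i) => a b; rewrite /= ?opprK.
Qed.
Lemma rmx_scalar n z : rmx (z%:M : 'M[R[i]]_n) =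
  (complex.Re z)%:M + complex.Im z *: rmx ('i%:M).
Proof.
have e (f : R[i] -> R) (f0 : f 0 = 0) a : map_mx f (a%:M : 'M[R[i]]_n) = (f a)%:M.
  by apply/matrixP => i j; rewrite !mxE; case: (i == j); rewrite ?mulr1n ?mulr0n.
rewrite /rmx !e // (scalar_mx_block n n) scale_block_mx add_block_mx.
by congr block_mx; apply/matrixP => i j; rewrite !mxE; case: z => a b /=;
  case: (i == j); rewrite ?mulr1n ?mulr0n; ring.
Qed.
Lemma realcolM n (A : 'M[R[i]]_n) (v : 'cV[R[i]]_n) : realcol (A *m v) = rmx A *m realcol v.
Proof. by rewrite /realcol /rmx mul_block_col mReM mImM mulNmx addrC (addrC (mIm A *m _)). Qed.
Lemma realcolD n (v w : 'cV[R[i]]_n) : realcol (v + w) = realcol v + realcol w.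
Proof.
rewrite /realcol add_col_mx; congr col_mx; apply/matrixP => i j;
  by rewrite !mxE ?cReD ?cImD.
Qed.
End realification.

(** * The Clifford relations over the reals *)

Section real_dirac.
Context {R : realType} (alpha : 'I_4 -> 'M[R[i]]_4).
Hypothesis halpha : dirac_matrices alpha.
Implicit Types (j k : 'I_3).

Local Notation wd := (widen_ord (leqnSn 3)).
Definition cN j : 'M[R[i]]_4 := (0 -i* 1) *: alpha (wd j).
Definition rN j : 'M[R]_(4 + 4) := rmx (cN j).
Definition rB : 'M[R]_(4 + 4) := rmx (alpha ord_max).
Definition rJ : 'M[R]_(4 + 4) := rmx ('i%:M).

Let ii : (0 -i* 1) * (0 -i* 1) = -1 :> R[i].
Proof. by apply/eqP; rewrite eq_complex /= !mulr0 !mul0r mulrNN mulr1 sub0r addr0 oppr0 !eqxx. Qed.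

Let clif (a b : 'I_4) : alpha a *m alpha b + alpha b *m alpha a = ((a == b)%:R *+ 2)%:M.
Proof. by have [_] := halpha. Qed.

Lemma rN_anti j : (rN j)^T = - rN j.
Proof.
rewrite /rN -rmx_adj -rmxN; congr rmx.
have [h _] := halpha; have /matrixP hj := h (wd j).
apply/matrixP => i k; have := hj i k; rewrite !mxE => <-.
by case: (alpha (wd j) k i) => a b; apply/eqP; rewrite eq_complex /=; apply/andP; split; apply/eqP; ring.
Qed.

Lemma rB_sym : rB^T = rB.
Proof. by rewrite /rB -rmx_adj; have [h _] := halpha; rewrite h. Qed.

Lemma rJ_anti : rJ^T = - rJ.
Proof.
rewrite /rJ -rmx_adj -rmxN; congr rmx; apply/matrixP => i k; rewrite !mxE eq_sym.
by case: (i == k); rewrite ?mulr1n ?mulr0n ?oppr0 //=; apply/eqP; rewrite eq_complex /= oppr0 !eqxx.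
Qed.

Lemma rNN j k : rN j *m rN k + rN k *m rN j = - ((j == k)%:R *+ 2)%:M.
Proof.
rewrite /rN -!rmxM -rmxD /cN -!scalemxAl -!scalemxAr !scalerA -scalerDr clif ii scaleN1r.
rewrite rmxN rmx_scalar; congr (- _).
have -> : (wd j == wd k) = (j == k) by rewrite -!val_eqE.
by case: (j == k); rewrite /= ?mulr2n /= ?addr0 ?scale0r ?addr0.
Qed.

Lemma rNB j : rN j *m rB + rB *m rN j = 0.
Proof.
rewrite /rN /rB -!rmxM -rmxD /cN -scalemxAl -scalemxAr -scalerDr clif.
have -> : (wd j == ord_max) = false by rewrite -val_eqE /= ltn_eqF.
by rewrite /= mul0rn scale_scalar_mx mulr0 rmx_scalar /= scale0r addr0 raddf0.
Qed.

Lemma rBB : rB *m rB = 1%:M.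
Proof.
rewrite /rB -rmxM; have /matrixP h := clif ord_max ord_max; rewrite eqxx in h.
have -> : alpha ord_max *m alpha ord_max = 1%:M.
  move: h; move: (alpha ord_max *m _) => P h; apply/matrixP => i k; have := h i k; rewrite !mxE.
  have n2 : (2 : R[i]) != 0 by rewrite pnatr_eq0.
  by move=> e; apply: (mulfI n2); rewrite [LHS]mulr_natl mulr2n e; case: (i == k); rewrite /= ?mulr1n ?mulr0n ?mulr1 ?mulr0.
by rewrite rmx_scalar /= scale0r addr0.
Qed.

Lemma rJJ : rJ *m rJ = - 1%:M.
Proof.
rewrite /rJ -rmxM -scalar_mxM.
have -> : 'i * 'i = -1 :> R[i] by rewrite -expr2 sqr_i.
by rewrite rmx_scalar /= oppr0 scale0r addr0 raddfN.
Qed.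

Lemma rNJ j : rN j *m rJ = rJ *m rN j.
Proof. by rewrite /rN /rJ -!rmxM scalar_mxC. Qed.
Lemma rBJ : rB *m rJ = rJ *m rB.
Proof. by rewrite /rB /rJ -!rmxM scalar_mxC. Qed.
End real_dirac.

(** * Weighted norms of complex spinors *)

Section spinors.
Context {R : realType}.
Local Notation V := (L2 (@leb3 R)).
Local Notation U := {ffun 'I_(4 + 4) -> V}.
Implicit Types (u v f g : spinor R).

Definition rcomp u (i : 'I_(4 + 4)) : E3 R -> R := fun x => realcol (u x) i 0.
Definition realize u : U := [ffun i => toL2 leb3 (rcomp u i)].
Definition cplx (f : U) : spinor R :=
  fun x => \col_k (f (lshift 4 k) x +i* f (rshift 4 k) x).

Lemma rcompl u k : rcomp u (lshift 4 k) = fun x => complex.Re (u x k 0).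
Proof. by apply/funext => x; rewrite /rcomp /realcol col_mxEu mxE. Qed.
Lemma rcompr u k : rcomp u (rshift 4 k) = fun x => complex.Im (u x k 0).
Proof. by apply/funext => x; rewrite /rcomp /realcol col_mxEd mxE. Qed.

Lemma rcomp_cplx (f : U) i : rcomp (cplx f) i = f i.
Proof.
by case: (split_ordP i) => k ->; rewrite ?rcompl ?rcompr; apply/funext => x; rewrite !mxE.
Qed.

Lemma japanese_wt (s : R) (x : R * R * R) : japanese x `^ (2 * s) = wt s x.
Proof.
have -> : japanese x = qq x `^ 2^-1.
  rewrite powR12_sqrt ?(ltW (qq_gt0 _)) // /japanese /qq !big_ord_recl big_ord0 addr0 /=.
  by rewrite /co /= -(addrA (x.1.1 ^+ 2)).
by rewrite -powRrM mulrA mulVf // mul1r /powR gt_eqF // qq_gt0.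
Qed.

Lemma wnorm_sqE (s : R) u k : wnorm_sq s (component u k) =
  (\int[leb3]_x (wt s x * (rcomp u (lshift 4 k) x ^+ 2 + rcomp u (rshift 4 k) x ^+ 2))%:E)%E.
Proof. by apply: eq_integral => x _; rewrite japanese_wt rcompl rcompr. Qed.

Lemma in_spinor_measurable (s : R) u i : in_spinor_L2 s u -> measurable_fun setT (rcomp u i).
Proof.
move=> h; case: (split_ordP i) => k ->; rewrite ?rcompl ?rcompr; have [a b _] := h k.
- exact: a.
- exact: b.
Qed.

Lemma measurable_wsq (s : R) (F : E3 R -> R) : measurable_fun setT F ->
  measurable_fun setT (fun x => (wt s x * F x ^+ 2)%:E).
Proof.
move=> mF; apply/measurable_EFinP; apply: measurable_funM; first exact: measurable_wt.
exact: measurable_funX.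
Qed.

Lemma wsq_ge0 (s : R) (F : E3 R -> R) x : (0 <= (wt s x * F x ^+ 2)%:E)%E.
Proof. by rewrite lee_fin mulr_ge0 ?sqr_ge0 // ltW // wt_gt0. Qed.

Definition spinor_sq (s : R) u : \bar R := (\sum_(k < 4) wnorm_sq s (component u k))%E.

Lemma spinor_sqE (s : R) u : (forall i, measurable_fun setT (rcomp u i)) ->
  spinor_sq s u = (\sum_i \int[leb3]_x (wt s x * rcomp u i x ^+ 2)%:E)%E.
Proof.
move=> mu; rewrite /spinor_sq [RHS]big_split_ord /=.
transitivity (\sum_(k < 4) (\int[leb3]_x (wt s x * rcomp u (lshift 4 k) x ^+ 2)%:E +
   \int[leb3]_x (wt s x * rcomp u (rshift 4 k) x ^+ 2)%:E))%E; last by rewrite big_split.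
apply: eq_bigr => k _; rewrite wnorm_sqE -ge0_integralD //; try (by move=> x _; exact: wsq_ge0); try exact: measurable_wsq.
by apply: eq_integral => x _; rewrite mulrDr EFinD.
Qed.

Lemma in_spinor_L2P (s : R) u : in_spinor_L2 s u <->
  (forall i, measurable_fun setT (rcomp u i)) /\
  forall i, (\int[leb3]_x (wt s x * rcomp u i x ^+ 2)%:E < +oo)%E.
Proof.
split=> [h|[mu iu] k].
  have mu i := in_spinor_measurable i h; split => // i.
  have E k : wnorm_sq s (component u k) =
      (\int[leb3]_x (wt s x * rcomp u (lshift 4 k) x ^+ 2)%:E +
       \int[leb3]_x (wt s x * rcomp u (rshift 4 k) x ^+ 2)%:E)%E.
    rewrite wnorm_sqE -ge0_integralD //; try (by move=> x _; exact: wsq_ge0); try exact: measurable_wsq.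
    by apply: eq_integral => x _; rewrite mulrDr EFinD.
  have I0 i' : (0 <= \int[leb3]_x (wt s x * rcomp u i' x ^+ 2)%:E)%E.
    by apply: integral_ge0 => x _; exact: wsq_ge0.
  case: (split_ordP i) => k ->; have [_ _] := h k; rewrite E; apply: le_lt_trans.
  - by rewrite leeDl.
  - by rewrite leeDr.
split.
- by have := mu (lshift 4 k); rewrite rcompl.
- by have := mu (rshift 4 k); rewrite rcompr.
rewrite wnorm_sqE.
have -> : (\int[leb3]_x (wt s x * (rcomp u (lshift 4 k) x ^+ 2 + rcomp u (rshift 4 k) x ^+ 2))%:E =
   \int[leb3]_x (wt s x * rcomp u (lshift 4 k) x ^+ 2)%:E +
   \int[leb3]_x (wt s x * rcomp u (rshift 4 k) x ^+ 2)%:E)%E.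
  rewrite -ge0_integralD //; try (by move=> x _; exact: wsq_ge0); try exact: measurable_wsq.
  by apply: eq_integral => x _; rewrite mulrDr EFinD.
by rewrite lte_add_pinfty.
Qed.

Lemma in_spinor_L20 u : in_spinor_L2 0 u <-> forall i, rcomp u i \in sqint (@leb3 R).
Proof.
have E i : (\int[leb3]_x (wt 0 x * rcomp u i x ^+ 2)%:E = \int[leb3]_x (rcomp u i x ^+ 2)%:E)%E.
  by apply: eq_integral => x _; rewrite wt0 mul1r.
rewrite in_spinor_L2P; split=> [[mu iu] i|h].
  by apply/sqintP; split => //; rewrite -E.
by split=> i; have /sqintP[a b] := h i; rewrite ?E.
Qed.

Lemma realizeE u i x : in_spinor_L2 0 u -> realize u i x = rcomp u i x.
Proof. by move=> /in_spinor_L20 h; rewrite ffunE toL2E. Qed.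

Lemma cplx_L2 (f : U) : in_spinor_L2 0 (cplx f).
Proof. by apply/in_spinor_L20 => i; rewrite rcomp_cplx; exact: l2funP. Qed.

Lemma realize_cplx (f : U) : realize (cplx f) = f.
Proof.
apply/ffunP => i; apply: L2_eqP => x; rewrite realizeE ?rcomp_cplx //; exact: cplx_L2.
Qed.

Lemma mact_realize (A : 'M[R[i]]_4) u i x : in_spinor_L2 0 u ->
  mact (rmx A) (realize u) i x = rcomp (fun y => A *m u y) i x.
Proof.
move=> hu; rewrite ffunE L2sumE /rcomp realcolM mxE; apply: eq_bigr => k _.
by rewrite L2ZE realizeE.
Qed.

End spinors.

(** * From the complex Dirac equation to the real one *)

Section transfer.
Context {R : realType} (alpha : 'I_4 -> 'M[R[i]]_4).
Local Notation V := (L2 (@leb3 R)).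
Local Notation U := {ffun 'I_(4 + 4) -> V}.
Local Notation dsol := (dsol (rN alpha) (rB alpha) rJ).
Implicit Types (u v f g : spinor R).

Lemma wpartialP j (u : scalar_field R) : in_H1 u ->
  in_L2 0 (wpartial j u) /\ weak_partial j u (wpartial j u).
Proof. by move=> [_ /(_ j)]; exact: xgetPex. Qed.

Lemma realize_fun u i : in_spinor_L2 0 u -> (realize u i : E3 R -> R) = rcomp u i.
Proof. by move=> hu; apply/funext => x; rewrite realizeE. Qed.

Lemma rcompD u v i x : rcomp (fun y => u y + v y) i x = rcomp u i x + rcomp v i x.
Proof. by rewrite /rcomp realcolD mxE. Qed.

Lemma rcomp_sum (F : 'I_3 -> spinor R) i x :
  rcomp (fun y => \sum_j F j y) i x = \sum_j rcomp (F j) i x.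
Proof.
rewrite !big_ord_recl !big_ord0 !addr0 -!rcompD /rcomp.
by congr (realcol _ i 0); rewrite !big_ord_recl big_ord0 addr0.
Qed.

(** On the domain the chosen [wpartial] are genuine weak derivatives, so they serve as witnesses for
    [drel]; the equation almost everywhere becomes one tested against every spinor. *)
Lemma dirac_dsol (l m : R) v f : in_spinor_H1 v -> in_spinor_L2 0 f ->
  spinor_ae_eq (fun x => dirac_op alpha v x - (l +i* m) *: v x) f ->
  dsol l m (realize v) (realize f).
Proof.
move=> hv hf e.
have v0 : in_spinor_L2 0 v by move=> k; have [] := hv k.
have w0 j : in_spinor_L2 0 (spinor_wpartial j v).
  move=> k; have [h _] := wpartialP j (hv k).
  rewrite (_ : component _ k = wpartial j (component v k)) //.
  by apply/funext => x; rewrite /component mxE.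
apply/dsolE; exists (fun j => realize (spinor_wpartial j v)); split=> [j i|].
  apply: weak_partial_pd; rewrite !realize_fun //.
  case: (split_ordP i) => k ->; rewrite ?rcompl ?rcompr; have [_ [a b]] := wpartialP j (hv k).
  - by move: a; rewrite (_ : (fun x => complex.Re (spinor_wpartial j v x k 0)) =
      (fun x => complex.Re (wpartial j (component v k) x))) //; apply/funext => x; rewrite mxE.
  - by move: b; rewrite (_ : (fun x => complex.Im (spinor_wpartial j v x k 0)) =
      (fun x => complex.Im (wpartial j (component v k) x))) //; apply/funext => x; rewrite mxE.
apply/ueqP => i z; apply/esym; apply: ip_aeq.
have E x : (\sum_j mact (rN alpha j) (realize (spinor_wpartial j v)) +
    mact (rB alpha - l%:M - m *: rJ) (realize v)) i x =
    rcomp (fun y => dirac_op alpha v y - (l +i* m) *: v y) i x.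
  have -> : rB alpha - l%:M - m *: rJ = rmx (alpha ord_max - (l +i* m)%:M).
    by rewrite rmxD rmxN rmx_scalar /= opprD addrA.
  rewrite ffunE L2DE mact_realize // sum_ffunE L2sumE.
  under eq_bigr do rewrite mact_realize //.
  rewrite -(rcomp_sum (fun j y => cN alpha j *m spinor_wpartial j v y)) -rcompD.
  rewrite /rcomp /dirac_op; congr (realcol _ i 0).
  rewrite mulmxBl mul_scalar_mx addrA; congr (_ + _ - _).
  by rewrite scaler_sumr; apply: eq_bigr => j _; rewrite -scalemxAl.
case: e => A [mA A0 HA]; exists A; split => // x /= h; apply: HA => /= e; apply: h.
by rewrite E realizeE // /rcomp e.
Qed.

Lemma spinor_sq_ge0 (s : R) u : (0 <= spinor_sq s u)%E.
Proof.
apply: sume_ge0 => k _; apply: integral_ge0 => x _.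
by rewrite lee_fin mulr_ge0 ?powR_ge0 // addr_ge0 ?sqr_ge0.
Qed.

Lemma spinor_sq_le (s s' : R) v : 0 <= s' <= s -> in_spinor_L2 0 v ->
  (spinor_sq (- s) v <= (sdot (realize v) (Bm (wt (- s')) (realize v)))%:E)%E.
Proof.
move=> /andP[s0 ss] hv; have mv i := in_spinor_measurable i hv.
have bw : bm (wt (- s') : E3 R -> R) by apply: bm_wt; rewrite oppr_le0.
rewrite spinor_sqE // /sdot -sumEFin; apply: lee_sum => i _.
rewrite BmE ipE /Rintegral fineK; last exact: integrable_fin_num (L2_int _ _).
apply: ge0_le_integral => //.
- by move=> x _; exact: wsq_ge0.
- exact: measurable_wsq.
- by apply/measurable_EFinP; apply: measurable_funM; exact: L2_measurable.
- move=> x _; rewrite lee_fin bmulE // realizeE //.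
  rewrite (mulrCA (rcomp v i x)) -(expr2 (rcomp v i x)).
  by rewrite ler_wpM2r ?sqr_ge0 // wt_le // lerN2.
Qed.

Lemma spinor_sq_triangle (s : R) u v : (forall i, measurable_fun setT (rcomp u i)) ->
  (forall i, measurable_fun setT (rcomp v i)) ->
  (spinor_sq s u <= 2%:E * spinor_sq s v + 2%:E * spinor_sq s (fun x => (v x - u x)%R))%E.
Proof.
move=> mu mv.
have D i x : rcomp (fun y => v y - u y) i x = rcomp v i x - rcomp u i x.
  have -> : (fun y => v y - u y) = (fun y => v y + (-1) *: u y) :> spinor R.
    by apply/funext => y; rewrite scaleN1r.
  rewrite rcompD; congr (_ + _); rewrite /rcomp /realcol.
  by case: (split_ordP i) => k ->; rewrite ?col_mxEu ?col_mxEd !mxE mulN1r; case: (u x k 0).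
have mD i : measurable_fun setT (rcomp (fun y => v y - u y) i).
  rewrite (_ : rcomp _ i = (fun x => rcomp v i x - rcomp u i x)); last exact/funext.
  exact: measurable_funB.
rewrite !spinor_sqE // !ge0_sume_distrr; try (by move=> i _; apply: integral_ge0 => x _; exact: wsq_ge0).
rewrite -big_split; apply: lee_sum => i _ /=.
rewrite -!ge0_integralZl //; try exact: measurable_wsq; try (by move=> x _; exact: wsq_ge0).
rewrite -ge0_integralD //; try (by move=> x _; rewrite mule_ge0 // wsq_ge0);
  try (by apply: measurable_funeM; exact: measurable_wsq).
apply: ge0_le_integral => //.
- by move=> x _; exact: wsq_ge0.
- exact: measurable_wsq.
- by apply: emeasurable_funD; apply: measurable_funeM; exact: measurable_wsq.
- move=> x _; rewrite -!EFinM -EFinD lee_fin D.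
  have := wt_gt0 s x; set w := wt s x => w0.
  set a := rcomp u i x; set b := rcomp v i x.
  (* [2 b^2 + 2 (b - a)^2 - a^2] is exactly this square. *)
  have : 0 <= w * (2 * b - a) ^+ 2 by rewrite mulr_ge0 ?sqr_ge0 // ltW.
  nra.
Qed.

Lemma spinor_norm_lt (s e : R) u : 0 < e ->
  (spinor_norm s u < e%:E)%E <-> (spinor_sq s u < (e ^+ 2)%:E)%E.
Proof.
move=> e0; rewrite /spinor_norm -/(spinor_sq s u); have := spinor_sq_ge0 s u.
case: (spinor_sq s u) => [r| |] // r0; last by rewrite poweRyr //; split.
rewrite poweR_EFin powR12_sqrt // !lte_fin.
have e2 : 0 < e ^+ 2 by exact: exprn_gt0.
by have := ltr_sqrt r e2; rewrite sqrtr_sqr (ger0_norm (ltW e0)) => ->.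
Qed.
End transfer.

(** * Passage to the boundary values *)

Section weighted_limit.
Context {R : realType} (alpha : 'I_4 -> 'M[R[i]]_4).
Hypothesis halpha : dirac_matrices alpha.
Variable R0 : R[i] -> spinor R -> spinor R.
Hypothesis hR0 : forall z : R[i], complex.Im z != 0 -> dirac_resolvent alpha z (R0 z).
Local Notation V := (L2 (@leb3 R)).
Local Notation U := {ffun 'I_(4 + 4) -> V}.

Lemma real_resolvent_exists (l m : R) (f : U) : m != 0 ->
  exists u, dsol (rN alpha) (rB alpha) rJ l m u f.
Proof.
move=> m0; have [H _] := hR0 (z := l +i* m) m0.
have [h1 e] := H _ (cplx_L2 f).
exists (realize (R0 (l +i* m) (cplx f))); rewrite -{2}(realize_cplx f).
exact: dirac_dsol h1 (cplx_L2 f) e.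
Qed.

Lemma resolvent_vanish (s : R) (f : spinor R) (e : R) : 2^-1 < s -> in_spinor_L2 s f -> 0 < e ->
  exists L : R, forall l m : R, L <= `|l| -> 0 < `|m| <= 1 ->
    in_spinor_L2 0 (R0 (l +i* m) f) /\ (spinor_sq (- s) (R0 (l +i* m) f) <= e%:E)%E.
Proof.
move=> s12 hf e0.
(* The estimates need an exponent below 1; lowering it enlarges the space of data and strengthens
   the norm of the conclusion. *)
pose s' := Num.min s (3 / 4).
have s'12 : 2^-1 < s' < 1.
  rewrite lt_min s12 /= gt_min; apply/andP; split; first by lra.
  by apply/orP; right; lra.
have s's : s' <= s by rewrite ge_min lexx.
have s'0 : 0 <= s' by have /andP[h _] := s'12; apply: le_trans (ltW h); rewrite invr_ge0.
have /in_spinor_L2P[mf iF] := hf.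
have wle (t : R) i : t <= s -> (\int[leb3]_x (wt t x * rcomp f i x ^+ 2)%:E < +oo)%E.
  move=> ts; apply: le_lt_trans (iF i); apply: ge0_le_integral => //.
  - by move=> x _; exact: wsq_ge0.
  - exact: measurable_wsq.
  - exact: measurable_wsq.
  - by move=> x _; rewrite lee_fin ler_wpM2r ?sqr_ge0 // wt_le.
have f0 : in_spinor_L2 0 f.
  by apply/in_spinor_L2P; split => // i; apply: wle; exact: le_trans s's.
pose F i : E3 R -> R := fun x => wt (s' / 2) x * rcomp f i x.
have Fi i : F i \in sqint (@leb3 R).
  apply/sqintP; split; first by apply: measurable_funM => //; exact: measurable_wt.
  have -> : (\int[leb3]_x (F i x ^+ 2)%:E = \int[leb3]_x (wt s' x * rcomp f i x ^+ 2)%:E)%E.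
    by apply: eq_integral => x _; rewrite /F exprMn (expr2 (wt _ _)) wtM -splitr.
  exact: wle.
pose f' : U := [ffun i => MkL2 (Fi i)].
have ff' : ueq (realize f) (Bm (wt (- (s' / 2))) f').
  suff -> : realize f = Bm (wt (- (s' / 2))) f' by [].
  apply/ffunP => i; rewrite BmE; apply: L2_eqP => x; rewrite realizeE //.
  rewrite bmulE; last by apply: bm_wt; rewrite oppr_le0 divr_ge0.
  by rewrite ffunE /= /F mulrA wtM addNr wt0 mul1r.
have [L HL] := resolvent_to_zero (rN_anti halpha) (rB_sym halpha) rJ_anti (rNN halpha)
  (rNB halpha) (rBB halpha) rJJ (rNJ alpha) (rBJ alpha) s'12 real_resolvent_exists f' e0.
exists L => l m lL m1.
have m0 : m != 0 by have /andP[h _] := m1; rewrite -normr_gt0.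
have [H _] := hR0 (z := l +i* m) m0; have [h1 ae] := H _ f0.
have v0 : in_spinor_L2 0 (R0 (l +i* m) f) by move=> k; have [] := h1 k.
split => //; have ss : 0 <= s' <= s by rewrite s'0.
apply: le_trans (spinor_sq_le ss v0) _; rewrite lee_fin.
exact: HL lL m1 ff' (dirac_dsol h1 f0 ae).
Qed.

(** The bound of [resolvent_vanish] is uniform in the imaginary part, so for each [lam] a single
    [mu] close enough to 0 suffices, and the threshold on [|lam|] does not depend on it. *)
Lemma extended_resolvent_vanish (s sigma : R) (T : R -> spinor R -> spinor R) (f : spinor R)
    (eps : R) : 2^-1 < s -> `|sigma| = 1 ->
  (forall lam : R, 1 < `|lam| -> extended_resolvent R0 s sigma lam (T lam)) ->
  in_spinor_L2 s f -> 0 < eps ->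
  exists M : R, forall lam : R, M < `|lam| -> (spinor_norm (- s) (T lam f) < eps%:E)%E.
Proof.
move=> s12 sg hT hf eps0.
(* The triangle inequality for squares then gives [2 e + 2 (eps / 2)^2], which is [3 / 4] of
   [eps ^+ 2]. *)
pose e := eps ^+ 2 / 8; have e0 : 0 < e by rewrite divr_gt0 // exprn_gt0.
have [L HL] := resolvent_vanish s12 hf e0.
exists (Num.max 1 L) => lam; rewrite gt_max => /andP[l1 lL].
have [[TL2 _ _] cv] := hT lam l1; have {}cv := cv f hf.
have d0 : 0 < eps / 2 by rewrite divr_gt0.
have : \forall mu \near 0^'+,
    (spinor_norm (- s) (fun x => (R0 (lam +i* (sigma * mu)) f x - T lam f x)%R) < (eps / 2)%:E)%E.
  apply: (cv [set x | (x < (eps / 2)%:E)%E]).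
  by apply: open_nbhs_nbhs; split; [exact: open_ereal_lt_ereal|rewrite /= lte_fin].
move=> near1.
have : \forall mu \near (0 : R)^'+, 0 < mu /\ mu <= 1 /\
    (spinor_norm (- s) (fun x => (R0 (lam +i* (sigma * mu)) f x - T lam f x)%R) < (eps / 2)%:E)%E.
  near=> mu; split; first by near: mu; exact: nbhs_right_gt.
  by split; near: mu; [exact: nbhs_right_le|exact: near1].
move=> /filter_ex[mu [mu0 [mu1 hm]]].
have sm : 0 < `|sigma * mu| <= 1 by rewrite normrM sg mul1r gtr0_norm // mu0.
have [v0 hv] := HL lam (sigma * mu) (ltW lL) sm.
apply/(spinor_norm_lt (- s) _ eps0); move/(spinor_norm_lt (- s) _ d0) : hm => hm.
apply: le_lt_trans (spinor_sq_triangle (- s) (u := T lam f) (v := R0 (lam +i* (sigma * mu)) f) _ _) _.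
- by move=> i; apply: (@in_spinor_measurable _ (- s)); exact: TL2.
- by move=> i; apply: (@in_spinor_measurable _ 0).
have two : (0 <= 2%:E :> \bar R)%E by rewrite lee_fin.
apply: le_lt_trans (leeD (lee_wpmul2l two hv) (lee_wpmul2l two (ltW hm))) _.
rewrite -!EFinM -EFinD lte_fin /e.
have -> : 2 * (eps ^+ 2 / 8) + 2 * (eps / 2) ^+ 2 = 3 / 4 * eps ^+ 2 by field.
have : 0 < eps ^+ 2 by exact: exprn_gt0.
by lra.
Unshelve. all: by end_near. Qed.
End weighted_limit.

Theorem theorem2p5 (R : realType) (alpha : 'I_4 -> 'M[R[i]]_4)
    (halpha : dirac_matrices alpha)
    (R0 : R[i] -> spinor R -> spinor R)
    (hR0 : forall z : R[i], complex.Im z != 0 -> dirac_resolvent alpha z (R0 z))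
    (s : R) (hs : 2^-1 < s)
    (Rplus Rminus : R -> spinor R -> spinor R)
    (hRplus : forall lam : R, 1 < `|lam| ->
       extended_resolvent R0 s 1 lam (Rplus lam))
    (hRminus : forall lam : R, 1 < `|lam| ->
       extended_resolvent R0 s (-1) lam (Rminus lam))
    (f : spinor R) (hf : in_spinor_L2 s f) :
  forall eps : R, 0 < eps -> exists M : R, forall lam : R, M < `|lam| ->
    (spinor_norm (- s) (Rplus lam f) < eps%:E)%E /\
    (spinor_norm (- s) (Rminus lam f) < eps%:E)%E.
Proof.
move=> eps eps0.
have n1 : `|1 : R| = 1 by rewrite normr1.
have m1 : `|-1 : R| = 1 by rewrite normrN1.
have [M1 H1] := extended_resolvent_vanish halpha hR0 hs n1 hRplus hf eps0.
have [M2 H2] := extended_resolvent_vanish halpha hR0 hs m1 hRminus hf eps0.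
exists (Num.max M1 M2) => lam; rewrite gt_max => /andP[l1 l2].
by split; [exact: H1|exact: H2].
Qed.
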